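(* Let $0<\epsilon\le1$ and $k<n/2$. There exists a deterministic EMD/EMD recovery scheme for sparsity $k$ with sketch length $m=O\!\left(\frac{1}{\epsilon^2}k\log(n/k)\right)$ and approximation factor $C=O(\epsilon\sqrt{\log(n/k)})$: there is an $m\times n$ matrix $A$ and a recovery algorithm which, for every $x\in\mathbb{R}_+^n$, given $Ax$ outputs $x^*$ with $\|x-x^*\|_{EMD}\le C\min_{k\text{-sparse }x'}\|x-x'\|_{EMD}$. Recovery takes $O(k^2n\log^c n)$ time for some constant $c$.
   Context: Let $\Delta$ be a power of $2$ and $n=\Delta^2$; vectors in $\mathbb{R}^n$ are identified with functions $[\Delta]\times[\Delta]\to\mathbb{R}$ (images), and $\mathbb{R}_+^n$ denotes the nonnegative ones. A vector is $k$-sparse if it has at most $k$ nonzero coordinates. For nonnegative $x,y\in\mathbb{R}^n$ with $\|x\|_1=\|y\|_1$, let $\mathrm{EMD}^*(x,y)=\min_\gamma\sum_{i,j\in[\Delta]^2}\gamma(i,j)\|i-j\|_1$, the minimum over all $\gamma:[\Delta]^2\times[\Delta]^2\to\mathbb{R}_+$ with $\sum_{l}\gamma(i,l)=x_i$ and $\sum_l\gamma(l,j)=y_j$. For general $w\in\mathbb{R}^n$, $\|w\|_{EMD}=\min\{\mathrm{EMD}^*(x,y)+2\Delta\|z\|_1: x-y+z=w,\ x,y\ge 0,\ \|x\|_1=\|y\|_1\}$. *)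

(* Defs.v *)
From HB Require Import structures.
From mathcomp Require Import all_boot all_order all_algebra.
From mathcomp Require Import boolp classical_sets reals exp.
Set Implicit Arguments.
Unset Strict Implicit.
Unset Printing Implicit Defensive.
Import Order.TTheory GRing.Theory Num.Theory.
Local Open Scope ring_scope.
Local Open Scope classical_set_scope.

(** * Earth mover distance on images

    An image [D] x [D] -> R is a column vector of length D ^ 2 in row-major
    order: coordinate i is the pixel (i %/ D, i %% D). *)

Definition pixel_dist (D : nat) (i j : 'I_(D ^ 2)) : nat :=
  (`|(i %/ D)%:Z - (j %/ D)%:Z| + `|(i %% D)%:Z - (j %% D)%:Z|)%N.

Section EMD.
Context {R : realType}.

Definition nonneg (n : nat) (x : 'cV[R]_n) : Prop := forall i, 0 <= x i 0.

Definition l1norm (n : nat) (x : 'cV[R]_n) : R := \sum_i `|x i 0|.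

Definition sparse (n k : nat) (x : 'cV[R]_n) : Prop :=
  (#|[set i | x i 0%R != 0%R]%SET| <= k)%N.

Definition coupling (n : nat) (x y : 'cV[R]_n) (g : 'M[R]_n) : Prop :=
  [/\ forall i j, 0 <= g i j,
      forall i, \sum_l g i l = x i 0
    & forall j, \sum_l g l j = y j 0].

Definition transport_cost (D : nat) (g : 'M[R]_(D ^ 2)) : R :=
  \sum_i \sum_j g i j * (pixel_dist i j)%:R.

(** The three minima below are written as infima of sets of nonnegative reals;
    [emd_star] is only meaningful, and only used, for nonnegative [x], [y] with
    the same l1 norm, which is when a coupling exists. *)
Definition emd_star (D : nat) (x y : 'cV[R]_(D ^ 2)) : R :=
  inf [set transport_cost g | g in [set g | coupling x y g]].

Definition emd_norm (D : nat) (w : 'cV[R]_(D ^ 2)) : R :=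
  inf [set r : R | exists x y z : 'cV[R]_(D ^ 2),
    [/\ x - y + z = w, nonneg x, nonneg y, l1norm x = l1norm y
      & r = emd_star x y + 2 * D%:R * l1norm z]].

Definition emd_sparse_err (D k : nat) (x : 'cV[R]_(D ^ 2)) : R :=
  inf [set emd_norm (x - x') | x' in [set x' | sparse k x']].

End EMD.

(** * A real RAM

    Programs manipulate finitely many unbounded arrays of natural numbers and
    finitely many unbounded arrays of reals, with indirect addressing. Every
    arithmetic operation, memory access, comparison and assignment has unit cost.
    Two standard restrictions keep unit cost honest: the integer operations are
    only addition and truncated subtraction (with multiplication, integers with
    exponentially many bits could be built), and there is no rounding of a real
    to an integer. The only constants are natural numbers. *)

Inductive iexp : Type :=
  | IConst of nat
  | IRead of nat & iexp
  | IAdd of iexp & iexp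
  | ISub of iexp & iexp.

Inductive rexp : Type :=
  | RInt of iexp
  | RRead of nat & iexp
  | RAdd of rexp & rexp
  | RSub of rexp & rexp
  | RMul of rexp & rexp
  | RDiv of rexp & rexp.

Inductive bexp : Type :=
  | BILe of iexp & iexp
  | BRLe of rexp & rexp
  | BNot of bexp.

(** [ISet a i e] is a[i] := e in integer array number a, and [RSet] likewise for
    the real arrays. *)
Inductive cmd : Type :=
  | Skip
  | ISet of nat & iexp & iexp
  | RSet of nat & iexp & rexp
  | Seq of cmd & cmd
  | If of bexp & cmd & cmd
  | While of bexp & cmd.

Fixpoint icost (e : iexp) : nat :=
  match e with
  | IConst _ => 1
  | IRead _ e1 => (icost e1).+1
  | IAdd e1 e2 | ISub e1 e2 => (icost e1 + icost e2).+1
  end.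

Fixpoint rcost (e : rexp) : nat :=
  match e with
  | RInt e1 | RRead _ e1 => (icost e1).+1
  | RAdd e1 e2 | RSub e1 e2 | RMul e1 e2 | RDiv e1 e2 =>
      (rcost e1 + rcost e2).+1
  end.

Fixpoint bcost (b : bexp) : nat :=
  match b with
  | BILe e1 e2 => (icost e1 + icost e2).+1
  | BRLe e1 e2 => (rcost e1 + rcost e2).+1
  | BNot b1 => (bcost b1).+1
  end.

Section RAM.
Context {R : realType}.

Record state : Type := State {
  imem : nat -> nat -> nat;
  rmem : nat -> nat -> R
}.

Definition upd (T : Type) (mem : nat -> nat -> T) (a i : nat) (v : T) :
    nat -> nat -> T :=
  fun b j => if (b == a) && (j == i) then v else mem b j.

Fixpoint ieval (s : state) (e : iexp) : nat :=
  match e with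
  | IConst c => c
  | IRead a e1 => imem s a (ieval s e1)
  | IAdd e1 e2 => (ieval s e1 + ieval s e2)%N
  | ISub e1 e2 => (ieval s e1 - ieval s e2)%N
  end.

Fixpoint reval (s : state) (e : rexp) : R :=
  match e with
  | RInt e1 => (ieval s e1)%:R
  | RRead a e1 => rmem s a (ieval s e1)
  | RAdd e1 e2 => reval s e1 + reval s e2
  | RSub e1 e2 => reval s e1 - reval s e2
  | RMul e1 e2 => reval s e1 * reval s e2
  | RDiv e1 e2 => reval s e1 / reval s e2
  end.

Fixpoint beval (s : state) (b : bexp) : bool :=
  match b with
  | BILe e1 e2 => (ieval s e1 <= ieval s e2)%N
  | BRLe e1 e2 => reval s e1 <= reval s e2
  | BNot b1 => ~~ beval s b1
  end.

(** [exec c s t s']: started in [s], the program [c] halts in [s'] after [t]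
    steps. *)
Inductive exec : cmd -> state -> nat -> state -> Prop :=
  | ExecSkip s : exec Skip s 1 s
  | ExecISet a i e s :
      exec (ISet a i e) s (icost i + icost e).+1
        (State (upd (imem s) a (ieval s i) (ieval s e)) (rmem s))
  | ExecRSet a i e s :
      exec (RSet a i e) s (icost i + rcost e).+1
        (State (imem s) (upd (rmem s) a (ieval s i) (reval s e)))
  | ExecSeq c1 c2 s t1 s1 t2 s2 :
      exec c1 s t1 s1 -> exec c2 s1 t2 s2 -> exec (Seq c1 c2) s (t1 + t2) s2
  | ExecIf b c1 c2 s t s' :
      exec (if beval s b then c1 else c2) s t s' ->
      exec (If b c1 c2) s (bcost b + t) s'
  | ExecWhileFalse b c s :
      ~~ beval s b -> exec (While b c) s (bcost b) s
  | ExecWhileTrue b c s t1 s1 t2 s2 :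
      beval s b -> exec c s t1 s1 -> exec (While b c) s1 t2 s2 ->
      exec (While b c) s (bcost b + t1 + t2) s2.

Lemma exec_det c s t s' : exec c s t s' ->
  forall u s'', exec c s u s'' -> u = t /\ s'' = s'.
Proof.
elim=> {c s t s'}.
- by move=> s u s'' H; inversion H.
- by move=> a i e s u s'' H; inversion H.
- by move=> a i e s u s'' H; inversion H.
- move=> c1 c2 s t1 s1 t2 s2 _ IH1 _ IH2 u s'' H; inversion H; subst.
  match goal with H1 : exec c1 s _ _ |- _ => case: (IH1 _ _ H1) => ? ? end.
  subst.
  by match goal with H2 : exec c2 s1 _ _ |- _ => case: (IH2 _ _ H2) => -> -> end.
- move=> b c1 c2 s t s' _ IH u s'' H; inversion H; subst.
  by match goal with H1 : exec (if _ then _ else _) s _ _ |- _ =>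
    case: (IH _ _ H1) => -> -> end.
- move=> b c s nb u s'' H; inversion H; subst => //.
  by match goal with H1 : is_true (beval s b) |- _ => rewrite H1 in nb end.
- move=> b c s t1 s1 t2 s2 tb _ IH1 _ IH2 u s'' H; inversion H; subst.
    by match goal with H1 : is_true (~~ beval _ b) |- _ => rewrite tb in H1 end.
  match goal with H1 : exec c s _ _ |- _ => case: (IH1 _ _ H1) => ? ? end.
  subst.
  by match goal with H2 : exec (While b c) s1 _ _ |- _ =>
    case: (IH2 _ _ H2) => -> -> end.
Qed.

(** The recovery algorithm knows the parameters and the sketching matrix, and
    receives the sketch [y]. The matrix is stored as the list of its nonzero
    entries, sorted by columns: this holds the same data as the full m x n table,
    but an algorithm need not spend m * n steps just to find the nonzero entries
    of a sparse matrix. Unused cells contain 0. *)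
Definition nz_entries (m n : nat) (A : 'M[R]_(m, n)) : seq ('I_m * 'I_n) :=
  [seq ij <- [seq (i, j) | j <- enum 'I_n, i <- enum 'I_m] | A ij.1 ij.2 != 0].

Definition ram_input (D k : nat) (eps : R) (m : nat) (A : 'M[R]_(m, D ^ 2))
    (y : 'cV[R]_m) : state :=
  let nz := nz_entries A in
  State
    (fun a => nth 0%N
      match a with
      | 0 => [:: D; k; m; size nz]
      | 1 => [seq nat_of_ord ij.1 | ij <- nz]
      | 2 => [seq nat_of_ord ij.2 | ij <- nz]
      | _ => [::]
      end)
    (fun a => nth 0
      match a with
      | 0 => [:: eps]
      | 1 => [seq A ij.1 ij.2 | ij <- nz]
      | 2 => [seq y i 0 | i <- enum 'I_m]
      | _ => [::]
      end).

Definition ram_output (n : nat) (s : state) : 'cV[R]_n := \col_i rmem s 3 i.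

End RAM.

(* Main.v *)
(** Telescoping along a quadtree writes the image [x] as a sum of dipoles, one for
    each cell: the mass [mu] of a cell of side [2 ^ l] moves from the corner of the
    cell to the corner of its parent, at distance at most [4 * 2 ^ l]. Hence, with
    weights [w = 2 ^ l * mu], estimating the weights of the cells with small l1
    error recovers [x] with small EMD error. If [x'] is k-sparse, then the total
    weight of the cells further than [s] cell sides from the support of [x'] is at
    most [2 / s] times the EMD norm of [x - x']. The cells are split into [s ^ 2]
    classes according to their coordinates modulo [s]; then in each class only
    [K = O (k log (n / k))] cells are close to the support, and each class is
    treated by l1/l1 sparse recovery, with an error at most
    [O (sqrt (1 + B / Lam))] times the tail from [O (Lam * K)] measurements, where
    [B = O (log (n / k))].

    This recovery uses two matrices. The adjacency matrix of an expander gives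
    overestimates of the weights; the [4 * K] largest ones contain all cells but
    some of weight at most [tail / K]. On the picked cells one solves a least
    squares problem for a random sign matrix, which is a restricted isometry, and
    which does not blow up the remaining flat vector.

    If [eps ^ -2 >= log (n / k)] one takes [s ^ 2] of the order of
    [eps ^ -2 / log (n / k)] and [Lam] of the order of [log (n / k)]. Otherwise
    [s = 1] and [Lam] is of the order of [eps ^ -2] only: this is enough because
    the weights decrease from parents to children, so that the picked sets are
    closed under parents, and there are only [exp (O (K))] such sets.

    The program does not depend on the matrix, so the matrix tells it what to do:
    the first rows store a description of the scheme. *)

Require Import Defs.
From mathcomp Require Import all_boot all_order all_algebra.
From mathcomp Require Import boolp reals sequences exp.
From mathcomp Require Import zify ring lra.
Set Implicit Arguments.
Unset Strict Implicit.
Unset Printing Implicit Defensive.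
Import Order.TTheory GRing.Theory Num.Theory.
Local Open Scope ring_scope.

(** * Running programs *)

(** For small [eps] the factor [eps * sqrt (log (n / k))] falls below any constant, so losing a
    constant factor against the best k-sparse image is too much. The gain is possible because the
    output need not be sparse: all cells within [s] cell sides of the support are decoded, and mass
    further away must travel [s] cell sides, so its weight is only a [1 / s] fraction of its
    transport cost. The lower bound on the norm used here is the easy half of Kantorovich duality,
    with the distance to the support as potential; the upper bound on the error is the cost of
    explicit dipoles. The quadtree is cut at the first level [H] with at most [s ^ 2 * k] cells.
    They are measured exactly, so only [O (log (n / k))] levels remain, which is why [K] involves
    log (n / k) and not log n. The advice is affordable because there are only [O (n)] cells in all
    and one row stores [n] numbers: up to a constant, as many rows as one class has measurements are
    enough. Both matrices exist by counting: sums of nonnegative tests over all candidates take the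
    place of probabilities. *)

Arguments upd T mem a i v b j /.

Section Runs.
Context {R : realType}.
Implicit Types (s : @state R) (c : cmd).

Definition runs c s T (Q : state -> Prop) : Prop :=
  exists t s', [/\ exec c s t s', (t <= T)%N & Q s'].

(** The arrays a program may write are read off its text, so that frame conditions reduce to
    membership tests that compute. *)
Fixpoint written_int c : seq nat :=
  match c with
  | ISet a _ _ => [:: a]
  | Seq c1 c2 | If _ c1 c2 => written_int c1 ++ written_int c2
  | While _ c1 => written_int c1
  | _ => [::]
  end.

Fixpoint written_real c : seq nat :=
  match c with
  | RSet a _ _ => [:: a]
  | Seq c1 c2 | If _ c1 c2 => written_real c1 ++ written_real c2
  | While _ c1 => written_real c1
  | _ => [::]
  end.

Definition same_off (li lr : seq nat) s s' : Prop :=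
  (forall a, a \notin li -> imem s' a = imem s a) /\
  (forall a, a \notin lr -> rmem s' a = rmem s a).

Lemma same_off_trans li lr s1 s2 s3 :
  same_off li lr s1 s2 -> same_off li lr s2 s3 -> same_off li lr s1 s3.
Proof.
move=> [i1 r1] [i2 r2]; split=> a aN; first by rewrite i2 // i1.
by rewrite r2 // r1.
Qed.

Lemma same_off_sub li lr li' lr' s s' :
  {subset li <= li'} -> {subset lr <= lr'} ->
  same_off li lr s s' -> same_off li' lr' s s'.
Proof.
move=> si sr [ii rr]; split=> a aN; [apply: ii | apply: rr];
  by apply: contra aN => /si || by apply: contra aN => /sr.
Qed.

Lemma exec_same_off c s t s' :
  exec c s t s' -> same_off (written_int c) (written_real c) s s'.
Proof.
elim=> {c s t s'} //=.
- move=> a i e s; split=> b //=; rewrite inE => ba.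
  by apply/boolp.funext=> j; rewrite /upd (negPf ba).
- move=> a i e s; split=> b //=; rewrite inE => ba.
  by apply/boolp.funext=> j; rewrite /upd (negPf ba).
- move=> c1 c2 s t1 s1 t2 s2 _ IH1 _ IH2.
  by apply: same_off_trans (same_off_sub _ _ IH1) (same_off_sub _ _ IH2) => a;
    rewrite mem_cat => ->; rewrite ?orbT.
- move=> b c1 c2 s t s' _; case: (beval s b) => IH;
  by apply: same_off_sub IH => a; rewrite mem_cat => ->; rewrite ?orbT.
- move=> b c s t1 s1 t2 s2 _ _ IH1 _ IH2; exact: same_off_trans IH1 IH2.
Qed.

Lemma runs_frame c s T Q :
  runs c s T Q ->
  runs c s T (fun s' => Q s' /\
                        same_off (written_int c) (written_real c) s s').
Proof.
by move=> [t [s' [e tT q]]]; exists t, s'; split=> //; split=> //;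
   exact: exec_same_off e.
Qed.

Lemma runs_le c s T T' (Q Q' : state -> Prop) : runs c s T Q ->
  (T <= T')%N -> (forall s', Q s' -> Q' s') -> runs c s T' Q'.
Proof.
move=> [t [s' [e tT q]]] TT' QQ'; exists t, s'; split=> //; last exact: QQ'.
exact: leq_trans TT'.
Qed.

Lemma runs_skip s (Q : state -> Prop) : Q s -> runs Skip s 1 Q.
Proof. by move=> q; exists 1%N, s; split=> //; constructor. Qed.

Lemma runs_iset a i e s (Q : state -> Prop) :
  Q (State (upd (imem s) a (ieval s i) (ieval s e)) (rmem s)) ->
  runs (ISet a i e) s (icost i + icost e).+1 Q.
Proof. by move=> q; eexists _, _; split; [constructor| |exact: q]. Qed.

Lemma runs_rset a i e s (Q : state -> Prop) :
  Q (State (imem s) (upd (rmem s) a (ieval s i) (reval s e))) ->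
  runs (RSet a i e) s (icost i + rcost e).+1 Q.
Proof. by move=> q; eexists _, _; split; [constructor| |exact: q]. Qed.

Lemma runs_seq c1 c2 s T1 T2 Q :
  runs c1 s T1 (fun s1 => runs c2 s1 T2 Q) -> runs (Seq c1 c2) s (T1 + T2) Q.
Proof.
move=> [t1 [s1 [e1 l1 [t2 [s2 [e2 l2 q]]]]]]; exists (t1 + t2)%N, s2.
by split=> //; [apply: ExecSeq e1 e2 | exact: leq_add].
Qed.

Lemma runs_if b c1 c2 s T Q :
  (beval s b -> runs c1 s T Q) -> (~~ beval s b -> runs c2 s T Q) ->
  runs (If b c1 c2) s (bcost b + T) Q.
Proof.
move=> h1 h2; have : runs (if beval s b then c1 else c2) s T Q.
  by case: (boolP (beval s b)).
move=> [t [s' [e l q]]]; exists (bcost b + t)%N, s'; split=> //.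
  exact: ExecIf.
by rewrite leq_add2l.
Qed.

(** The invariant is indexed by the number of completed turns, which yields termination and cost at
    once: exactly [N] turns and [N + 1] tests. *)
Lemma runs_while b c N T (inv : nat -> state -> Prop) s Q :
  inv 0%N s ->
  (forall j s, (j < N)%N -> inv j s ->
     beval s b /\ runs c s T (inv j.+1)) ->
  (forall s, inv N s -> ~~ beval s b) ->
  (forall s, inv N s -> Q s) ->
  runs (While b c) s (N * (bcost b + T) + bcost b) Q.
Proof.
move=> i0 step stop fin.
suff H : forall d j s1, (j + d = N)%N -> inv j s1 ->
    runs (While b c) s1 (d * (bcost b + T) + bcost b) Q by exact: H i0.
elim=> [|d IH] j s1 jd ij.
  rewrite addn0 in jd; subst j; exists (bcost b), s1; split=> //.
  - by constructor; exact: stop.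
  - exact: fin.
have jN : (j < N)%N by lia.
have [bt [t1 [s2 [e1 l1 i2]]]] := step _ _ jN ij.
have [t2 [s3 [e2 l2 q]]] := IH j.+1 s2 ltac:(lia) i2.
exists (bcost b + t1 + t2)%N, s3; split=> //.
  exact: ExecWhileTrue bt e1 e2.
by rewrite mulSn; lia.
Qed.

Lemma runs_time c s T T' Q : runs c s T Q -> (T <= T')%N -> runs c s T' Q.
Proof. by move=> h TT'; apply: runs_le h TT' _. Qed.

Lemma runs_post c s T (Q Q' : state -> Prop) :
  runs c s T Q ->
  (forall s', Q s' -> same_off (written_int c) (written_real c) s s' -> Q' s') ->
  runs c s T Q'.
Proof.
by move=> h QQ'; apply: runs_le (runs_frame h) (leqnn _) _ => s' [q o]; exact: QQ'.
Qed.

Lemma runs_seqf c1 c2 s T1 T2 (P Q : state -> Prop) :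
  runs c1 s T1 P ->
  (forall s1, P s1 -> same_off (written_int c1) (written_real c1) s s1 ->
     runs c2 s1 T2 Q) ->
  runs (Seq c1 c2) s (T1 + T2) Q.
Proof. by move=> h1 h2; apply: runs_seq; exact: runs_post h1 h2. Qed.

End Runs.

(* Scalars are cells number 0 of arrays of their own, so that distinct variables
   are distinct arrays and reads commute with writes by computation. *)
Notation "'%' a" := (IRead a (IConst 0)) (at level 8, a at level 0, format "'%' a").
Definition set_int (a : nat) (e : iexp) : cmd := ISet a (IConst 0) e.
Definition set_real (a : nat) (e : rexp) : cmd := RSet a (IConst 0) e.
Definition incr (a : nat) (e : iexp) : cmd := set_int a (IAdd (% a) e).
Definition for_loop (i : nat) (N : iexp) (c : cmd) : cmd :=
  Seq (set_int i (IConst 0))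
      (While (BNot (BILe N (% i))) (Seq c (incr i (IConst 1)))).

Section ForLoop.
Context {R : realType}.
Implicit Types (s : @state R) (c : cmd).

(** The bound [N] is evaluated anew at every test, hence the hypothesis that it keeps the value
    [Nv]; the invariant must ignore the counter, which changes outside the body. The 10 is 4 for the
    rest of the test and 6 for the increment. *)
Lemma runs_for i N c s Nv T (inv : nat -> state -> Prop) (Q : state -> Prop) :
  i \notin written_int c ->
  (forall j s1 v, inv j s1 ->
     inv j (State (upd (imem s1) i 0%N v) (rmem s1))) ->
  inv 0%N s ->
  (forall j s1, (j < Nv)%N -> inv j s1 -> imem s1 i 0%N = j ->
     same_off (i :: written_int c) (written_real c) s s1 ->
     runs c s1 T (inv j.+1)) ->
  (forall j s1, (j <= Nv)%N -> inv j s1 ->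
     same_off (i :: written_int c) (written_real c) s s1 ->
     ieval s1 N = Nv) ->
  (forall s1, inv Nv s1 -> Q s1) ->
  runs (for_loop i N c) s
    (3 + (Nv * (icost N + T + 10) + (icost N + 4)))%N Q.
Proof.
move=> ic clo i0 step bnd fin.
pose inv' j s1 := [/\ inv j s1, imem s1 i 0%N = j &
  same_off (i :: written_int c) (written_real c) s s1].
apply: runs_seq; apply: (@runs_le _ _ _ _ _ _ _ _ (leqnn _) (fun _ H => H)).
have H := @runs_iset _ i (IConst 0) (IConst 0) s.
apply: runs_le (H _ _) (leqnn _) (fun _ H => H) => {H}.
have off1 s1 v : same_off (i :: written_int c) (written_real c) s1
    (State (upd (imem s1) i 0%N v) (rmem s1)).
  split=> a //=; rewrite inE negb_or => /andP[ai _].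
  by apply/boolp.funext=> j; rewrite /upd (negPf ai).
apply: (@runs_le _ _ _ (Nv * (icost N + 4 + (T + 6)) + (icost N + 4))%N _ Q Q).
- have -> : (icost N + 4 = bcost (BNot (BILe N (% i))))%N by rewrite /=; lia.
  apply: (@runs_while _ _ _ _ _ inv').
  + split; [exact: clo | by rewrite /= /upd !eqxx | exact: off1].
  + move=> j s1 jN [ij eij off]; split.
      have eN := bnd j s1 (ltnW jN) ij off.
      by rewrite /= eN eij -ltnNge.
    apply: runs_seq.
    apply: runs_le (runs_frame (step _ _ jN ij eij off)) (leqnn _) _.
    move=> s2 [ij' off2].
    have eij2 : imem s2 i 0%N = j by rewrite off2.1.
    have H := @runs_iset _ i (IConst 0) (IAdd (% i) (IConst 1)) s2.
    apply: runs_le (H _ _) (leqnn _) (fun _ H => H) => {H}.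
    split; first exact: clo.
      by rewrite /= /upd !eqxx /= eij2 addn1.
    apply: same_off_trans off _; apply: same_off_trans (off1 _ _).
    by apply: same_off_sub off2 => // a; rewrite inE orbC => ->.
  + by move=> s1 [ij eij off]; rewrite /= (bnd Nv) //= eij leqnn.
  + by move=> s1 [ij _ _]; exact: fin.
- by nia.
- by [].
Qed.

End ForLoop.

(** * The recovery program *)

(** Numbers of integer arrays; 0 to 2 hold the input. Names in [v] are scalars, names in [a] are
    genuine arrays. *)
Notation vn := 10%N (only parsing).
Notation vacc := 11%N (only parsing).
Notation amul := 12%N (only parsing).
Notation apw := 13%N (only parsing).
Notation vnb := 14%N (only parsing).
Notation vi := 15%N (only parsing).
Notation vb := 16%N (only parsing).
Notation vS := 17%N (only parsing).
Notation vR1 := 18%N (only parsing).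
Notation vR2 := 19%N (only parsing).
Notation vNT := 20%N (only parsing).
Notation vap := 21%N (only parsing).
Notation vyp := 22%N (only parsing).
Notation vpos := 23%N (only parsing).
Notation vneg := 24%N (only parsing).
Notation vo := 26%N (only parsing).
Notation vNN := 27%N (only parsing).
Notation vK := 28%N (only parsing).
Notation vq := 29%N (only parsing).
Notation vv := 30%N (only parsing).
Notation vr := 31%N (only parsing).
Notation vmi := 32%N (only parsing).
Notation vmj := 33%N (only parsing).
Notation vl := 34%N (only parsing).
Notation vj := 35%N (only parsing).
Notation vbv := 36%N (only parsing).
Notation vbq := 37%N (only parsing).
Notation asel := 38%N (only parsing).
Notation vW := 39%N (only parsing).
Notation vnq := 40%N (only parsing).
(** Numbers of real arrays, a separate memory: a number shared with an integer array is no clash.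
    [ay] holds the sketch, [aout] the output, [adm] the dense matrix, [aest] the estimates, [ag] the
    Gram-Schmidt vectors. *)
Notation ay := 2%N (only parsing).
Notation aout := 3%N (only parsing).
Notation adm := 4%N (only parsing).
Notation aest := 5%N (only parsing).
Notation ag := 6%N (only parsing).
Notation vbest := 7%N (only parsing).
Notation vnum := 8%N (only parsing).
Notation vden := 9%N (only parsing).
Notation vcoef := 10%N (only parsing).
Notation rvar a := (RRead a (IConst 0)).
Infix "+i" := IAdd (at level 50, left associativity).
Notation "c1 ;; c2" := (Seq c1 c2) (at level 80, right associativity).

(* There is no rounding instruction: a natural number stored as a real is
   recovered bit by bit from the powers of two. *)
Definition conv_bit : iexp := IRead apw (ISub (% vnb) (% vb +i IConst 1)).
Definition conv (dst : nat) (src : iexp) : cmd :=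
  set_int dst (IConst 0) ;;
  for_loop vb (% vnb)
    (If (BRLe (RInt (% dst +i conv_bit)) (RRead adm src))
       (set_int dst (% dst +i conv_bit)) Skip).

(** Without an integer product, [D * D] and the row offsets [i * n] are built by repeated
    addition. *)
Definition prog_sizes : cmd :=
  set_int vn (IConst 0) ;;
  for_loop vi (IRead 0 (IConst 0)) (incr vn (IRead 0 (IConst 0))) ;;
  set_int vacc (IConst 0) ;;
  for_loop vi (IRead 0 (IConst 2))
    (ISet amul (% vi) (% vacc) ;; incr vacc (% vn)).

(** Row-major expansion of the sparse input: the advice table runs across row boundaries and can
    then be read at consecutive addresses. *)
Definition prog_dense : cmd :=
  for_loop vi (IRead 0 (IConst 3))
    (RSet adm (IRead amul (IRead 1 (% vi)) +i IRead 2 (% vi))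
       (RRead 1 (% vi))).

(** Powers of two past [m + n + n], a bound on all naturals stored in the table. *)
Definition prog_powers : cmd :=
  ISet apw (IConst 0) (IConst 1) ;;
  set_int vnb (IConst 0) ;;
  While (BILe (IRead apw (% vnb)) (IRead 0 (IConst 2) +i % vn +i % vn))
    (ISet apw (% vnb +i IConst 1) (IRead apw (% vnb) +i IRead apw (% vnb)) ;;
     incr vnb (IConst 1)).

Definition prog_header : cmd :=
  conv vyp (IConst 0) ;; conv vS (IConst 1) ;; conv vR1 (IConst 2) ;;
  conv vR2 (IConst 3) ;; conv vNT (IConst 4) ;;
  set_int vap (IConst 5) ;;
  set_int vW (% vR1 +i % vR2 +i IConst 2).

Definition prog_top : cmd :=
  for_loop vi (% vNT)
    (conv vpos (% vap) ;;
     RSet aout (% vpos) (RAdd (RRead aout (% vpos)) (RRead ay (% vyp))) ;;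
     incr vap (IConst 1) ;; incr vyp (IConst 1)).

Definition prog_est : cmd :=
  set_int vq (% vap) ;;
  for_loop vv (% vNN)
    (RSet aest (% vv) (RRead ay (% vyp)) ;;
     for_loop vr (% vR1)
       (If (BRLe (RInt (IConst 1)) (RRead adm (% vq +i % vr)))
          (If (BRLe (RRead ay (% vyp +i % vr)) (RRead aest (% vv)))
             (RSet aest (% vv) (RRead ay (% vyp +i % vr))) Skip) Skip) ;;
     incr vq (% vW)) ;;
  set_int vnq (% vq).

(** The sentinel -1 lies below all estimates, which are nonnegative; picked nodes are overwritten by
    it. The comparison is strict, so the earliest maximum wins. *)
Definition prog_scan : cmd :=
  set_real vbest (RSub (RInt (IConst 0)) (RInt (IConst 1))) ;;
  set_int vq (% vap) ;;
  for_loop vv (% vNN)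
    (If (BNot (BRLe (RRead aest (% vv)) (rvar vbest)))
       (set_real vbest (RRead aest (% vv)) ;; set_int vbv (% vv) ;;
        set_int vbq (% vq)) Skip ;;
     incr vq (% vW)).

Definition prog_select : cmd :=
  for_loop vl (% vK)
    (prog_scan ;;
     RSet aest (% vbv) (RSub (RInt (IConst 0)) (RInt (IConst 1))) ;;
     ISet asel (% vl) (% vbq)).

(* Least squares by Gram-Schmidt. Each selected column is followed by a unit
   vector, so that once the sketch, treated last, has been reduced, the second
   part of its vector holds the opposites of the coefficients. *)
Definition prog_load : cmd :=
  for_loop vr (% vK) (RSet ag (% vmi +i % vR2 +i % vr) (RInt (IConst 0))) ;;
  If (BILe (% vl +i IConst 1) (% vK))
    (for_loop vr (% vR2)
       (RSet ag (% vmi +i % vr)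
          (RRead adm (IRead asel (% vl) +i % vR1 +i % vr))) ;;
     RSet ag (% vmi +i % vR2 +i % vl) (RInt (IConst 1)))
    (for_loop vr (% vR2)
       (RSet ag (% vmi +i % vr) (RRead ay (% vyp +i % vr)))).

Definition prog_orth : cmd :=
  set_int vmj (IConst 0) ;;
  for_loop vj (% vl)
    (set_real vnum (RInt (IConst 0)) ;;
     set_real vden (RInt (IConst 0)) ;;
     for_loop vr (% vR2)
       (set_real vnum (RAdd (rvar vnum)
          (RMul (RRead ag (% vmi +i % vr)) (RRead ag (% vmj +i % vr)))) ;;
        set_real vden (RAdd (rvar vden)
          (RMul (RRead ag (% vmj +i % vr)) (RRead ag (% vmj +i % vr))))) ;;
     set_real vcoef (RDiv (rvar vnum) (rvar vden)) ;;
     for_loop vr (% vR2 +i % vK)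
       (RSet ag (% vmi +i % vr)
          (RSub (RRead ag (% vmi +i % vr))
             (RMul (rvar vcoef) (RRead ag (% vmj +i % vr))))) ;;
     incr vmj (% vR2 +i % vK)).

Definition prog_solve : cmd :=
  set_int vmi (IConst 0) ;;
  for_loop vl (% vK +i IConst 1)
    (prog_load ;; prog_orth ;; incr vmi (% vR2 +i % vK)).

Definition prog_write : cmd :=
  for_loop vl (% vK)
    (conv vpos (IRead asel (% vl) +i % vR1 +i % vR2) ;;
     conv vneg (IRead asel (% vl) +i % vR1 +i % vR2 +i IConst 1) ;;
     RSet aout (% vpos) (RSub (RRead aout (% vpos))
       (RRead ag (% vmj +i % vR2 +i % vl))) ;;
     RSet aout (% vneg) (RAdd (RRead aout (% vneg))
       (RRead ag (% vmj +i % vR2 +i % vl)))).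

Definition prog_class : cmd :=
  conv vNN (% vap) ;; conv vK (% vap +i IConst 1) ;; incr vap (IConst 2) ;;
  prog_est ;; incr vyp (% vR1) ;; prog_select ;; prog_solve ;; prog_write ;;
  set_int vap (% vnq) ;; incr vyp (% vR2).

Definition recovery : cmd :=
  prog_sizes ;; prog_dense ;; prog_powers ;; prog_header ;; prog_top ;;
  for_loop vo (% vS) prog_class.

(** * Correctness and cost of the pieces of the program *)

Section Pieces.
Context {R : realType}.
Implicit Types (s : @state R).

Lemma runs_conv dst src s nb v T (Q : state -> Prop) :
  dst \notin [:: vb; vnb; apw] ->
  imem s vnb 0%N = nb -> (forall b, (b < nb)%N -> imem s apw b = (2 ^ b)%N) ->
  (v < 2 ^ nb)%N ->
  rmem s adm (ieval s src) = v%:R ->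
  (forall s1, same_off [:: dst; vb] [::] s s1 -> ieval s1 src = ieval s src) ->
  (icost src <= 20)%N -> (100 * nb.+1 <= T)%N ->
  (forall s1, same_off [:: dst; vb] [::] s s1 -> imem s1 dst 0%N = v -> Q s1) ->
  runs (conv dst src) s T Q.
Proof.
rewrite !inE !negb_or => /and3P[d1 d2 d3] enb epw vlt edm esrc csrc cT hQ.
apply: (@runs_le _ _ _ (3 + (3 + (nb * (2 + (icost src + 45) + 10) + (2 + 4))))%N _ Q Q) => //;
  last by nia.
apply: runs_seq; apply: runs_iset => /=.
set s0 := State _ _.
have off0 : same_off [:: dst; vb] [::] s s0.
  split=> a //=; rewrite !inE negb_or => /andP[ad _].
  by apply/boolp.funext=> j; rewrite /upd (negPf ad).
(* Binary digits from the top: after [j] digits the accumulated [r] leaves a remainder below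
   [2 ^ (nb - j)]. *)
pose inv j s1 := exists r, [/\ imem s1 dst 0%N = r, (r <= v)%N,
  (v < r + 2 ^ (nb - j))%N & same_off [:: dst; vb] [::] s s1].
apply: (@runs_for _ _ _ _ _ nb _ inv).
- by rewrite /= !inE eq_sym.
- move=> j s1 w [r [e1 e2 e3 e4]]; exists r; split=> //=.
    by rewrite /upd (negPf d1).
  apply: same_off_trans e4 _; split=> a //=.
  rewrite !inE negb_or => /andP[_ ab].
  by apply/boolp.funext=> i; rewrite /upd (negPf ab).
- by exists 0%N; rewrite subn0 add0n /= /upd !eqxx.
- move=> j s1 jnb [r [e1 e2 e3 e4]] ej off.
  have e5 : imem s1 vnb 0%N = nb.
    by rewrite e4.1 ?enb // !inE negb_or eq_sym d2.
  have e6 : imem s1 apw (nb - j.+1)%N = (2 ^ (nb - j.+1))%N.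
    by rewrite e4.1 ?epw // ?inE ?negb_or ?(eq_sym apw) ?d3 //; lia.
  have e7 : rmem s1 adm (ieval s1 src) = v%:R.
    by rewrite esrc // e4.2.
  have pw2 : (2 ^ (nb - j) = 2 ^ (nb - j.+1) + 2 ^ (nb - j.+1))%N.
    have -> : (nb - j = (nb - j.+1).+1)%N by lia.
    by rewrite expnS mul2n addnn.
  have e8 : ieval s1 (% dst +i conv_bit) = (r + 2 ^ (nb - j.+1))%N.
    by rewrite /= e5 ej addn1 e6 e1.
  apply: (@runs_le _ _ _ (bcost (BRLe (RInt (% dst +i conv_bit)) (RRead adm src)) + 13)%N
    _ (inv j.+1) (inv j.+1)) => //.
    have eb : beval s1 (BRLe (RInt (% dst +i conv_bit)) (RRead adm src)) =
        (r + 2 ^ (nb - j.+1) <= v)%N.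
      by rewrite -(@ler_nat R) -e8 -e7.
    apply: runs_if; rewrite eb => le1.
      apply: runs_le (runs_iset _) _ (fun _ H => H) => //.
      rewrite e8; exists (r + 2 ^ (nb - j.+1))%N; split=> //.
      + by rewrite /= /upd !eqxx.
      + by lia.
      + apply: same_off_trans e4 _; split=> a //=.
        rewrite !inE negb_or => /andP[ad _].
        by apply/boolp.funext=> i; rewrite /upd (negPf ad).
    apply: runs_le (runs_skip _) _ (fun _ H => H) => //.
    by exists r; split=> //; lia.
  by rewrite /=; lia.
- move=> j s1 _ [r [_ _ _ e4]] _ /=.
  by rewrite e4.1 // !inE negb_or eq_sym d2.
- move=> s1 [r [e1 e2 e3 e4]]; apply: hQ => //.
  by rewrite e1; move: e3; rewrite subnn expn0; lia.
Qed.


Lemma run_sizes s D m :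
  imem s 0%N 0%N = D -> imem s 0%N 2%N = m ->
  runs prog_sizes s (100 * (D + m + 1))%N (fun s1 =>
    imem s1 vn 0%N = (D * D)%N /\
    forall i, (i < m)%N -> imem s1 amul i = (i * (D * D))%N).
Proof.
move=> eD em; apply: runs_time.
apply: runs_seq; apply: runs_iset.
apply: runs_seqf (runs_for (i := vi) (Nv := D)
  (inv := fun j s1 => imem s1 vn 0%N = (j * D)%N) _ _ _ _ _ (fun _ H => H)) _ => //=.
- move=> j s1 jD ej _ off; apply: runs_time (runs_iset _) (leqnn _).
  by rewrite /= /upd /= ej off.1 //= eD mulSn addnC.
- by move=> j s1 _ _ off; rewrite off.1.
move=> s1 e1 off1; apply: runs_seq; apply: runs_iset.
have eD1 : imem s1 0%N 2%N = m by rewrite off1.1.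
apply: (runs_for (i := vi) (Nv := m)
  (inv := fun j s1 => [/\ imem s1 vn 0%N = (D * D)%N,
     imem s1 vacc 0%N = (j * (D * D))%N &
     forall i, (i < j)%N -> imem s1 amul i = (i * (D * D))%N])) => //=.
- move=> j s2 jm [f1 f2 f3] ej off.
  apply: runs_seq; apply: runs_iset; apply: runs_iset.
  rewrite /= /upd /= ej f1 f2; split=> //; first by rewrite mulSn addnC.
  move=> i; rewrite ltnS leq_eqVlt => /orP[/eqP->|ij]; first by rewrite eqxx.
  by rewrite (ltn_eqF ij) f3.
- by move=> j s2 _ _ off; rewrite off.1.
- by move=> s2 [].
by rewrite /=; nia.
Qed.

(** The disjunction copes with colliding addresses: a written cell holds the value of some entry
    sent there, which determines it once the values come from a matrix. *)
Lemma run_dense s n m N (ri ci : nat -> nat) (val : nat -> R) :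
  imem s 0%N 3%N = N ->
  (forall i, (i < m)%N -> imem s amul i = (i * n)%N) ->
  (forall e, (e < N)%N -> [/\ (ri e < m)%N, imem s 1%N e = ri e,
     imem s 2%N e = ci e & rmem s 1%N e = val e]) ->
  runs prog_dense s (100 * N.+1)%N (fun s1 => forall q,
    (exists e, [/\ (e < N)%N, (ri e * n + ci e)%N = q & rmem s1 adm q = val e])
    \/ ((forall e, (e < N)%N -> (ri e * n + ci e)%N <> q) /\
        rmem s1 adm q = rmem s adm q)).
Proof.
move=> eN emul he; apply: runs_time.
apply: (runs_for (i := vi) (Nv := N) (inv := fun j s1 => forall q,
    (exists e, [/\ (e < j)%N, (ri e * n + ci e)%N = q & rmem s1 adm q = val e])
    \/ ((forall e, (e < j)%N -> (ri e * n + ci e)%N <> q) /\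
        rmem s1 adm q = rmem s adm q))) => //=.
- by move=> q; right.
- move=> j s1 jN inv ej off; have [h1 h2 h3 h4] := he _ jN.
  apply: runs_time (runs_rset _) (leqnn _) => q /=.
  rewrite /upd /= ej !off.1 // off.2 // h2 h3 h4 emul //.
  case: eqP => [->|ne]; first by left; exists j.
  case: (inv q) => [[e [ej' eq1 eq2]]|[h5 h6]].
    by left; exists e; split=> //; rewrite ltnS ltnW.
  right; split=> // e; rewrite ltnS leq_eqVlt => /orP[/eqP->|/h5 //].
  by move=> h; exact: ne.
- by move=> j s1 _ _ off; rewrite off.1.
by rewrite /=; nia.
Qed.

Lemma run_powers s n m :
  imem s vn 0%N = n -> imem s 0%N 2%N = m -> (0 < n)%N ->
  let nb := (trunc_log 2 (m + n + n)).+1 in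
  runs prog_powers s (100 * nb.+1)%N (fun s1 =>
    imem s1 vnb 0%N = nb /\
    forall b, (b <= nb)%N -> imem s1 apw b = (2 ^ b)%N).
Proof.
move=> en em n0 nb; apply: runs_time.
apply: runs_seq; apply: runs_iset; apply: runs_seq; apply: runs_iset => /=.
pose inv j s1 := [/\ imem s1 vn 0%N = n, imem s1 0%N 2%N = m,
    imem s1 vnb 0%N = j & forall b, (b <= j)%N -> imem s1 apw b = (2 ^ b)%N].
apply: (runs_while (N := nb) (inv := inv)).
- split=> //= b; rewrite leqn0 => /eqP->; by rewrite /upd.
- move=> j s1 jnb [f1 f2 f3 f4]; split.
    have le1 : (2 ^ j <= 2 ^ trunc_log 2 (m + n + n))%N.
      by rewrite leq_exp2l // -ltnS.
    rewrite /= f1 f2 f3 f4 //; apply: leq_trans le1 (trunc_logP _ _) => //.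
    by lia.
  apply: runs_seq; apply: runs_iset; apply: runs_iset; split=> //=.
    by rewrite /upd /= f3 addn1.
  move=> b; rewrite /upd /= f3 f4 // addn1 leq_eqVlt ltnS => /orP[/eqP->|bj].
    by rewrite eqxx expnS mul2n addnn.
  by rewrite ltn_eqF ?f4 // ltnS.
- move=> s1 [f1 f2 f3 f4]; rewrite /= f1 f2 f3 f4 // -ltnNge.
  exact: trunc_log_ltn.
- by move=> s1 [].
by rewrite /=; nia.
Qed.

Definition is_est (y1 : nat -> R) (R1 : nat) (phi : nat -> bool) (e : R) : Prop :=
  [/\ e <= y1 0%N, forall r, (r < R1)%N -> phi r -> e <= y1 r
    & e = y1 0%N \/ exists r, [/\ (r < R1)%N, phi r & e = y1 r]].

Lemma run_est s ap yp NN R1 W :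
  imem s vap 0%N = ap -> imem s vyp 0%N = yp -> imem s vNN 0%N = NN ->
  imem s vR1 0%N = R1 -> imem s vW 0%N = W ->
  runs prog_est s (100 * (NN * (R1 + 1) + 1))%N (fun s1 =>
    imem s1 vnq 0%N = (ap + NN * W)%N /\
    forall v, (v < NN)%N ->
      is_est (fun r => rmem s ay (yp + r)%N) R1
        (fun r => 1 <= rmem s adm (ap + v * W + r)%N) (rmem s1 aest v)).
Proof.
move=> eap eyp eNN eR1 eW; apply: runs_time.
apply: runs_seq; apply: runs_iset.
set s0 := State _ _.
pose E v e j := is_est (fun r => rmem s ay (yp + r)%N) j
        (fun r => 1 <= rmem s adm (ap + v * W + r)%N) e.
apply: (runs_seqf (runs_for (i := vv) (Nv := NN)
  (inv := fun j s1 => imem s1 vq 0%N = (ap + j * W)%N /\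
    forall v, (v < j)%N -> E v (rmem s1 aest v) R1) _ _ _ _ _ (fun _ H => H))) => //=.
- by rewrite eap addn0.
- move=> j s1 jNN [f1 f2] ej off.
  have g1 : imem s1 vyp 0%N = yp by rewrite off.1.
  have g2 : rmem s1 ay = rmem s ay by rewrite off.2.
  have g3 : rmem s1 adm = rmem s adm by rewrite off.2.
  have g4 : imem s1 vR1 0%N = R1 by rewrite off.1.
  have g5 : imem s1 vW 0%N = W by rewrite off.1.
  apply: runs_seq; apply: runs_rset => /=.
  apply: (runs_seqf (runs_for (i := vr) (Nv := R1)
    (inv := fun i s2 => E j (rmem s2 aest j) i /\
      forall v, (v < j)%N -> E v (rmem s2 aest v) R1) _ _ _ _ _ (fun _ H => H))) => //=.
  + split=> [|v vj]; last by rewrite ej (ltn_eqF vj); exact: f2.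
    by rewrite ej eqxx g1 g2; split; rewrite ?addn0 //; left; rewrite ?addn0.
  + move=> i s2 iR1 [h1 h2] ei off2.
    have k1 : imem s2 vyp 0%N = yp by rewrite off2.1 //= g1.
    have k2 : rmem s2 ay = rmem s ay by rewrite off2.2 //= g2.
    have k3 : rmem s2 adm = rmem s adm by rewrite off2.2 //= g3.
    have k4 : imem s2 vq 0%N = (ap + j * W)%N by rewrite off2.1 //= f1.
    have k5 : imem s2 vv 0%N = j by rewrite off2.1.
    case: h1 => l1 l2 l3.
    have l3' : rmem s2 aest j = rmem s ay (yp + 0)%N \/
      exists r, [/\ (r < i.+1)%N, 1 <= rmem s adm (ap + j * W + r)%N &
        rmem s2 aest j = rmem s ay (yp + r)%N].
      by case: l3 => [->|[r [r1 r2 r3]]]; [left | right; exists r; rewrite ltnS ltnW].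
    apply: runs_if.
      rewrite /= k3 k4 ei => b1; apply: runs_if.
        rewrite /= k1 k2 k5 ei => b2; apply: runs_time (runs_rset _) (leqnn _).
        split=> [|v vj] /=.
          rewrite k5 eqxx k1 k2 ei; split.
          * exact: le_trans l1.
          * move=> r; rewrite ltnS leq_eqVlt => /orP[/eqP->//|ri pr].
            exact: le_trans (l2 _ ri pr).
          * by right; exists i; split.
        by rewrite k5 (ltn_eqF vj); exact: h2.
      rewrite /= k1 k2 k5 ei -ltNge => b2.
      apply: runs_time (runs_skip _) _; last by [].
      split=> //; split=> // r; rewrite ltnS leq_eqVlt => /orP[/eqP->|ri pr].
        by move=> _; exact: ltW.
      exact: l2.
    rewrite /= k3 k4 ei -ltNge => b1.
    apply: runs_time (runs_skip _) _; last by [].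
    split=> //; split=> // r; rewrite ltnS leq_eqVlt => /orP[/eqP->|ri pr].
      by rewrite leNgt b1.
    exact: l2.
  + by move=> i s2 _ _ off2; rewrite off2.1 //=.
  move=> s2 [h1 h2] off2; apply: runs_time (runs_iset _) (leqnn _) => /=.
  split; first by rewrite !off2.1 //= g5 f1 mulSn; lia.
  by move=> v; rewrite ltnS leq_eqVlt => /orP[/eqP->|/h2].
- by move=> j s1 _ _ off; rewrite off.1 //=.
move=> s1 [f1 f2] off; apply: runs_time (runs_iset _) (leqnn _) => /=.
by rewrite f1; split.
by rewrite /=; nia.
Qed.

Lemma run_scan s ap NN W :
  imem s vap 0%N = ap -> imem s vNN 0%N = NN -> imem s vW 0%N = W ->
  (exists v, (v < NN)%N /\ -1 < rmem s aest v) ->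
  runs prog_scan s (100 * NN.+1)%N (fun s1 => exists v0, [/\ (v0 < NN)%N,
     imem s1 vbv 0%N = v0, imem s1 vbq 0%N = (ap + v0 * W)%N,
     -1 < rmem s aest v0 &
     forall v, (v < NN)%N -> rmem s aest v <= rmem s aest v0 /\
       ((v < v0)%N -> rmem s aest v < rmem s aest v0)]).
Proof.
move=> eap eNN eW [vx [vxN vxp]]; apply: runs_time.
apply: runs_seq; apply: runs_rset; apply: runs_seq; apply: runs_iset.
set f := rmem s aest in vxp *.
pose top j b := forall v, (v < j)%N -> f v <= b.
apply: (runs_for (i := vv) (Nv := NN)
  (inv := fun j s1 => [/\ imem s1 vq 0%N = (ap + j * W)%N,
    top j (rmem s1 vbest 0%N) &
    rmem s1 vbest 0%N = -1 \/ exists v0, [/\ (v0 < j)%N,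
     imem s1 vbv 0%N = v0, imem s1 vbq 0%N = (ap + v0 * W)%N,
     -1 < f v0 /\ rmem s1 vbest 0%N = f v0 &
     forall v, (v < v0)%N -> f v < f v0]])) => //=.
- by split=> //=; [rewrite eap addn0 | left; rewrite sub0r].
- move=> j s1 jNN [f1 f2 f3] ej off.
  have g1 : rmem s1 aest = f by rewrite off.2.
  have g2 : imem s1 vW 0%N = W by rewrite off.1.
  have fb : -1 <= rmem s1 vbest 0%N.
    by case: f3 => [->//|[v0 [_ _ _ [h1 ->] _]]]; exact: ltW.
  apply: (runs_seqf (P := fun s2 => [/\ imem s2 vq 0%N = (ap + j * W)%N,
    top j.+1 (rmem s2 vbest 0%N) &
    rmem s2 vbest 0%N = -1 \/ exists v0, [/\ (v0 < j.+1)%N,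
     imem s2 vbv 0%N = v0, imem s2 vbq 0%N = (ap + v0 * W)%N,
     -1 < f v0 /\ rmem s2 vbest 0%N = f v0 &
     forall v, (v < v0)%N -> f v < f v0]])).
    apply: runs_if => /=; rewrite g1 ej => b1.
      rewrite -ltNge in b1.
      apply: runs_seq; apply: runs_rset; apply: runs_seq; apply: runs_iset.
      apply: runs_iset => /=; rewrite ej g1 f1; split=> //.
        move=> v; rewrite ltnS leq_eqVlt => /orP[/eqP->//|/f2 h].
        by apply: le_trans h _; exact: ltW.
      right; exists j; split=> //; first by split=> //; exact: le_lt_trans b1.
      by move=> v /f2 h; exact: le_lt_trans b1.
    rewrite negbK in b1.
    apply: runs_time (runs_skip _) _; last by [].
    split=> //.
      by move=> v; rewrite ltnS leq_eqVlt => /orP[/eqP->//|/f2 h].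
    case: f3 => [|[v0 [h1 h2 h3 h4 h5]]]; [by left | right; exists v0; split=> //].
    by rewrite ltnS ltnW.
  move=> s2 [h1 h2 h3] off2; apply: runs_time (runs_iset _) (leqnn _) => /=.
  by split=> //; rewrite h1 off2.1 //= g2 mulSn; lia.
- by move=> j s1 _ _ off; rewrite off.1 //=.
- move=> s1 [h1 h2 [h3|[v0 [k1 k2 k3 [k4 k5] k6]]]].
    by have := h2 _ vxN; rewrite h3 leNgt vxp.
  exists v0; split=> // v vN; split; last exact: k6.
  by rewrite -k5; exact: h2.
by rewrite /=; nia.
Qed.

(** Ties are broken in favour of small indices. As parents precede their children, a parent wins
    against a child with the same estimate, which will make picked sets closed under parents. *)
Definition top_selection (E : nat -> R) (NN K : nat) (sq : seq nat) : Prop :=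
  [/\ size sq = K, uniq sq, {in sq, forall u, (u < NN)%N} &
   forall u v, u \in sq -> (v < NN)%N -> v \notin sq ->
     E v <= E u /\ ((v < u)%N -> E v < E u)].

Lemma run_select s ap NN W K :
  imem s vap 0%N = ap -> imem s vNN 0%N = NN -> imem s vW 0%N = W ->
  imem s vK 0%N = K -> (K <= NN)%N ->
  (forall v, (v < NN)%N -> 0 <= rmem s aest v) ->
  runs prog_select s (200 * (K.+1 * NN.+1))%N (fun s1 => exists sq,
     top_selection (rmem s aest) NN K sq /\
     forall i, (i < K)%N -> imem s1 asel i = (ap + nth 0%N sq i * W)%N).
Proof.
move=> eap eNN eW eK KN E0; set E := rmem s aest; apply: runs_time.
apply: (runs_for (i := vl) (Nv := K)
  (inv := fun j s1 => exists sq, [/\ top_selection E NN j sq,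
     forall i, (i < j)%N -> imem s1 asel i = (ap + nth 0%N sq i * W)%N &
     forall v, (v < NN)%N -> rmem s1 aest v = if v \in sq then -1 else E v])).
- by [].
- by [].
- by exists [::].
- move=> j s1 jK [sq [[t1 t2 t3 t4] f2 f3]] ej off.
  have [v [vN vsq]] : exists v, (v < NN)%N /\ v \notin sq.
    have : ~~ all (fun x => x \in sq) (iota 0 NN).
      apply/negP => /allP /= H; have := uniq_leq_size (iota_uniq 0 NN) H.
      by rewrite size_iota t1 leqNgt (leq_trans jK KN).
    by case/allPn => v; rewrite mem_iota => vN vs; exists v.
  apply: (runs_seqf (run_scan (ap := ap) (NN := NN) (W := W) _ _ _ _)).
  + by rewrite off.1.
  + by rewrite off.1.
  + by rewrite off.1.
  + exists v; split=> //; rewrite f3 // (negPf vsq).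
    by apply: lt_le_trans (E0 _ vN); rewrite oppr_lt0.
  move=> s2 [v0 [h1 h2 h3 h4 h5]] off2.
  have v0sq : v0 \notin sq by apply/negP => hh; rewrite f3 // hh ltxx in h4.
  have e0 : rmem s1 aest v0 = E v0 by rewrite f3 // (negPf v0sq).
  apply: runs_seq; apply: runs_rset; apply: runs_iset => /=.
  have g2 : imem s2 vl 0%N = j by rewrite off2.1.
  rewrite g2 h2 h3; exists (rcons sq v0); split.
  + split; first by rewrite size_rcons t1.
    * by rewrite rcons_uniq v0sq.
    * by move=> u; rewrite mem_rcons inE => /orP[/eqP->//|/t3].
    * move=> u w; rewrite !mem_rcons !inE negb_or => uu wN /andP[wv0 wsq].
      case/orP: uu => [/eqP->|uu]; last exact: t4.
      by have := h5 _ wN; rewrite e0 f3 // (negPf wsq).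
  + move=> i; rewrite nth_rcons t1 ltnS leq_eqVlt => /orP[/eqP->|ij].
      by rewrite /= eqxx ltnn.
    by rewrite /= (ltn_eqF ij) ij off2.1 //= f2.
  + move=> w wN; rewrite mem_rcons inE; case: eqP => [->|wv0] /=.
      by rewrite sub0r.
    by rewrite off2.2 //= f3.
- by move=> j s1 _ _ off; rewrite /= off.1.
- by move=> s1 [sq [h1 h2 h3]]; exists sq.
by rewrite /=; nia.
Qed.

(** The case [i = K] loads the sketch; the unit vector then degenerates to zero, because [l == K]
    fails for [l < K]. *)
Lemma run_load s yp R1 R2 K i mi :
  imem s vyp 0%N = yp -> imem s vR1 0%N = R1 -> imem s vR2 0%N = R2 ->
  imem s vK 0%N = K -> imem s vl 0%N = i -> imem s vmi 0%N = mi -> (i <= K)%N ->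
  runs prog_load s (100 * (R2 + K).+1)%N (fun s1 =>
    [/\ forall r, (r < R2)%N -> rmem s1 ag (mi + r)%N =
         if (i < K)%N then rmem s adm (imem s asel i + R1 + r)%N
         else rmem s ay (yp + r)%N,
      forall l, (l < K)%N -> rmem s1 ag (mi + R2 + l)%N = (l == i)%:R &
      forall q, (q < mi)%N -> rmem s1 ag q = rmem s ag q]).
Proof.
move=> eyp eR1 eR2 eK ei emi iK; apply: runs_time.
apply: (runs_seqf (runs_for (i := vr) (Nv := K) (inv := fun j s1 =>
   (forall l, (l < j)%N -> rmem s1 ag (mi + R2 + l)%N = 0) /\
   (forall q, (q < mi)%N -> rmem s1 ag q = rmem s ag q))
   _ _ _ _ _ (fun _ H => H))) => //=.
- move=> j s1 jK [h1 h2] ej off; apply: runs_time (runs_rset _) (leqnn _).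
  have g1 : imem s1 vmi 0%N = mi by rewrite off.1.
  have g2 : imem s1 vR2 0%N = R2 by rewrite off.1.
  split=> [l|q qmi] /=; rewrite g1 g2 ej.
    rewrite ltnS leq_eqVlt => /orP[/eqP->|lj]; first by rewrite eqxx.
    by rewrite eqn_add2l (ltn_eqF lj) h1.
  by rewrite ltn_eqF ?h2 // -addnA ltn_addr.
- by move=> j s1 _ _ off; rewrite off.1.
move=> s1 [h1 h2] off.
have g1 : imem s1 vmi 0%N = mi by rewrite off.1.
have g2 : imem s1 vR2 0%N = R2 by rewrite off.1.
have g3 : imem s1 vl 0%N = i by rewrite off.1.
have g4 : imem s1 vK 0%N = K by rewrite off.1.
have g5 : imem s1 vR1 0%N = R1 by rewrite off.1.
have g6 : imem s1 vyp 0%N = yp by rewrite off.1.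
have g7 : imem s1 asel = imem s asel by rewrite off.1.
have g8 : rmem s1 adm = rmem s adm by rewrite off.2.
have g9 : rmem s1 ay = rmem s ay by rewrite off.2.
pose inv v j s2 := [/\ forall r, (r < j)%N -> rmem s2 ag (mi + r)%N = v r,
   forall l, (l < K)%N -> rmem s2 ag (mi + R2 + l)%N = 0 &
   forall q, (q < mi)%N -> rmem s2 ag q = rmem s ag q].
have upd_inv v j s2 : (j < R2)%N -> inv v j s2 ->
    inv v j.+1 (State (imem s2) (upd (rmem s2) ag (mi + j)%N (v j))).
  move=> jR [k1 k2 k3]; split=> [r|l lK|q qmi] /=.
  - rewrite ltnS leq_eqVlt => /orP[/eqP->|rj]; first by rewrite eqxx.
    by rewrite eqn_add2l (ltn_eqF rj) k1.
  - by rewrite -addnA eqn_add2l gtn_eqF ?addnA ?k2 // ltn_addr.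
  - by rewrite ltn_eqF ?k3 // ltn_addr.
apply: runs_if.
- rewrite /= g3 g4 addn1 => iK'; rewrite iK'.
  apply: (runs_seqf (runs_for (i := vr) (Nv := R2)
    (inv := inv (fun r => rmem s adm (imem s asel i + R1 + r)%N))
    _ _ _ _ _ (fun _ H => H))) => //=.
  + move=> j s2 jR k ej off2; apply: runs_time (runs_rset _) (leqnn _) => /=.
    rewrite ej !off2.1 //= !off2.2 //= g1 g3 g5 g7 g8.
    exact: (upd_inv _ _ _ jR k).
  + by move=> j s2 _ _ off2; rewrite off2.1.
  move=> s2 [k1 k2 k3] off2; apply: runs_time (runs_rset _) (leqnn _) => /=.
  rewrite !off2.1 //= g1 g2 g3; split=> [r rR|l lK|q qmi].
  + by rewrite -addnA eqn_add2l ltn_eqF ?k1 // ltn_addr.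
  + by rewrite eqn_add2l; case: eqP => // _; rewrite k2.
  + by rewrite ltn_eqF ?k3 // -addnA ltn_addr.
- rewrite /= g3 g4 addn1 => iK'; rewrite (negPf iK').
  apply: runs_time; first apply: (runs_for (i := vr) (Nv := R2)
    (inv := inv (fun r => rmem s ay (yp + r)%N))) => //=.
  + move=> j s2 jR k ej off2; apply: runs_time (runs_rset _) (leqnn _) => /=.
    rewrite ej !off2.1 //= !off2.2 //= g1 g6 g9.
    exact: (upd_inv _ _ _ jR k).
  + by move=> j s2 _ _ off2; rewrite off2.1.
  + move=> s2 [k1 k2 k3]; split=> // l lK; rewrite k2 //.
    by case: eqP => // li; rewrite li ltnNge -ltnS in lK; move: iK'; rewrite -leqNgt; lia.
  + by rewrite /=; nia.
by rewrite /=; nia.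
Qed.

Definition row_dot (R2 : nat) (g h : nat -> R) : R := \sum_(r < R2) g r * h r.

(** Each coefficient is computed from the partly reduced vector; pairwise orthogonality of the
    earlier vectors ensures that a later subtraction does not spoil an orthogonality already
    reached. *)
Lemma run_orth s R2 K i :
  let GW := (R2 + K)%N in
  let g i' r := rmem s ag (i' * GW + r)%N in
  imem s vR2 0%N = R2 -> imem s vK 0%N = K -> imem s vl 0%N = i ->
  imem s vmi 0%N = (i * GW)%N ->
  (forall j j', (j < i)%N -> (j' < i)%N -> j != j' -> row_dot R2 (g j) (g j') = 0) ->
  runs prog_orth s (200 * (i.+1 * GW.+1))%N (fun s1 =>
    [/\ imem s1 vmj 0%N = (i * GW)%N,
      forall q, (q < i * GW)%N -> rmem s1 ag q = rmem s ag q &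
      exists c : nat -> R,
        (forall r, (r < GW)%N -> rmem s1 ag (i * GW + r)%N =
           g i r - \sum_(j < i) c j * g j r) /\
        forall j, (j < i)%N ->
           row_dot R2 (fun r => rmem s1 ag (i * GW + r)%N) (g j) = 0]).
Proof.
move=> GW g eR2 eK ei emi orth; apply: runs_time.
apply: runs_seq; apply: runs_iset.
have jGW j : (j < i)%N -> forall r, (r < GW)%N -> (j * GW + r < i * GW)%N.
  by move=> ji r rG; have := leq_mul ji (leqnn GW); rewrite mulSn; lia.
apply: (runs_for (i := vj) (Nv := i) (inv := fun j s1 =>
    [/\ imem s1 vmj 0%N = (j * GW)%N,
      forall q, (q < i * GW)%N -> rmem s1 ag q = rmem s ag q &
      exists c : nat -> R,
        (forall r, (r < GW)%N -> rmem s1 ag (i * GW + r)%N =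
           g i r - \sum_(j' < j) c j' * g j' r) /\
        forall j', (j' < j)%N ->
           row_dot R2 (fun r => rmem s1 ag (i * GW + r)%N) (g j') = 0])) => //=.
- split=> //; exists (fun=> 0); split=> // r rG.
  by rewrite big_ord0 subr0.
- move=> j s1 ji [h1 h2 [c [h3 h4]]] ej off.
  have g1 : imem s1 vR2 0%N = R2 by rewrite off.1.
  have g2 : imem s1 vK 0%N = K by rewrite off.1.
  have g3 : imem s1 vmi 0%N = (i * GW)%N by rewrite off.1.
  have h2' r : (r < GW)%N -> rmem s1 ag (j * GW + r)%N = g j r.
    by move=> rG; rewrite h2 // jGW.
  pose gi r := rmem s1 ag (i * GW + r)%N.
  apply: runs_seq; apply: runs_rset; apply: runs_seq; apply: runs_rset => /=.
  apply: (runs_seqf (runs_for (i := vr) (Nv := R2) (inv := fun t s2 =>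
     rmem s2 vnum 0%N = row_dot t gi (g j) /\
     rmem s2 vden 0%N = row_dot t (g j) (g j)) _ _ _ _ _ (fun _ H => H))) => //=.
  + by rewrite /row_dot !big_ord0.
  + move=> t s2 tR [k1 k2] et off2.
    have l1 : rmem s2 ag = rmem s1 ag by rewrite off2.2.
    have l2 : imem s2 vmi 0%N = (i * GW)%N by rewrite off2.1.
    have l3 : imem s2 vmj 0%N = (j * GW)%N by rewrite off2.1.
    apply: runs_seq; apply: runs_rset; apply: runs_rset => /=.
    rewrite et l1 l2 l3 k1 k2 h2' ?(leq_trans tR) ?leq_addr //.
    by rewrite /row_dot !big_ord_recr.
  + by move=> t s2 _ _ off2; rewrite off2.1.
  move=> s2 [k1 k2] off2.
  apply: runs_seq; apply: runs_rset => /=.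
  set coef := _ / _.
  have ecoef : coef = row_dot R2 gi (g j) / row_dot R2 (g j) (g j).
    by rewrite /coef k1 k2.
  have m1 : imem s2 vmi 0%N = (i * GW)%N by rewrite off2.1.
  have m2 : imem s2 vmj 0%N = (j * GW)%N by rewrite off2.1.
  have m3 : rmem s2 ag = rmem s1 ag by rewrite off2.2.
  have m4 : imem s2 vR2 0%N = R2 by rewrite off2.1.
  have m5 : imem s2 vK 0%N = K by rewrite off2.1.
  apply: (runs_seqf (runs_for (i := vr) (Nv := GW) (inv := fun t s3 =>
     (forall r, (r < GW)%N -> rmem s3 ag (i * GW + r)%N =
        if (r < t)%N then gi r - coef * g j r else gi r) /\
     (forall q, (q < i * GW)%N -> rmem s3 ag q = rmem s1 ag q))
     _ _ _ _ _ (fun _ H => H))) => //=.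
  + by rewrite m3.
  + move=> t s3 tG [n1 n2] et off3; apply: runs_time (runs_rset _) (leqnn _) => /=.
    have p3 : rmem s3 vcoef 0%N = coef by rewrite off3.2.
    rewrite et !off3.1 //= m1 m2 p3; split=> [r rG|q qi].
      rewrite eqn_add2l ltnS; case: (ltngtP r t) => [rt|rt|->].
      * by rewrite n1 // rt.
      * by rewrite n1 // ltnNge (ltnW rt).
      * by rewrite n1 // ltnn n2 ?jGW // h2'.
    by rewrite ltn_eqF ?n2 // ltn_addr.
  + by move=> t s3 _ _ off3; rewrite !off3.1 //= m4 m5.
  move=> s3 [n1 n2] off3; apply: runs_time (runs_iset _) (leqnn _) => /=.
  rewrite !off3.1 //= m2 m4 m5; split.
  + by rewrite mulSn addnC.
  + by move=> q qi; rewrite n2 // h2.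
  + exists (fun j' => if j' == j then coef else c j'); split.
      move=> r rG; rewrite n1 // rG /gi h3 // big_ord_recr /= eqxx opprD addrA.
      congr (_ - _ - _); apply: eq_bigr => j' _.
      by rewrite (ltn_eqF (ltn_ord j')).
    move=> j'; have -> : row_dot R2 (fun r => rmem s3 ag (i * GW + r)%N) (g j') =
        row_dot R2 gi (g j') - coef * row_dot R2 (g j) (g j').
      rewrite /row_dot mulr_sumr -sumrB; apply: eq_bigr => r _.
      have rG : (r < GW)%N by rewrite (leq_trans (ltn_ord r)) ?leq_addr.
      by rewrite n1 // rG mulrBl mulrA.
    rewrite ltnS leq_eqVlt => /orP[/eqP->|j'j].
      (* A linearly dependent column has been reduced to zero. Division by zero returns 0, and
         orthogonality to a zero vector is automatic. *)
      rewrite ecoef; have [z|nz] := eqVneq (row_dot R2 (g j) (g j)) 0.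
        have zero r : (r < R2)%N -> g j r = 0.
          move=> rR; have := z; rewrite /row_dot.
          under eq_bigr do rewrite -expr2.
          move/eqP; rewrite psumr_eq0 => [|r' _]; last exact: sqr_ge0.
          by move=> /allP /(_ (Ordinal rR) (mem_index_enum _)) /=; rewrite sqrf_eq0 => /eqP.
        have -> : row_dot R2 gi (g j) = 0.
          by apply: big1 => r _; rewrite zero ?mulr0.
        by rewrite mul0r mul0r subr0.
      by rewrite mulfVK // subrr.
    rewrite h4 // orth ?mulr0 ?subr0 //; first exact: ltn_trans ji.
    by rewrite gtn_eqF.
- by move=> j s1 _ _ off; rewrite off.1.
by rewrite /= -/GW; nia.
Qed.

End Pieces.

(** * Gram-Schmidt yields the normal equations *)

Section Pieces.
Context {R : realType}.
Implicit Types (s : @state R).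

Lemma row_dotC R2 (g h : nat -> R) : row_dot R2 g h = row_dot R2 h g.
Proof. by apply: eq_bigr => r _; rewrite mulrC. Qed.

Lemma eq_row_dot R2 (g g' h h' : nat -> R) :
  (forall r, (r < R2)%N -> g r = g' r) -> (forall r, (r < R2)%N -> h r = h' r) ->
  row_dot R2 g h = row_dot R2 g' h'.
Proof. by move=> e1 e2; apply: eq_bigr => r _; rewrite e1 ?e2. Qed.

(** Passes from orthogonality to the reduced vectors to orthogonality to the original columns. *)
Lemma row_dot_comb R2 i (rho h u : nat -> R) (c : nat -> R) (g : nat -> nat -> R) :
  (forall r, (r < R2)%N -> h r = u r - \sum_(j < i) c j * g j r) ->
  (forall j, (j < i)%N -> row_dot R2 rho (g j) = 0) ->
  row_dot R2 rho u = row_dot R2 rho h.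
Proof.
move=> e z; rewrite /row_dot.
under [RHS]eq_bigr => r _ do rewrite e // mulrBr mulr_sumr.
rewrite sumrB exchange_big /= [X in _ - X]big1 ?subr0 // => j _.
under eq_bigr => r _ do rewrite mulrCA.
by rewrite -mulr_sumr -/(row_dot R2 rho (g j)) z ?mulr0.
Qed.

Lemma run_solve s yp R1 R2 K :
  let GW := (R2 + K)%N in
  let b l r := rmem s adm (imem s asel l + R1 + r)%N in
  let y2 r := rmem s ay (yp + r)%N in
  imem s vyp 0%N = yp -> imem s vR1 0%N = R1 -> imem s vR2 0%N = R2 ->
  imem s vK 0%N = K ->
  runs prog_solve s (1000 * (K.+1 * K.+1 * GW.+1))%N (fun s1 =>
    imem s1 vmj 0%N = (K * GW)%N /\ exists c : nat -> R,
      (forall l, (l < K)%N -> rmem s1 ag (K * GW + R2 + l)%N = - c l) /\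
      forall i, (i < K)%N ->
        row_dot R2 (fun r => y2 r - \sum_(l < K) c l * b l r) (b i) = 0).
Proof.
move=> GW b y2 eyp eR1 eR2 eK; apply: runs_time.
apply: runs_seq; apply: runs_iset.
pose g s1 i r := rmem s1 ag (i * GW + r)%N.
pose inv i s1 := [/\ imem s1 vmi 0%N = (i * GW)%N,
  (0 < i)%N -> imem s1 vmj 0%N = (i.-1 * GW)%N,
  forall i', (i' < i)%N -> forall r, (r < R2)%N -> g s1 i' r =
    (if (i' < K)%N then 0 else y2 r) + \sum_(l < K) g s1 i' (R2 + l)%N * b l r,
  forall j j', (j < i)%N -> (j' < i)%N -> j != j' ->
    row_dot R2 (g s1 j) (g s1 j') = 0 &
  forall i', (i' < i)%N -> (i' < K)%N -> forall rho : nat -> R,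
    (forall j, (j <= i')%N -> row_dot R2 rho (g s1 j) = 0) ->
    row_dot R2 rho (b i') = 0].
have jGW i j : (j < i)%N -> forall r, (r < GW)%N -> (j * GW + r < i * GW)%N.
  by move=> ji r rG; have := leq_mul ji (leqnn GW); rewrite mulSn; lia.
apply: (runs_for (i := vl) (Nv := K.+1) (inv := inv)) => //=.
- move=> i s1 iK [h1 h2 h3 h4 h5] ei off.
  have g1 : imem s1 vyp 0%N = yp by rewrite off.1.
  have g2 : imem s1 vR1 0%N = R1 by rewrite off.1.
  have g3 : imem s1 vR2 0%N = R2 by rewrite off.1.
  have g4 : imem s1 vK 0%N = K by rewrite off.1.
  have g5 : imem s1 asel = imem s asel by rewrite off.1.
  have g6 : rmem s1 adm = rmem s adm by rewrite off.2.
  have g7 : rmem s1 ay = rmem s ay by rewrite off.2.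
  rewrite ltnS in iK.
  apply: (runs_seqf (run_load g1 g2 g3 g4 ei h1 iK)).
  rewrite g5 g6 g7 => s2 [k1 k2 k3] off2.
  have eg2 j r : (j < i)%N -> (r < GW)%N -> g s2 j r = g s1 j r.
    by move=> ji rG; rewrite /g k3 // jGW.
  have RGW r : (r < R2)%N -> (r < GW)%N by move=> rR; rewrite ltn_addr.
  have lGW l : (l < K)%N -> (R2 + l < GW)%N by move=> lK; rewrite ltn_add2l.
  move: (run_orth (s := s2) (R2 := R2) (K := K) (i := i)); cbv zeta => H.
  apply: (runs_seqf (runs_time (H _ _ _ _ _) (_ : _ <= 200 * (K.+1 * GW.+1))%N)) => {H}.
  + by rewrite off2.1.
  + by rewrite off2.1.
  + by rewrite off2.1.
  + by rewrite off2.1.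
  + move=> j j' ji j'i jj'; rewrite -(h4 j j') //.
    by apply: eq_row_dot => r rR; exact: eg2 (RGW _ _).
  + by rewrite leq_mul2l leq_mul2r ltnS iK orbT.
  move=> s3 [m1 m2 [c [m3 m4]]] off3; apply: runs_time (runs_iset _) (leqnn _).
  have eg3 j r : (j < i)%N -> (r < GW)%N -> g s3 j r = g s1 j r.
    by move=> ji rG; rewrite -eg2 // /g m2 // jGW.
  have eLi r : (r < R2)%N -> rmem s2 ag (i * GW + r)%N =
      if (i < K)%N then b i r else y2 r by move=> rR; rewrite k1.
  have eg3i r : (r < GW)%N ->
      g s3 i r = rmem s2 ag (i * GW + r)%N - \sum_(j < i) c j * g s1 j r.
    move=> rG; rewrite /g m3 //; congr (_ - _); apply: eq_bigr => j _.
    by rewrite -/(g s2 j r) eg2.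
  set s4 := State _ _.
  have eg4 j r : g s4 j r = g s3 j r by [].
  split.
  + by rewrite /= !off3.1 //= !off2.1 //= h1 g3 g4 mulSn addnC.
  + by move=> _; rewrite /= m1.
  + move=> i'; rewrite ltnS leq_eqVlt => /orP[/eqP->|i'i] r rR; last first.
      rewrite eg4 eg3 ?RGW // h3 //; congr (_ + _).
      by apply: eq_bigr => l _; rewrite eg4 eg3 // lGW.
    rewrite eg4 eg3i ?RGW // eLi //.
    under [in RHS]eq_bigr => l _.
      rewrite eg4 eg3i ?lGW // addnA k2 // mulrBl mulr_suml; over.
    rewrite sumrB exchange_big /= addrA; congr (_ - _).
      case: ltnP => iK'.
        rewrite add0r (bigD1 (Ordinal iK')) //= eqxx mul1r big1 ?addr0 // => l ne.
        by rewrite (_ : (_ == _) = false) ?mul0r //;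
          apply/negbTE; apply: contra ne => /eqP e; apply/eqP/val_inj.
      rewrite big1 ?addr0 // => l _; rewrite ltn_eqF ?mul0r //.
      exact: leq_trans (ltn_ord l) iK'.
    apply: eq_bigr => j _; rewrite h3 // (leq_trans (ltn_ord j)) // add0r mulr_sumr.
    by apply: eq_bigr => l _; rewrite mulrA.
  + have base j : (j < i)%N -> row_dot R2 (g s3 i) (g s3 j) = 0.
      move=> ji; rewrite -(m4 j ji); apply: eq_row_dot => r rR //.
      by rewrite eg3 ?RGW // -eg2 ?RGW.
    have cs j : (j < i.+1)%N -> j = i \/ (j < i)%N.
      by rewrite ltnS leq_eqVlt => /orP[/eqP->|]; [left | right].
    move=> j j' /cs[->|ji] /cs[->|j'i] jj'.
    * by rewrite eqxx in jj'.
    * exact: base.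
    * by rewrite row_dotC; exact: base.
    * rewrite -(h4 j j') //; apply: eq_row_dot => r rR; exact: eg3 (RGW _ _).
  + move=> i'; rewrite ltnS leq_eqVlt => /orP[/eqP->|i'i] i'K rho orho.
      rewrite (row_dot_comb (i := i) (h := g s3 i) (c := c) (g := g s1)).
      * exact: orho.
      * by move=> r rR; rewrite eg3i ?RGW // eLi // i'K.
      * move=> j ji; rewrite -(orho j (ltnW ji)).
        by apply: eq_row_dot => r rR //; rewrite eg4 eg3 ?RGW.
    apply: h5 => // j ji'; rewrite -(orho j ji').
    apply: eq_row_dot => r rR //; rewrite eg4 eg3 ?RGW //.
    exact: leq_ltn_trans i'i.
- by move=> j s1 _ _ off; rewrite off.1 //= eK addn1.
- move=> s1 [h1 h2 h3 h4 h5]; split; first by rewrite h2.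
  exists (fun l => - g s1 K (R2 + l)%N); split=> [l lK|i iK].
    by rewrite opprK /g addnA.
  apply: h5 => //; first exact: leqW.
  move=> j ji; apply: etrans (h4 K j _ _ _); last 3 first.
  + by [].
  + by rewrite ltnS (leq_trans ji) // ltnW.
  + by rewrite gtn_eqF // (leq_ltn_trans ji).
  apply: eq_row_dot => r rR //; rewrite h3 // ltnn; congr (_ + _).
  by rewrite -sumrN; apply: eq_bigr => l _; rewrite mulNr opprK.
by rewrite /= -/GW; nia.
Qed.

End Pieces.

(** * The whole program on a stored table *)

Section Recovery.
Context {R : realType}.
Implicit Types (s : @state R).

(* What the program is told about the sketch: [ly_a] rows of advice, [ly_NT]
   cells measured exactly, then [ly_S] classes with [ly_R1] hash rows and
   [ly_R2] sign rows each. Class [o] has [ly_NN o] nodes, of which [ly_K o] are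
   picked; node [v] is estimated from the hash rows [ly_phi o v], has column
   [ly_B o v] in the sign rows, and contributes a dipole from pixel [ly_neg o v]
   to pixel [ly_pos o v]. *)
Record layout := Layout {
  ly_a : nat; ly_S : nat; ly_R1 : nat; ly_R2 : nat; ly_NT : nat;
  ly_NN : nat -> nat; ly_K : nat -> nat; ly_top : nat -> nat;
  ly_phi : nat -> nat -> nat -> bool; ly_B : nat -> nat -> nat -> R;
  ly_pos : nat -> nat -> nat; ly_neg : nat -> nat -> nat
}.

Definition rec_size ly := (ly_R1 ly + ly_R2 ly + 2)%N.
Definition class_addr ly o :=
  (5 + ly_NT ly + \sum_(o' < o) (2 + ly_NN ly o' * rec_size ly))%N.
Definition rec_addr ly o v := (class_addr ly o + 2 + v * rec_size ly)%N.
Definition y_addr ly o := (ly_a ly + ly_NT ly + o * (ly_R1 ly + ly_R2 ly))%N.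

Definition header_stored ly (M : nat -> R) : Prop :=
  [/\ M 0%N = (ly_a ly)%:R, M 1%N = (ly_S ly)%:R, M 2%N = (ly_R1 ly)%:R,
      M 3%N = (ly_R2 ly)%:R & M 4%N = (ly_NT ly)%:R].

Definition top_stored ly (M : nat -> R) : Prop :=
  forall t, (t < ly_NT ly)%N -> M (5 + t)%N = (ly_top ly t)%:R.

Definition class_stored ly (M : nat -> R) o : Prop :=
  [/\ M (class_addr ly o) = (ly_NN ly o)%:R,
      M (class_addr ly o + 1)%N = (ly_K ly o)%:R &
      forall v, (v < ly_NN ly o)%N ->
      [/\ forall r, (r < ly_R1 ly)%N ->
             M (rec_addr ly o v + r)%N = (ly_phi ly o v r)%:R,
          forall r, (r < ly_R2 ly)%N ->
             M (rec_addr ly o v + ly_R1 ly + r)%N = ly_B ly o v r,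
          M (rec_addr ly o v + ly_R1 ly + ly_R2 ly)%N = (ly_pos ly o v)%:R &
          M (rec_addr ly o v + ly_R1 ly + ly_R2 ly + 1)%N = (ly_neg ly o v)%:R]].

Definition layout_bounded ly (lim : nat) : Prop :=
  [/\ [/\ ly_a ly <= lim, ly_S ly <= lim, ly_R1 ly <= lim, ly_R2 ly <= lim
       & ly_NT ly <= lim]%N,
      forall t, (t < ly_NT ly)%N -> (ly_top ly t <= lim)%N &
      forall o, (o < ly_S ly)%N ->
        [/\ (ly_NN ly o <= lim)%N, (ly_K ly o <= ly_NN ly o)%N &
         forall v, (v < ly_NN ly o)%N ->
           (ly_pos ly o v <= lim)%N /\ (ly_neg ly o v <= lim)%N]].

(** Least squares is recorded by its normal equations, which keep their meaning for dependent
    columns, where [c] is not unique. *)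
Definition class_solution ly (yy : nat -> R) o (sq : seq nat) (c : nat -> R) : Prop :=
  exists E : nat -> R,
  [/\ forall v, (v < ly_NN ly o)%N ->
        is_est (fun r => yy (y_addr ly o + r)%N) (ly_R1 ly) (ly_phi ly o v) (E v),
      top_selection E (ly_NN ly o) (ly_K ly o) sq &
      forall i, (i < ly_K ly o)%N ->
        row_dot (ly_R2 ly) (fun r => yy (y_addr ly o + ly_R1 ly + r)%N -
             \sum_(l < ly_K ly o) c l * ly_B ly o (nth 0%N sq l) r)
          (ly_B ly o (nth 0%N sq i)) = 0].

Definition class_output ly o (sq : seq nat) (c : nat -> R) (q : nat) : R :=
  \sum_(i < ly_K ly o) c i * ((q == ly_pos ly o (nth 0%N sq i))%:R -
                              (q == ly_neg ly o (nth 0%N sq i))%:R).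

Definition top_output ly (yy : nat -> R) (q : nat) : R :=
  \sum_(t < ly_NT ly) (q == ly_top ly t)%:R * yy (ly_a ly + t)%N.

Definition conv_ready s lim nb : Prop :=
  [/\ imem s vnb 0%N = nb, forall b, (b < nb)%N -> imem s apw b = (2 ^ b)%N &
      (lim < 2 ^ nb)%N].

Lemma runs_conv' dst src s lim nb v :
  conv_ready s lim nb -> dst \notin [:: vb; vnb; apw] -> (v <= lim)%N ->
  rmem s adm (ieval s src) = v%:R ->
  (forall s1, same_off [:: dst; vb] [::] s s1 -> ieval s1 src = ieval s src) ->
  (icost src <= 20)%N ->
  runs (conv dst src) s (100 * nb.+1)%N (fun s1 => imem s1 dst 0%N = v).
Proof.
move=> [r1 r2 r3] d1 vl e1 e2 e3.
by apply: (runs_conv (nb := nb) (v := v)) => //; exact: leq_ltn_trans r3.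
Qed.

Lemma run_write s lim nb K R1 R2 mj (c : nat -> R) (pos neg : nat -> nat) :
  conv_ready s lim nb ->
  imem s vK 0%N = K -> imem s vR1 0%N = R1 -> imem s vR2 0%N = R2 ->
  imem s vmj 0%N = mj ->
  (forall i, (i < K)%N ->
    [/\ rmem s adm (imem s asel i + R1 + R2)%N = (pos i)%:R,
        rmem s adm (imem s asel i + R1 + R2 + 1)%N = (neg i)%:R,
        (pos i <= lim)%N, (neg i <= lim)%N & rmem s ag (mj + R2 + i)%N = - c i]) ->
  runs prog_write s (1000 * (K.+1 * nb.+1))%N (fun s1 => forall q,
    rmem s1 aout q = rmem s aout q +
      \sum_(i < K) c i * ((q == pos i)%:R - (q == neg i)%:R)).
Proof.
move=> rdy eK eR1 eR2 emj hyp; apply: runs_time.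
apply: (runs_for (i := vl) (Nv := K) (inv := fun j s1 => forall q,
    rmem s1 aout q = rmem s aout q +
      \sum_(i < j) c i * ((q == pos i)%:R - (q == neg i)%:R))) => //=.
- by move=> q; rewrite big_ord0 addr0.
- move=> j s1 jK inv ej off.
  have [p1 p2 p3 p4 p5] := hyp _ jK.
  have rdy1 : conv_ready s1 lim nb.
    by case: rdy => r1 r2 r3; split=> //; rewrite off.1.
  have g1 : imem s1 asel = imem s asel by rewrite off.1.
  have g2 : imem s1 vR1 0%N = R1 by rewrite off.1.
  have g3 : imem s1 vR2 0%N = R2 by rewrite off.1.
  have g4 : imem s1 vmj 0%N = mj by rewrite off.1.
  have g5 : rmem s1 adm = rmem s adm by rewrite off.2.
  have g6 : rmem s1 ag = rmem s ag by rewrite off.2.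
  apply: (runs_seqf (runs_conv' (v := pos j) rdy1 _ _ _ _ _)) => //=.
  + by rewrite ej g1 g2 g3 g5.
  + by move=> s2 off2; rewrite !off2.1.
  move=> s2 h1 off2.
  have rdy2 : conv_ready s2 lim nb.
    by case: rdy1 => r1 r2 r3; split=> //; rewrite off2.1.
  have e1 : ieval s2 (IRead asel (% vl) +i % vR1 +i % vR2 +i IConst 1) =
      (imem s asel j + R1 + R2 + 1)%N.
    by rewrite /= !off2.1 //= ej g1 g2 g3.
  apply: (runs_seqf (runs_conv' (v := neg j) rdy2 _ _ _ _ _)) => //=.
  + by rewrite -/(ieval s2 (IRead asel (% vl) +i % vR1 +i % vR2 +i IConst 1)) e1 off2.2 //= g5.
  + by move=> s3 off3; rewrite !off3.1.
  move=> s3 h2 off3.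
  apply: runs_seq; apply: runs_rset; apply: runs_rset => /= q.
  have h1' : imem s3 vpos 0%N = pos j by rewrite off3.1.
  rewrite h1' h2 !off3.1 //= !off3.2 //= !off2.1 //= !off2.2 //= ej g3 g4 g6 p5.
  rewrite !inv big_ord_recr /=.
  (* The corner of a cell can also be the corner of its parent: then both updates hit one pixel and
     cancel. *)
  by case: (q =P neg j) => [<-|qn]; case: (q =P pos j) => [->|qp];
    rewrite ?eqxx /=; ring.
- by move=> j s1 _ _ off; rewrite off.1.
by rewrite /=; nia.
Qed.

(** Keeps every estimate above the sentinel -1 of the selection. *)
Definition y_nonneg ly (yy : nat -> R) : Prop :=
  forall o r, (o < ly_S ly)%N -> (r < ly_R1 ly)%N -> 0 <= yy (y_addr ly o + r)%N.

Lemma run_class s ly yy M lim nb o NNm Km :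
  conv_ready s lim nb -> layout_bounded ly lim -> y_nonneg ly yy ->
  (0 < ly_R1 ly)%N -> (o < ly_S ly)%N -> (ly_NN ly o <= NNm)%N ->
  (ly_K ly o <= Km)%N ->
  class_stored ly M o -> rmem s adm = M -> rmem s ay = yy ->
  imem s vap 0%N = class_addr ly o -> imem s vyp 0%N = y_addr ly o ->
  imem s vR1 0%N = ly_R1 ly -> imem s vR2 0%N = ly_R2 ly ->
  imem s vW 0%N = rec_size ly ->
  runs prog_class s (5000 * (nb.+1 * Km.+1 + (NNm.+1 * (Km + ly_R1 ly).+1) +
      Km.+1 * Km.+1 * (ly_R2 ly + Km).+1))%N (fun s1 =>
    [/\ imem s1 vap 0%N = class_addr ly o.+1, imem s1 vyp 0%N = y_addr ly o.+1 &
    exists sq c, class_solution ly yy o sq c /\ forall q,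
      rmem s1 aout q = rmem s aout q + class_output ly o sq c q]).
Proof.
move=> rdy lb y0 R1_0 oS NNle Kle [m1 m2 m3] eM eyy eap eyp eR1 eR2 eW.
have [_ _ /(_ _ oS)[b1 b2 b3]] := lb.
apply: runs_time.
apply: (runs_seqf (runs_conv' (v := ly_NN ly o) rdy _ _ _ _ _)) => //=.
  by rewrite eM eap.
  by move=> s1 off1; rewrite off1.1.
move=> s1 f1 off1.
have rdy1 : conv_ready s1 lim nb.
  by case: rdy => r1 r2 r3; split=> //; rewrite off1.1.
have ap1 : imem s1 vap 0%N = class_addr ly o by rewrite off1.1.
apply: (runs_seqf (runs_conv' (v := ly_K ly o) rdy1 _ _ _ _ _)) => //=.
  exact: leq_trans b1.
  by rewrite off1.2 //= eM ap1.
  by move=> s2 off2; rewrite off2.1.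
move=> s2 f2 off2; apply: runs_seq; apply: runs_iset.
set s3 := State _ _.
have ap3 : imem s3 vap 0%N = (class_addr ly o + 2)%N.
  by rewrite /= off2.1 //= ap1.
have yp3 : imem s3 vyp 0%N = y_addr ly o by rewrite /= off2.1 //= off1.1.
have NN3 : imem s3 vNN 0%N = ly_NN ly o by rewrite /= off2.1.
have K3 : imem s3 vK 0%N = ly_K ly o by [].
have R13 : imem s3 vR1 0%N = ly_R1 ly by rewrite /= off2.1 //= off1.1.
have R23 : imem s3 vR2 0%N = ly_R2 ly by rewrite /= off2.1 //= off1.1.
have W3 : imem s3 vW 0%N = rec_size ly by rewrite /= off2.1 //= off1.1.
have M3 : rmem s3 adm = M by rewrite /= off2.2 //= off1.2.
have Y3 : rmem s3 ay = yy by rewrite /= off2.2 //= off1.2.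
have out3 : rmem s3 aout = rmem s aout by rewrite /= off2.2 //= off1.2.
have rdy3 : conv_ready s3 lim nb.
  by case: rdy1 => r1 r2 r3; split=> //=; rewrite off2.1.
clearbody s3.
apply: (runs_seqf (runs_time (run_est ap3 yp3 NN3 R13 W3)
  (_ : _ <= 200 * (NNm.+1 * (Km + ly_R1 ly).+1))%N)).
  by nia.
move=> s4 [f4 est4] off4; apply: runs_seq; apply: runs_iset.
set s5 := State _ _.
have est5 v : (v < ly_NN ly o)%N ->
    is_est (fun r => yy (y_addr ly o + r)%N) (ly_R1 ly) (ly_phi ly o v)
      (rmem s5 aest v).
  move=> vN; have [_ h1 h2] := est4 v vN; have [p1 _ _ _] := m3 v vN.
  have ephi r : (r < ly_R1 ly)%N -> (1 <= M (class_addr ly o + 2 +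
      v * rec_size ly + r)%N) = ly_phi ly o v r.
    by move=> rR; rewrite p1 // ler1n; case: (ly_phi _ _ _ _).
  move: est4 => /(_ v vN); rewrite Y3 M3 => -[q1 q2 q3]; split=> //.
    by move=> r rR pr; apply: q2 => //; rewrite ephi.
  case: q3 => [->|[r [r1 r2 r3]]]; [by left|right; exists r; split=> //].
  by rewrite -ephi.
have ap5 : imem s5 vap 0%N = (class_addr ly o + 2)%N by rewrite /= off4.1.
have yp5 : imem s5 vyp 0%N = (y_addr ly o + ly_R1 ly)%N.
  by rewrite /= !off4.1 //= yp3 R13.
have NN5 : imem s5 vNN 0%N = ly_NN ly o by rewrite /= off4.1.
have K5 : imem s5 vK 0%N = ly_K ly o by rewrite /= off4.1.
have R15 : imem s5 vR1 0%N = ly_R1 ly by rewrite /= off4.1.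
have R25 : imem s5 vR2 0%N = ly_R2 ly by rewrite /= off4.1.
have W5 : imem s5 vW 0%N = rec_size ly by rewrite /= off4.1.
have M5 : rmem s5 adm = M by rewrite /= off4.2.
have Y5 : rmem s5 ay = yy by rewrite /= off4.2.
have out5 : rmem s5 aout = rmem s aout by rewrite /= off4.2.
have nq5 : imem s5 vnq 0%N = class_addr ly o.+1.
  by rewrite /= f4 /class_addr big_ord_recr /=; lia.
have rdy5 : conv_ready s5 lim nb.
  by case: rdy3 => r1 r2 r3; split=> //=; rewrite off4.1.
clearbody s5.
apply: (runs_seqf (runs_time (run_select ap5 NN5 W5 K5 b2 _)
  (_ : _ <= 200 * (NNm.+1 * (Km + ly_R1 ly).+1))%N)).
- move=> v vN; have [_ _ [->|[r [r1 _ ->]]]] := est5 v vN; exact: y0.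
- by rewrite leq_mul2l /=; nia.
move=> s6 [sq [tsel sel6]] off6.
have [t1 t2 t3 t4] := tsel.
have yp6 : imem s6 vyp 0%N = (y_addr ly o + ly_R1 ly)%N by rewrite off6.1.
have R16 : imem s6 vR1 0%N = ly_R1 ly by rewrite off6.1.
have R26 : imem s6 vR2 0%N = ly_R2 ly by rewrite off6.1.
have K6 : imem s6 vK 0%N = ly_K ly o by rewrite off6.1.
have M6 : rmem s6 adm = M by rewrite off6.2.
have Y6 : rmem s6 ay = yy by rewrite off6.2.
have sqN i : (i < ly_K ly o)%N -> (nth 0 sq i < ly_NN ly o)%N.
  by move=> iK; apply: t3; rewrite mem_nth // t1.
move: (run_solve yp6 R16 R26 K6); cbv zeta => H.
apply: (runs_seqf (runs_time H (_ : _ <= 1000 *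
   (Km.+1 * Km.+1 * (ly_R2 ly + Km).+1))%N)) => {H}.
  by rewrite leq_mul2l /= !leq_mul ?ltnS ?leq_add2l.
rewrite M6 Y6 => s7 [f7 [c [c1 c2]]] off7.
have M7 : rmem s7 adm = M by rewrite off7.2.
have rdy7 : conv_ready s7 lim nb.
  by case: rdy5 => r1 r2 r3; split=> //; rewrite off7.1 ?off6.1.
have K7 : imem s7 vK 0%N = ly_K ly o by rewrite off7.1.
have R17 : imem s7 vR1 0%N = ly_R1 ly by rewrite off7.1.
have R27 : imem s7 vR2 0%N = ly_R2 ly by rewrite off7.1.
have sel7 : imem s7 asel = imem s6 asel by rewrite off7.1.
have H := run_write (c := c) (pos := fun i => ly_pos ly o (nth 0%N sq i))
   (neg := fun i => ly_neg ly o (nth 0%N sq i)) rdy7 K7 R17 R27 f7.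
apply: (runs_seqf (runs_time (H _) (_ : _ <= 1000 * (nb.+1 * Km.+1))%N)) => {H}.
- move=> i iK; rewrite sel7 sel6 // M7.
  have [_ _ p3 p4] := m3 _ (sqN _ iK); have [p5 p6] := b3 _ (sqN _ iK).
  by split=> //; exact: c1.
- by rewrite leq_mul2l /= mulnC leq_mul ?ltnS.
move=> s8 out8 off8; apply: runs_seq; apply: runs_iset; apply: runs_iset => /=.
split.
- by rewrite off8.1 //= off7.1 //= off6.1.
- rewrite !off8.1 //= off7.1 //= yp6 R27 /y_addr mulSn; lia.
exists sq, c; split; last first.
  by move=> q; rewrite out8 off7.2 //= off6.2 //= out5.
exists (rmem s5 aest); split=> //.
move=> i iK; have [_ p2 _ _] := m3 _ (sqN _ iK).
rewrite -[RHS](c2 i iK); apply: eq_row_dot => r rR; last first.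
  by rewrite sel6 // -p2.
congr (_ - _); apply: eq_bigr => l _; congr (_ * _).
have [_ p2' _ _] := m3 _ (sqN _ (ltn_ord l)).
by rewrite sel6 // -p2'.
by rewrite /=; nia.
Qed.

Lemma run_header s ly M lim nb :
  conv_ready s lim nb -> layout_bounded ly lim -> header_stored ly M ->
  rmem s adm = M ->
  runs prog_header s (1000 * nb.+1)%N (fun s1 =>
    [/\ imem s1 vyp 0%N = ly_a ly, imem s1 vS 0%N = ly_S ly,
        imem s1 vNT 0%N = ly_NT ly, imem s1 vap 0%N = 5 &
        [/\ imem s1 vR1 0%N = ly_R1 ly, imem s1 vR2 0%N = ly_R2 ly &
        imem s1 vW 0%N = rec_size ly]]).
Proof.
move=> rdy [[b1 b2 b3 b4 b5] _ _] [h1 h2 h3 h4 h5] eM; apply: runs_time.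
apply: (runs_seqf (runs_conv' (v := ly_a ly) rdy _ _ _ _ _)) => //=.
  by rewrite eM.
move=> s1 f1 off1.
have rdy1 : conv_ready s1 lim nb.
  by case: rdy => r1 r2 r3; split=> //; rewrite off1.1.
apply: (runs_seqf (runs_conv' (v := ly_S ly) rdy1 _ _ _ _ _)) => //=.
  by rewrite off1.2 //= eM.
move=> s2 f2 off2.
have rdy2 : conv_ready s2 lim nb.
  by case: rdy1 => r1 r2 r3; split=> //; rewrite off2.1.
apply: (runs_seqf (runs_conv' (v := ly_R1 ly) rdy2 _ _ _ _ _)) => //=.
  by rewrite off2.2 //= off1.2 //= eM.
move=> s3 f3 off3.
have rdy3 : conv_ready s3 lim nb.
  by case: rdy2 => r1 r2 r3; split=> //; rewrite off3.1.
apply: (runs_seqf (runs_conv' (v := ly_R2 ly) rdy3 _ _ _ _ _)) => //=.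
  by rewrite off3.2 //= off2.2 //= off1.2 //= eM.
move=> s4 f4 off4.
have rdy4 : conv_ready s4 lim nb.
  by case: rdy3 => r1 r2 r3; split=> //; rewrite off4.1.
apply: (runs_seqf (runs_conv' (v := ly_NT ly) rdy4 _ _ _ _ _)) => //=.
  by rewrite off4.2 //= off3.2 //= off2.2 //= off1.2 //= eM.
move=> s5 f5 off5; apply: runs_seq; apply: runs_iset; apply: runs_iset => /=.
have e1 : imem s5 vR1 0%N = ly_R1 ly by rewrite off5.1 //= off4.1.
have e2 : imem s5 vR2 0%N = ly_R2 ly by rewrite off5.1.
split=> //; first by rewrite off5.1 //= off4.1 //= off3.1 //= off2.1.
  by rewrite off5.1 //= off4.1 //= off3.1.
by rewrite e1 e2; split.
by rewrite /=; nia.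
Qed.

Lemma run_top s ly yy M lim nb :
  conv_ready s lim nb -> layout_bounded ly lim -> top_stored ly M ->
  rmem s adm = M -> rmem s ay = yy -> (forall q, rmem s aout q = 0) ->
  imem s vap 0%N = 5 -> imem s vyp 0%N = ly_a ly -> imem s vNT 0%N = ly_NT ly ->
  runs prog_top s (1000 * ((ly_NT ly).+1 * nb.+1))%N (fun s1 =>
    [/\ imem s1 vap 0%N = (5 + ly_NT ly)%N,
        imem s1 vyp 0%N = (ly_a ly + ly_NT ly)%N &
        forall q, rmem s1 aout q = top_output ly yy q]).
Proof.
move=> rdy [_ tb _] st eM eyy out0 eap eyp eNT; apply: runs_time.
apply: (runs_for (i := vi) (Nv := ly_NT ly) (inv := fun j s1 =>
    [/\ imem s1 vap 0%N = (5 + j)%N, imem s1 vyp 0%N = (ly_a ly + j)%N &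
        forall q, rmem s1 aout q =
          \sum_(t < j) (q == ly_top ly t)%:R * yy (ly_a ly + t)%N])) => //=.
- by split=> // [|q]; rewrite ?addn0 // big_ord0 out0.
- move=> j s1 jN [f1 f2 f3] ej off.
  have rdy1 : conv_ready s1 lim nb.
    by case: rdy => r1 r2 r3; split=> //; rewrite off.1.
  apply: (runs_seqf (runs_conv' (v := ly_top ly j) rdy1 _ _ _ _ _)) => //=.
  + exact: tb.
  + by rewrite f1 off.2 //= eM st.
  + by move=> s2 off2; rewrite off2.1.
  move=> s2 g1 off2; apply: runs_seq; apply: runs_rset; apply: runs_seq.
  apply: runs_iset; apply: runs_iset => /=; split.
  + by rewrite off2.1 //= f1 addn1 addnS.
  + by rewrite off2.1 //= f2 addn1 addnS.
  + move=> q; rewrite g1 !off2.2 //= off2.1 //= f2 (off.2 2%N) // eyy !f3.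
    rewrite big_ord_recr /=; case: (q =P _) => [->|_]; first by rewrite mul1r.
    by rewrite mul0r addr0.
- by move=> j s1 _ _ off; rewrite off.1.
by rewrite /=; nia.
Qed.

Definition dense (m n : nat) (A : 'M[R]_(m, n)) (q : nat) : R :=
  match insub (q %/ n)%N, insub (q %% n)%N with
  | Some i, Some j => A i j
  | _, _ => 0
  end.

Lemma denseE m n (A : 'M[R]_(m, n)) (i : 'I_m) (j : 'I_n) :
  dense A (i * n + j) = A i j.
Proof.
have n0 : (0 < n)%N by apply: leq_ltn_trans (ltn_ord j).
by rewrite /dense divnMDl // modnMDl divn_small // modn_small // addn0 !valK.
Qed.

Definition cells m (y : 'cV[R]_m) (q : nat) : R := nth 0 [seq y i 0 | i <- enum 'I_m] q.

Lemma mem_nz_entries m n (A : 'M[R]_(m, n)) ij :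
  (ij \in nz_entries A) = (A ij.1 ij.2 != 0).
Proof.
rewrite mem_filter; case: (A ij.1 ij.2 != 0) => //=; case: ij => i j.
by apply/allpairsP; exists (j, i); rewrite !mem_enum.
Qed.

Lemma run_recovery D k eps m (A : 'M[R]_(m, D ^ 2)) (y : 'cV[R]_m) ly NNm Km :
  let n := (D ^ 2)%N in
  let lim := (m + n + n)%N in
  let nb := (trunc_log 2 lim).+1 in
  (0 < D)%N -> layout_bounded ly lim -> y_nonneg ly (cells y) ->
  (0 < ly_R1 ly)%N ->
  (forall o, (o < ly_S ly)%N -> (ly_NN ly o <= NNm)%N /\ (ly_K ly o <= Km)%N) ->
  header_stored ly (dense A) -> top_stored ly (dense A) ->
  (forall o, (o < ly_S ly)%N -> class_stored ly (dense A) o) ->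
  runs recovery (ram_input k eps A y)
    (100 * 100 * (n + m + size (nz_entries A) + (ly_NT ly).+1 * nb.+1 +
       ly_S ly * (nb.+1 * Km.+1 + (NNm.+1 * (Km + ly_R1 ly).+1) +
      Km.+1 * Km.+1 * (ly_R2 ly + Km).+1) + 1))%N
    (fun s1 => exists sqs cs,
      (forall o, (o < ly_S ly)%N ->
         class_solution ly (cells y) o (sqs o) (cs o)) /\
      forall q, rmem s1 aout q = top_output ly (cells y) q +
        \sum_(o < ly_S ly) class_output ly o (sqs o) (cs o) q).
Proof.
move=> n lim nb D0 lb y0 R1_0 NNK hs ts cs; apply: runs_time.
set s := ram_input k eps A y.
have n0 : (0 < n)%N by rewrite expn_gt0 D0.
have nE : n = (D * D)%N by rewrite /n expnS expn1.
apply: (runs_seqf (run_sizes (s := s) (D := D) (m := m) _ _)) => //.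
rewrite -nE => s1 [n1 mul1] off1.
pose nz := nz_entries A.
pose ri e := nth 0%N [seq nat_of_ord ij.1 | ij <- nz] e.
pose ci e := nth 0%N [seq nat_of_ord ij.2 | ij <- nz] e.
pose val e := nth 0 [seq A ij.1 ij.2 | ij <- nz] e.
have nzE e : (e < size nz)%N -> exists ij, [/\ ij \in nz,
    ri e = ij.1, ci e = ij.2 & val e = A ij.1 ij.2].
  move=> eN; have [x0 _] : exists x0, x0 \in nz.
    by move: eN; case E: nz => [//|x0 nz'] _; exists x0; rewrite inE eqxx.
  by exists (nth x0 nz e); rewrite mem_nth // /ri /ci /val !(nth_map x0).
apply: (runs_seqf (run_dense (s := s1) (n := n) (m := m) (N := size nz)
   (ri := ri) (ci := ci) (val := val) _ _ _)).
- by rewrite off1.1.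
- by move=> i /mul1 ->; rewrite nE.
- move=> e eN; have [ij [_ e1 _ _]] := nzE e eN.
  by rewrite !off1.1 //= off1.2 //=; split=> //; rewrite e1.
move=> s2 dm2 off2.
have M2 : rmem s2 adm = dense A.
  apply/boolp.funext=> q; case: (dm2 q) => [[e [eN <- ->]]|[ne ->]].
    have [ij [_ -> -> ->]] := nzE e eN; by rewrite denseE.
  rewrite off1.2 // /dense /=; case: insubP => [i _ iE|_]; last by rewrite nth_nil.
  case: insubP => [j _ jE|_]; last by rewrite nth_nil.
  rewrite nth_nil; apply/esym/eqP/negPn/negP => nzA.
  have ijnz : (i, j) \in nz by rewrite mem_nz_entries.
  have eN : (index (i, j) nz < size nz)%N by rewrite index_mem.
  apply: (ne _ eN); rewrite /ri /ci !(nth_map (i, j)) // nth_index //=.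
  by rewrite iE jE -divn_eq.
apply: (runs_seqf (run_powers (n := n) (m := m) _ _ n0)).
- by rewrite off2.1.
- by rewrite off2.1 //= off1.1.
move=> s3 [nb3 pw3] off3.
have rdy3 : conv_ready s3 lim nb.
  by split=> // [b /ltnW/pw3 //|]; exact: trunc_log_ltn.
have M3 : rmem s3 adm = dense A by rewrite off3.2.
apply: (runs_seqf (run_header rdy3 lb hs M3)).
move=> s4 [yp4 S4 NT4 ap4 [R14 R24 W4]] off4.
have rdy4 : conv_ready s4 lim nb.
  by case: rdy3 => r1 r2 r3; split=> //; rewrite off4.1.
have M4 : rmem s4 adm = dense A by rewrite off4.2.
have Y4 : rmem s4 ay = cells y.
  by rewrite off4.2 //= off3.2 //= off2.2 //= off1.2.
have out4 q : rmem s4 aout q = 0.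
  by rewrite off4.2 //= off3.2 //= off2.2 //= off1.2 //= nth_nil.
apply: (runs_seqf (run_top rdy4 lb ts M4 Y4 out4 ap4 yp4 NT4)).
move=> s5 [ap5 yp5 out5] off5.
have rdy5 : conv_ready s5 lim nb.
  by case: rdy4 => r1 r2 r3; split=> //; rewrite off5.1.
have M5 : rmem s5 adm = dense A by rewrite off5.2.
have Y5 : rmem s5 ay = cells y by rewrite off5.2.
have S5 : imem s5 vS 0%N = ly_S ly by rewrite off5.1.
apply: (runs_for (i := vo) (Nv := ly_S ly) (inv := fun o s6 =>
   [/\ imem s6 vap 0%N = class_addr ly o, imem s6 vyp 0%N = y_addr ly o &
    exists sqs cs,
      (forall o', (o' < o)%N -> class_solution ly (cells y) o' (sqs o') (cs o')) /\
      forall q, rmem s6 aout q = top_output ly (cells y) q +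
        \sum_(o' < o) class_output ly o' (sqs o') (cs o') q])) => //=.
- split; first by rewrite ap5 /class_addr big_ord0 addn0.
    by rewrite yp5 /y_addr mul0n addn0.
  exists (fun=> [::]), (fun=> fun=> 0); split=> // q.
  by rewrite out5 big_ord0 addr0.
- move=> o s6 oS [ap6 yp6 [sqs [cs' [sol6 out6]]]] eo off6.
  have [NNo Ko] := NNK o oS.
  have rdy6 : conv_ready s6 lim nb.
    by case: rdy5 => r1 r2 r3; split=> //; rewrite off6.1.
  have M6 : rmem s6 adm = dense A by rewrite off6.2.
  have Y6 : rmem s6 ay = cells y by rewrite off6.2.
  have R16 : imem s6 vR1 0%N = ly_R1 ly by rewrite off6.1 //= off5.1.
  have R26 : imem s6 vR2 0%N = ly_R2 ly by rewrite off6.1 //= off5.1.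
  have W6 : imem s6 vW 0%N = rec_size ly by rewrite off6.1 //= off5.1.
  apply: (runs_post (run_class rdy6 lb y0 R1_0 oS NNo Ko (cs o oS) M6 Y6 ap6
     yp6 R16 R26 W6)) => s7 [ap7 yp7 [sq [c [sol7 out7]]]] _.
  split=> //.
  exists (fun o' => if o' == o then sq else sqs o'),
         (fun o' => if o' == o then c else cs' o'); split.
    move=> o'; rewrite ltnS leq_eqVlt => /orP[/eqP->|o'o]; first by rewrite eqxx.
    by rewrite (ltn_eqF o'o); exact: sol6.
  move=> q; rewrite out7 out6 big_ord_recr /= eqxx addrA; congr (_ + _ + _).
  by apply: eq_bigr => o' _; rewrite (ltn_eqF (ltn_ord o')).
- by move=> o s6 _ _ off6; rewrite off6.1.
- by move=> s6 [_ _].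
have Dn : (D <= n)%N by rewrite /n expnS expn1 leq_pmulr.
rewrite -/nb /=; set N0 := size _; set X := (nb.+1 * _ + _ + _)%N.
have X0 : (0 < X)%N by rewrite /X; lia.
have h1 : (nb.+1 <= (ly_NT ly).+1 * nb.+1)%N by rewrite leq_pmull.
have h2 : (ly_S ly <= ly_S ly * X)%N by rewrite leq_pmulr.
have -> : (ly_S ly * (2 + 5000 * X + 10) = 5000 * (ly_S ly * X) + 12 * ly_S ly)%N.
  by ring.
by move: ((ly_NT ly).+1 * nb.+1)%N (ly_S ly * X)%N h1 h2 => u v; clear -Dn; lia.
Qed.

End Recovery.

(** * Restricted isometry of random signs *)

Section Signs.
Context {R : realType}.

(** A weak form of [cosh x <= exp (x ^ 2 / 2)]. For [x > 1 / 2] use [x <= 2 * x ^ 2]; below, [exp y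
    <= 1 / (1 - y) <= 1 + y + 2 * y ^ 2] for [y = x] and [y = - x], and the linear terms cancel. *)
Lemma cosh_le (x : R) : expR x + expR (- x) <= 2 * expR (2 * x ^+ 2).
Proof.
wlog x0 : x / 0 <= x.
  move=> H; case: (leP 0 x) => [/H //|/ltW xn].
  by have := H (- x); rewrite opprK sqrrN addrC oppr_ge0; exact.
have [x1|x1] := leP x (1 / 2); last first.
  have h1 : expR x <= expR (2 * x ^+ 2) by rewrite ler_expR; nra.
  have h2 : expR (- x) <= expR x by rewrite ler_expR; lra.
  by move: h1 h2; lra.
have bnd (y : R) : y <= 1 / 2 -> expR y <= 1 + y + 2 * y ^+ 2.
  move=> y1; have h := expR_ge1Dx (- y).
  have p := expR_gt0 y; have pn := expR_gt0 (- y).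
  have e : expR y * expR (- y) = 1 by rewrite -expRD subrr expR0.
  have h3 : expR y * (1 - y) <= 1 by rewrite -e ler_pM2l // ; lra.
  have : expR y * (1 - y) <= (1 + y + 2 * y ^+ 2) * (1 - y).
    by apply: le_trans h3 _; nra.
  by rewrite ler_pM2r; lra.
have h1 := bnd x x1; have h2 := bnd (- x) ltac:(lra).
have h3 := expR_ge1Dx (2 * x ^+ 2).
by rewrite sqrrN in h2; lra.
Qed.

Variable V : finType.
Notation signs := {ffun V -> bool}.

Definition sg (b : bool) : R := if b then 1 else -1.

Lemma sgN b : sg (~~ b) = - sg b.
Proof. by case: b; rewrite /= ?opprK. Qed.

Lemma sg_sqr b : sg b ^+ 2 = 1.
Proof. by case: b; rewrite /sg ?sqrrN expr1n. Qed.

Definition flip (v : V) (tau : signs) : signs :=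
  [ffun u => if u == v then ~~ tau u else tau u].

Lemma flipK v : involutive (flip v).
Proof.
by move=> tau; apply/ffunP => u; rewrite !ffunE; case: eqP => // _; rewrite negbK.
Qed.

Definition rsum (l : seq V) (z : V -> R) (tau : signs) : R :=
  \sum_(v <- l) sg (tau v) * z v.

(** Pair each sign vector with its flip at [v]: the cross terms form a hyperbolic cosine, and the
    exponent from [cosh_le] joins the coefficient of the remaining sum. As [s] may be negative, one
    step serves both tails. *)
Lemma mgf_step (v : V) l (z : V -> R) (s : R) : v \notin l ->
  \sum_(tau : signs) expR (s * rsum (v :: l) z tau ^+ 2) <=
  expR (s * z v ^+ 2) *
    \sum_(tau : signs) expR (s * (1 + 8 * s * z v ^+ 2) * rsum l z tau ^+ 2).
Proof.
move=> vl; rewrite -(ler_pM2l (_ : 0 < 2 :> R)) //.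
set f := fun tau : signs => expR (s * rsum (v :: l) z tau ^+ 2).
have -> : 2 * (\sum_tau f tau) = \sum_tau (f (flip v tau) + f tau).
  have e : \sum_tau f tau = \sum_tau f (flip v tau).
    exact: (reindex_inj (inv_inj (flipK v))).
  by rewrite big_split /= -e; ring.
rewrite mulr_sumr mulr_sumr; apply: ler_sum => tau _; rewrite /f.
have -> : rsum (v :: l) z (flip v tau) = rsum l z tau - sg (tau v) * z v.
  rewrite /rsum big_cons ffunE eqxx sgN mulNr addrC; congr (_ - _).
  rewrite big_seq [RHS]big_seq; apply: eq_bigr => u ul.
  by rewrite ffunE; case: eqP => // uv; rewrite uv (negPf vl) in ul.
have -> : rsum (v :: l) z tau = rsum l z tau + sg (tau v) * z v.
  by rewrite /rsum big_cons addrC.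
set Y := rsum l z tau; set a := sg (tau v) * z v.
have a2 : a ^+ 2 = z v ^+ 2 by rewrite exprMn sg_sqr mul1r.
pose A := s * (Y ^+ 2 + z v ^+ 2); pose b := 2 * s * Y * a.
have -> : s * (Y - a) ^+ 2 = A + - b by rewrite /A /b -a2; ring.
have -> : s * (Y + a) ^+ 2 = A + b by rewrite /A /b -a2; ring.
have -> : expR (s * z v ^+ 2) * expR (s * (1 + 8 * s * z v ^+ 2) * Y ^+ 2) =
    expR A * expR (2 * b ^+ 2).
  by rewrite -!expRD; congr expR; rewrite /A /b -a2; ring.
rewrite !expRD -mulrDr mulrCA ler_pM2l ?expR_gt0 // addrC; exact: cosh_le.
Qed.

Definition sqn (l : seq V) (z : V -> R) : R := \sum_(v <- l) z v ^+ 2.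

Lemma sqn_ge0 l z : 0 <= sqn l z.
Proof. by apply: sumr_ge0 => v _; exact: sqr_ge0. Qed.

Lemma mgf_pos l (z : V -> R) (s : R) : uniq l -> 0 <= s -> 16 * s * sqn l z <= 1 ->
  \sum_(tau : signs) expR (s * rsum l z tau ^+ 2) <=
  #|signs|%:R * expR (2 * s * sqn l z).
Proof.
elim: l s => [|v l IH] s /=.
  move=> _ _ _; rewrite /sqn big_nil mulr0 expR0 mulr1.
  by under eq_bigr do rewrite /rsum big_nil expr0n mulr0 expR0; rewrite big_const iter_addr_0.
move=> /andP[vl ul] s0; rewrite {1}/sqn big_cons -/(sqn l z) => sV.
apply: le_trans (mgf_step _ _ vl) _.
have W0 := sqn_ge0 l z; have z0 := sqr_ge0 (z v).
set W := sqn l z in W0 sV *; set a := z v ^+ 2 in z0 sV *.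
have sa0 : 0 <= s * a by rewrite mulr_ge0.
have sW0 : 0 <= s * W by rewrite mulr_ge0.
have s1 : 0 <= s * (1 + 8 * s * a) by rewrite mulr_ge0 //; nra.
(* The induction raises [s] to [s * (1 + 8 * s * a)]. By [16 * s * W <= 1] this raises [s * W] by at
   most [s * a / 2], so the smallness hypothesis and the factor 2 of the conclusion both survive. *)
have key : 8 * (s * a) * (s * W) <= s * a / 2 by nra.
apply: le_trans (ler_wpM2l (expR_ge0 _) (IH _ ul s1 _)) _.
  by rewrite -/W; nra.
rewrite mulrCA ler_wpM2l // -expRD ler_expR /sqn big_cons -/(sqn l z) -/a -/W.
by nra.
Qed.

Lemma mgf_neg l (z : V -> R) (s : R) : uniq l -> 0 <= s -> 16 * s * sqn l z <= 1 ->
  \sum_(tau : signs) expR (- s * rsum l z tau ^+ 2) <=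
  #|signs|%:R * expR (- (s * sqn l z / 2)).
Proof.
elim: l s => [|v l IH] s /=.
  move=> _ _ _; rewrite /sqn big_nil mulr0 mul0r oppr0 expR0 mulr1.
  by under eq_bigr do rewrite /rsum big_nil expr0n mulr0 expR0; rewrite big_const iter_addr_0.
move=> /andP[vl ul] s0; rewrite {1}/sqn big_cons -/(sqn l z) => sV.
apply: le_trans (mgf_step _ _ vl) _.
have W0 := sqn_ge0 l z; have z0 := sqr_ge0 (z v).
set W := sqn l z in W0 sV *; set a := z v ^+ 2 in z0 sV *.
have sa0 : 0 <= s * a by rewrite mulr_ge0.
have sW0 : 0 <= s * W by rewrite mulr_ge0.
have s1 : 0 <= s * (1 - 8 * s * a) by rewrite mulr_ge0 //; nra.
have key : 8 * (s * a) * (s * W) <= s * a / 2 by nra.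
have -> : - s * (1 + 8 * - s * a) = - (s * (1 - 8 * s * a)) by ring.
apply: le_trans (ler_wpM2l (expR_ge0 _) (IH _ ul s1 _)) _.
  by rewrite -/W; nra.
rewrite mulrCA ler_wpM2l // -expRD ler_expR /sqn big_cons -/(sqn l z) -/a -/W.
by nra.
Qed.

Variable m : nat.
Notation signmx := {ffun 'I_m -> signs}.

Definition nsq (z : V -> R) : R := \sum_v z v ^+ 2.
Definition bsum (z : V -> R) (tau : signs) : R := \sum_v sg (tau v) * z v.
Definition bsq (sigma : signmx) (z : V -> R) : R :=
  \sum_(i < m) bsum z (sigma i) ^+ 2.

Lemma nsq_ge0 z : 0 <= nsq z. Proof. exact: sqn_ge0. Qed.
Lemma bsq_ge0 sigma z : 0 <= bsq sigma z.
Proof. by apply: sumr_ge0 => i _; exact: sqr_ge0. Qed.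

(** Independence of the rows of a uniformly random sign matrix. *)
Lemma sum_rows (F : signs -> R) :
  \sum_(sigma : signmx) \prod_(i < m) F (sigma i) = (\sum_tau F tau) ^+ m.
Proof.
rewrite -(bigA_distr_bigA (fun _ => F)) /= prodr_const.
by rewrite card_ord.
Qed.

Lemma card_signmx : (#|{: signmx}|%:R : R) = #|{: signs}|%:R ^+ m.
Proof. by rewrite card_ffun card_ord natrX. Qed.

Lemma avg_pos (z : V -> R) (s : R) : 0 <= s -> 16 * s * nsq z <= 1 ->
  \sum_(sigma : signmx) expR (s * bsq sigma z) <=
  #|{: signmx}|%:R * expR (2 * s * nsq z * m%:R).
Proof.
move=> s0 sV; under eq_bigr do rewrite mulr_sumr expR_sum.
rewrite (sum_rows (fun tau => expR (s * bsum z tau ^+ 2))).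
rewrite card_signmx expRM_natr -exprMn.
apply: lerXn2r; rewrite ?nnegrE ?mulr_ge0 ?expR_ge0 //.
  by apply: sumr_ge0 => i _; exact: expR_ge0.
exact: mgf_pos (index_enum_uniq _) s0 sV.
Qed.

Lemma avg_neg (z : V -> R) (s : R) : 0 <= s -> 16 * s * nsq z <= 1 ->
  \sum_(sigma : signmx) expR (- s * bsq sigma z) <=
  #|{: signmx}|%:R * expR (- (s * nsq z / 2) * m%:R).
Proof.
move=> s0 sV; under eq_bigr do rewrite mulr_sumr expR_sum.
rewrite (sum_rows (fun tau => expR (- s * bsum z tau ^+ 2))).
rewrite card_signmx expRM_natr -exprMn.
apply: lerXn2r; rewrite ?nnegrE ?mulr_ge0 ?expR_ge0 //.
  by apply: sumr_ge0 => i _; exact: expR_ge0.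
exact: mgf_neg (index_enum_uniq _) s0 sV.
Qed.

Lemma bsumD (x u w : V -> R) tau : (forall v, x v = u v + w v) ->
  bsum x tau = bsum u tau + bsum w tau.
Proof.
by move=> e; rewrite /bsum -big_split; apply: eq_bigr => v _; rewrite e mulrDr.
Qed.

Lemma bsumZ (x u : V -> R) c tau : (forall v, x v = c * u v) ->
  bsum x tau = c * bsum u tau.
Proof.
by move=> e; rewrite /bsum mulr_sumr; apply: eq_bigr => v _; rewrite e mulrCA.
Qed.

Lemma bsqZ sigma (x u : V -> R) c : (forall v, x v = c * u v) ->
  bsq sigma x = c ^+ 2 * bsq sigma u.
Proof.
move=> e; rewrite /bsq mulr_sumr; apply: eq_bigr => i _.
by rewrite (bsumZ _ e) exprMn.
Qed.

Lemma sqrD_le (t a b : R) : 0 < t ->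
  (a + b) ^+ 2 <= (1 + t) * a ^+ 2 + (1 + t^-1) * b ^+ 2.
Proof.
move=> t0; rewrite -subr_ge0.
have -> : (1 + t) * a ^+ 2 + (1 + t^-1) * b ^+ 2 - (a + b) ^+ 2 =
    t^-1 * (t * a - b) ^+ 2 by field; rewrite gt_eqF.
by rewrite mulr_ge0 ?sqr_ge0 // invr_ge0 ltW.
Qed.

Lemma bsqD_le sigma (t : R) (x u w : V -> R) : 0 < t ->
  (forall v, x v = u v + w v) ->
  bsq sigma x <= (1 + t) * bsq sigma u + (1 + t^-1) * bsq sigma w.
Proof.
move=> t0 e; rewrite /bsq !mulr_sumr -big_split; apply: ler_sum => i _.
by rewrite (bsumD _ e); exact: sqrD_le.
Qed.

Lemma nsqD_le (t : R) (x u w : V -> R) : 0 < t -> (forall v, x v = u v + w v) ->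
  nsq x <= (1 + t) * nsq u + (1 + t^-1) * nsq w.
Proof.
move=> t0 e; rewrite /nsq !mulr_sumr -big_split; apply: ler_sum => i _.
by rewrite e; exact: sqrD_le.
Qed.

Lemma sqr_sum_le (I : finType) (P : pred I) (F : I -> R) :
  (\sum_(i | P i) F i) ^+ 2 <= #|P|%:R * \sum_(i | P i) F i ^+ 2.
Proof.
set S := \sum_(i | P i) F i; set Q := \sum_(i | P i) F i ^+ 2.
have [p0|p0] := posnP #|P|.
  have : S = 0.
    by apply: big_pred0 => i; have := card0_eq p0 i; rewrite !inE.
  by move=> ->; rewrite p0 mul0r expr0n.
have N0 : 0 < #|P|%:R :> R by rewrite ltr0n.
have : 0 <= \sum_(i | P i) (#|P|%:R * F i - S) ^+ 2.
  by apply: sumr_ge0 => i _; exact: sqr_ge0.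
under eq_bigr do rewrite sqrrB exprMn.
rewrite big_split /= sumrB -mulr_sumr -/Q.
have -> : \sum_(i | P i) (#|P|%:R * F i * S) *+ 2 = 2 * #|P|%:R * S ^+ 2.
  under eq_bigr do rewrite -mulr_natl mulrA.
  rewrite -mulr_suml -mulr_sumr.
  under eq_bigr do rewrite mulrC.
  by rewrite -mulr_suml -/S; ring.
have -> : \sum_(i | P i) S ^+ 2 = #|P|%:R * S ^+ 2.
  by rewrite sumr_const mulr_natl.
have -> : #|P|%:R ^+ 2 * Q - 2 * #|P|%:R * S ^+ 2 + #|P|%:R * S ^+ 2 =
  #|P|%:R * (#|P|%:R * Q - S ^+ 2) by ring.
by rewrite pmulr_rge0 // subr_ge0.
Qed.

(** The starting point of the bootstrapping of the upper bound in [signs_exist]. *)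
Lemma bsq_crude sigma z : bsq sigma z <= m%:R * #|V|%:R * nsq z.
Proof.
apply: le_trans (_ : \sum_(i < m) #|V|%:R * nsq z <= _).
  apply: ler_sum => i _; apply: le_trans (sqr_sum_le _ _) _.
  rewrite ler_wpM2l // /nsq; apply: ler_sum => v _.
  by rewrite exprMn sg_sqr mul1r.
by rewrite sumr_const card_ord -[leLHS]mulr_natl mulrA.
Qed.

Lemma sum_half_le (M : nat) : \sum_(j < M) (1 / 2 : R) ^+ j <= 2.
Proof.
suff -> : \sum_(j < M) (1 / 2 : R) ^+ j = 2 - 2 * (1 / 2) ^+ M.
  by rewrite gerBl; apply: mulr_ge0 => //; apply: exprn_ge0; lra.
elim: M => [|M IH]; first by rewrite big_ord0 expr0; lra.
by rewrite big_ord_recr /= IH exprS; lra.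
Qed.

Definition ndist (a b : nat) : nat := (a - b) + (b - a).

Lemma sum_ndist_le (M : nat) : \sum_(j < M.*2.+1) (1 / 2 : R) ^+ ndist j M <= 3.
Proof.
rewrite -(big_mkord xpredT (fun j => (1 / 2 : R) ^+ ndist j M)).
rewrite (big_cat_nat _ (n := M)) //=; last by rewrite -addnn; lia.
have -> : 3 = 1 + 2 :> R by ring.
apply: lerD.
  rewrite big_mkord (reindex_inj rev_ord_inj) /=.
  have h := sum_half_le M.
  apply: le_trans (_ : 1 / 2 * \sum_(j < M) (1 / 2 : R) ^+ j <= _); last by lra.
  rewrite mulr_sumr; apply: ler_sum => j _; rewrite -exprS /ndist.
  by have -> : (M - j.+1 - M + (M - (M - j.+1)) = j.+1)%N by have := ltn_ord j; lia.
rewrite -{1}[M]add0n big_addn big_mkord.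
have -> : (M.*2.+1 - M = M.+1)%N by rewrite -addnn; lia.
apply: le_trans (sum_half_le M.+1); apply: ler_sum => j _.
by rewrite /ndist; have -> : (j + M - M + (M - (j + M)) = j)%N by lia.
Qed.

End Signs.

(** * A lattice net for vectors supported on a small set *)

Section Net.
Context {R : realType}.
Variable V : finType.
Variables (K1 M : nat).
Notation points := {ffun V -> 'I_(M.*2.+1)}.

(** Integer points with coordinates between [- M] and [M], stored with a shift by [M] to form a
    finite type. *)
Definition zval (zeta : points) (v : V) : R := (zeta v)%:R - M%:R.

Definition in_net (X : {set V}) (zeta : points) : bool :=
  [forall v, (v \in X) || (zeta v == M :> nat)] &&
  (nsq (zval zeta) <= (81 * K1)%:R).

Lemma ndist_sqr (zeta : points) v : (ndist (zeta v) M)%:R <= zval zeta v ^+ 2.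
Proof.
rewrite /zval /ndist; case: (leqP (zeta v) M) => le.
  have -> : (zeta v - M + (M - zeta v) = M - zeta v)%N by lia.
  rewrite -sqrrN opprB -natrB // -natrX ler_nat expnS expn1.
  by case: (M - zeta v)%N => // d; rewrite leq_pmulr.
have -> : (zeta v - M + (M - zeta v) = zeta v - M)%N by lia.
rewrite -natrB ?(ltnW le) // -natrX ler_nat expnS expn1.
by case: (zeta v - M)%N => // d; rewrite leq_pmulr.
Qed.

(** Weight each point by the product of [2 ^ - |z v|] over all [v], with [z = zval zeta]. The points
    supported on [X] weigh at most [3 ^ #|X|] in total. For integers the sum of [|z v|] is at most
    the squared norm, so a net point weighs at least [2 ^ - (81 * K1)]. *)
Lemma card_net (X : {set V}) :
  #|in_net X|%:R <= (2 ^+ (81 * K1) * 3 ^+ #|X| : R).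
Proof.
pose Q v (j : 'I_(M.*2.+1)) := (v \in X) || (j == M :> nat).
pose F (v : V) (j : 'I_(M.*2.+1)) : R := (1 / 2) ^+ ndist j M.
have F0 v j : 0 <= F v j by apply: exprn_ge0; lra.
have le1 : \sum_(zeta in family Q) \prod_v F v (zeta v) <= 3 ^+ #|X|.
  rewrite -(bigA_distr_big_dep Q F).
  rewrite -prodr_const [leRHS]big_mkcond /=; apply: ler_prod => v _.
  rewrite sumr_ge0 //=; case: ifP => vX; last first.
    rewrite (big_pred1 (inord M)) => [|j]; last first.
      rewrite /Q vX /= -val_eqE /= inordK //; rewrite -addnn; lia.
    by rewrite /F inordK ?/ndist ?subnn //; rewrite -addnn; lia.
  apply: le_trans (sum_ndist_le M); rewrite big_mkcond; apply: ler_sum => j _.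
  by case: ifP => // _; exact: F0.
apply: le_trans (ler_wpM2l (exprn_ge0 _ _) le1) => //.
rewrite mulr_sumr -sum1_card natr_sum.
rewrite [leLHS]big_mkcond [leRHS]big_mkcond /=; apply: ler_sum => zeta _.
case: ifP => [|_]; last by case: ifP => // _; rewrite mulr_ge0 ?exprn_ge0 ?prodr_ge0.
rewrite unfold_in /in_net => /andP[/forallP h1 h2].
rewrite ifT; last by apply/familyP => v; exact: h1.
have le2 : (\sum_v ndist (zeta v) M <= 81 * K1)%N.
  rewrite -(ler_nat R); apply: le_trans h2; rewrite natr_sum.
  by apply: ler_sum => v _; exact: ndist_sqr.
rewrite /F prodrXr; apply: le_trans (_ : 2 ^+ (81 * K1) * (1 / 2) ^+ (81 * K1) <= _).
  by rewrite -exprMn (_ : 2 * (1 / 2) = 1 :> R) ?expr1n //; lra.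
rewrite ler_pM2l ?exprn_gt0 //; apply: ler_wiXn2l => //; lra.
Qed.

(** The mesh [h] is chosen so that [u / h] has squared norm [64 * K1]. Rounding down changes at most
    [K1] coordinates by at most 1 each, so the result has squared norm at most [(8 + 1) ^ 2 * K1];
    this is the 81. The remainder keeps at most 1/64 of the squared norm of [u]. *)
Lemma rounding (X : {set V}) (u : V -> R) :
  M = (81 * K1)%N -> (#|X| <= K1)%N -> (0 < K1)%N ->
  (forall v, v \notin X -> u v = 0) -> 0 < nsq u ->
  exists (h : R) (zeta : points), [/\ 0 < h, in_net X zeta,
    64 * K1%:R * h ^+ 2 = nsq u &
    nsq (fun v => u v - h * zval zeta v) <= h ^+ 2 * K1%:R].
Proof.
move=> eM XK K0 supp N0.
have K0' : 0 < K1%:R :> R by rewrite ltr0n.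
pose h := Num.sqrt (nsq u / (64 * K1%:R)).
have hh : 64 * K1%:R * h ^+ 2 = nsq u.
  rewrite sqr_sqrtr; first by rewrite mulrC divfK // gt_eqF // mulr_gt0.
  by rewrite divr_ge0 ?mulr_ge0 // ltW.
have h0 : 0 < h by rewrite sqrtr_gt0 divr_gt0 // mulr_gt0.
pose r v : int := Num.floor (u v / h).
pose d v : R := u v / h - (r v)%:~R.
have d01 v : 0 <= d v <= 1.
  have /andP[a b] := floor_itv (u v / h); rewrite /d -/(r v).
  by rewrite intrD in b; rewrite -/(r v) in a b; lra.
have r0 v : v \notin X -> r v = 0 by move=> vX; rewrite /r supp // mul0r floor0.
have d0 v : v \notin X -> d v = 0 by move=> vX; rewrite /d r0 // supp // mul0r subr0.
have sumX (f : V -> R) : (forall v, f v <= 1) -> (forall v, v \notin X -> f v = 0) ->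
    \sum_v f v <= K1%:R.
  move=> f1 f0; rewrite (bigID (mem X)) /= [X in _ + X]big1 ?addr0; last first.
    by move=> v vX; exact: f0.
  apply: le_trans (_ : \sum_(v in X) 1 <= _).
    by apply: ler_sum => v _; exact: f1.
  by rewrite sumr_const ler_nat.
have nd : nsq d <= K1%:R.
  apply: sumX => [v|v vX]; last by rewrite d0 // expr0n.
  by have := d01 v; nra.
have nr : nsq (fun v => (r v)%:~R : R) <= (81 * K1)%:R.
  have e v : (r v)%:~R = u v / h + - d v :> R by rewrite /d; ring.
  have := nsqD_le (t := 1 / 8) _ e; move=> /(_ ltac:(lra)).
  have -> : nsq (fun v => u v / h) = 64 * K1%:R.
    rewrite /nsq; under eq_bigr do rewrite exprMn.
    by rewrite -mulr_suml -/(nsq u) -hh; field; rewrite gt_eqF.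
  have -> : nsq (fun v => - d v) = nsq d.
    by apply: eq_bigr => v _; rewrite sqrrN.
  by rewrite natrM; lra.
have rM v : (`|r v| <= M)%N.
  have : (r v)%:~R ^+ 2 <= (81 * K1)%:R :> R.
    apply: le_trans nr; rewrite /nsq (bigD1 v) //= lerDl.
    by apply: sumr_ge0 => w _; exact: sqr_ge0.
  rewrite -eM -rmorphXn /= -[M%:R]/(M%:Z%:~R) ler_int => h1.
  by rewrite expr2 in h1; case: (r v) h1 => a h1 /=; nia.
pose zeta : points := [ffun v => inord (absz (r v + M%:Z))].
have ez v : zval zeta v = (r v)%:~R.
  have ra := rM v.
  have nn : (0 <= r v + M%:Z)%R by lia.
  rewrite /zval ffunE inordK; last by rewrite -addnn; lia.
  have -> : (absz (r v + M%:Z))%:R = (r v + M%:Z)%:~R :> R.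
    by rewrite -[in RHS](gez0_abs nn).
  by rewrite intrD addrK.
exists h, zeta; split=> //.
- apply/andP; split.
    apply/forallP => v; apply/orP; case: (boolP (v \in X)) => vX; first by left.
    by right; rewrite ffunE r0 // add0r inordK // -addnn; lia.
  rewrite (_ : nsq _ = nsq (fun v => (r v)%:~R)) //.
  by apply: eq_bigr => v _; rewrite ez.
- apply: le_trans (ler_wpM2l (sqr_ge0 h) nd); rewrite /nsq mulr_sumr.
  apply: ler_sum => v _; rewrite ez /d -exprMn mulrBr mulrCA mulfV ?mulr1 //.
  by rewrite gt_eqF.
Qed.

End Net.

(** * Existence of a good sign matrix by counting *)

Section Existence.
Context {R : realType}.
Variable V : finType.
Variable m : nat.
Notation signs := {ffun V -> bool}.
Notation signmx := {ffun 'I_m -> signs}.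

Definition indic (S : {set V}) (v : V) : R := (v \in S)%:R.

Lemma nsq_indic S : nsq (indic S) = #|S|%:R.
Proof.
rewrite /nsq -sum1_card natr_sum [RHS]big_mkcond /=.
by apply: eq_bigr => v _; rewrite /indic; case: (v \in S); rewrite ?expr1n ?expr0n.
Qed.

Lemma sum_subsets (x : R) : \sum_(S : {set V}) x ^+ #|S| = (1 + x) ^+ #|V|.
Proof.
have -> : (1 + x) ^+ #|V| = \prod_(v : V) \sum_(b : bool) (if b then x else 1).
  by rewrite prodr_const; congr (_ ^+ _); rewrite big_bool addrC.
rewrite bigA_distr_bigA /= (reindex (fun S : {set V} => [ffun v => v \in S])) /=.
  apply: eq_bigr => S _; rewrite -prodr_const big_mkcond /=.
  by apply: eq_bigr => v _; rewrite ffunE.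
exists (fun f : signs => [set v | f v]) => S _.
  by apply/setP => v; rewrite inE ffunE.
by apply/ffunP => v; rewrite ffunE inE.
Qed.

(** Weight each set by [2 ^ - (B * #|S|)]: all weights add up to at most [exp K], and a set of at
    most [2 * K] elements weighs at least [2 ^ - (2 * K * B)]. *)
Lemma card_small_sets (K B : nat) : (#|V| <= K * 2 ^ B)%N ->
  #|[set S : {set V} | (#|S| <= 2 * K)%N]|%:R <= expR (K + 2 * K * B)%:R :> R.
Proof.
move=> VK; pose x : R := (2 ^+ B)^-1.
have x0 : 0 < x by rewrite invr_gt0 exprn_gt0.
have x1 : x <= 1 by rewrite invf_le1 ?exprn_gt0 // -natrX ler1n expn_gt0.
have h1 : (1 + x) ^+ #|V| <= expR K%:R.
  apply: le_trans (_ : expR x ^+ #|V| <= _).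
    by apply: lerXn2r; rewrite ?nnegrE ?expR_ge0 ?expR_ge1Dx ?addr_ge0 // ltW.
  rewrite -expRM_natr ler_expR mulrC ler_pdivrMr ?exprn_gt0 //.
  by rewrite -natrX -natrM ler_nat.
have h2 : #|[set S : {set V} | (#|S| <= 2 * K)%N]|%:R * x ^+ (2 * K) <= expR K%:R.
  apply: le_trans h1; rewrite -sum_subsets -sum1_card natr_sum mulr_suml.
  rewrite big_mkcond /=; apply: ler_sum => S _; rewrite inE; case: ifP => SK.
    by rewrite mul1r; apply: ler_wiXn2l => //; exact: ltW.
  by apply: exprn_ge0; exact: ltW.
have e2 : 2 <= expR 1 :> R by have := expR_ge1Dx (1 : R); lra.
rewrite natrD expRD -(ler_pM2r (exprn_gt0 (2 * K) x0)); apply: le_trans h2 _.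
rewrite -mulrA ler_peMr ?expR_ge0 // /x -exprVn -exprM mulrC.
rewrite exprVn ler_pdivlMl ?exprn_gt0 // mulr1 -[(_ * B)%:R]mulr1 expRM_natl mulnC.
by apply: lerXn2r; rewrite ?nnegrE ?expR_ge0.
Qed.

Lemma expRN_le (x : R) : 0 <= x -> expR (- x) <= (1 + x)^-1.
Proof.
by move=> x0; rewrite expRN lef_pV2 ?posrE ?expR_gt0 ?expR_ge1Dx //; lra.
Qed.

(** The first moment method. Applied to a sum of nonnegative tests it makes all of them smaller than
    1 at once. *)
Lemma exists_lt1 (I : finType) (g : I -> R) : \sum_i g i < #|I|%:R ->
  exists i, g i < 1.
Proof.
move=> h; case: (boolP [exists i, g i < 1]) => [/existsP //|/existsPn H].
have : #|I|%:R <= \sum_i g i.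
  rewrite -sum1_card natr_sum; apply: ler_sum => i _.
  by rewrite leNgt; exact: H.
by rewrite leNgt h.
Qed.

Variables (K1 K B L : nat) (Adm : {set {set V}}).
Hypotheses (K1_0 : (0 < K1)%N) (K_0 : (0 < K)%N) (VK : (#|V| <= K * 2 ^ B)%N).
Hypothesis AdmK : forall X, X \in Adm -> (#|X| <= K1)%N.
Hypothesis AdmL : #|Adm|%:R <= expR (L * K1)%:R :> R.
Hypothesis mE : m = (64 * ((L + 300) * K1))%N.

Let M := (81 * K1)%N.
Notation points := {ffun V -> 'I_(M.*2.+1)}.
(** At parameter [1 / (32 * K)] the exponential moment of an indicator of [2 * K] nodes is at most
    [exp (m / 8)]; the next term pays for the number of such sets, the 3 for the failure
    probability. *)
Definition flat_bound : R := 32 * K%:R * (m%:R / 8 + (K + 2 * K * B)%:R + 3).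

(** Exponential Markov inequalities: [test1 < 1] puts [bsq] above [m * N / 4], [test2 < 1] puts it
    below [4 * m * N], and [test3 < 1] below [flat_bound]. *)
Let test1 (sigma : signmx) (zeta : points) : R :=
  let N := nsq (@zval R V M zeta) in
  expR (- (16 * N)^-1 * bsq sigma (zval zeta)) * expR (m%:R / 64).
Let test2 (sigma : signmx) (zeta : points) : R :=
  let N := nsq (@zval R V M zeta) in
  expR ((16 * N)^-1 * bsq sigma (zval zeta)) * expR (- (m%:R / 4)).
Let test3 (sigma : signmx) (S : {set V}) : R :=
  expR ((32 * K%:R)^-1 * bsq sigma (indic S)) * expR (- (flat_bound / (32 * K%:R))).

Local Notation net := (@in_net R V K1 M).
Local Notation zv := (@zval R V M).
Let NZ : pred points := fun zeta => 0 < nsq (@zval R V M zeta).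

Let sum_test1 zeta : NZ zeta ->
  \sum_sigma test1 sigma zeta <= #|{: signmx}|%:R * expR (- (m%:R / 64)).
Proof.
rewrite /NZ /test1; set N := nsq _ => N0.
have s0 : 0 <= (16 * N)^-1 by rewrite invr_ge0 mulr_ge0 // ltW.
have e : 16 * (16 * N)^-1 * N = 1 by field; rewrite gt_eqF.
rewrite -mulr_suml; apply: le_trans (ler_wpM2r (expR_ge0 _) (avg_neg m s0 _)) _.
  by rewrite -/N e.
rewrite -[leLHS]mulrA -[X in _ * X <= _]expRD ler_wpM2l // ler_expR -/N.
have -> : (16 * N)^-1 * N = 1 / 16 by field; rewrite gt_eqF.
by lra.
Qed.

Let sum_test2 zeta : NZ zeta ->
  \sum_sigma test2 sigma zeta <= #|{: signmx}|%:R * expR (- (m%:R / 64)).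
Proof.
rewrite /NZ /test2; set N := nsq _ => N0.
have s0 : 0 <= (16 * N)^-1 by rewrite invr_ge0 mulr_ge0 // ltW.
have e : 16 * (16 * N)^-1 * N = 1 by field; rewrite gt_eqF.
rewrite -mulr_suml; apply: le_trans (ler_wpM2r (expR_ge0 _) (avg_pos m s0 _)) _.
  by rewrite -/N e.
rewrite -[leLHS]mulrA -[X in _ * X <= _]expRD ler_wpM2l // ler_expR -/N.
have -> : 2 * (16 * N)^-1 * N = 1 / 8 by field; rewrite gt_eqF.
have : 0 <= m%:R :> R by [].
by lra.
Qed.

Let sum_test3 (S : {set V}) : (#|S| <= 2 * K)%N ->
  \sum_sigma test3 sigma S <= #|{: signmx}|%:R * expR (- (K + 2 * K * B)%:R - 3).
Proof.
move=> SK; have K0 : 0 < K%:R :> R by rewrite ltr0n.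
have s0 : 0 <= (32 * K%:R)^-1 :> R by rewrite invr_ge0 mulr_ge0 // ltW.
have SK' : #|S|%:R <= 2 * K%:R :> R by rewrite -natrM ler_nat.
have e : (32 * K%:R)^-1 * #|S|%:R <= 1 / 16 :> R.
  by rewrite mulrC ler_pdivrMr ?mulr_gt0 //; lra.
rewrite /test3 -mulr_suml.
apply: le_trans (ler_wpM2r (expR_ge0 _) (avg_pos m s0 _)) _.
  by rewrite nsq_indic; lra.
rewrite -[leLHS]mulrA -[X in _ * X <= _]expRD ler_wpM2l // ler_expR nsq_indic /flat_bound.
have -> : 32 * K%:R * (m%:R / 8 + (K + 2 * K * B)%:R + 3) / (32 * K%:R) =
   m%:R / 8 + (K + 2 * K * B)%:R + 3 :> R by field; rewrite gt_eqF.
suff : 2 * (32 * K%:R)^-1 * #|S|%:R * m%:R <= m%:R / 8 :> R by lra.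
by have : 0 <= m%:R :> R by []; nra.
Qed.

Let sum_tests : \sum_sigma (
   \sum_(X in Adm) \sum_(zeta | net X zeta && NZ zeta)
      (test1 sigma zeta + test2 sigma zeta) +
   \sum_(S : {set V} | (#|S| <= 2 * K)%N) test3 sigma S) < #|{: signmx}|%:R.
Proof.
have P0 : 0 < #|{: signmx}|%:R :> R.
  by rewrite ltr0n; apply/card_gt0P; exists [ffun => [ffun => true]].
set P : R := #|{: signmx}|%:R in P0 *.
rewrite big_split /=.
have h3 : \sum_sigma \sum_(S : {set V} | (#|S| <= 2 * K)%N) test3 sigma S <= P / 4.
  rewrite exchange_big /=.
  apply: le_trans (_ : \sum_(S : {set V} | (#|S| <= 2 * K)%N)
     P * expR (- (K + 2 * K * B)%:R - 3) <= _).
    by apply: ler_sum => S; exact: sum_test3.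
  have -> : \sum_(S : {set V} | (#|S| <= 2 * K)%N) P * expR (- (K + 2 * K * B)%:R - 3)
     = #|[set S : {set V} | (#|S| <= 2 * K)%N]|%:R * (P * expR (- (K + 2 * K * B)%:R - 3)).
    by rewrite -sum1dep_card natr_sum mulr_suml; apply: eq_bigr => S _; rewrite mul1r.
  rewrite mulrCA ler_pM2l //.
  apply: le_trans (ler_wpM2r (expR_ge0 _) (card_small_sets VK)) _.
  rewrite -expRD addrA subrr add0r; apply: le_trans (expRN_le _) _ => //; lra.
have h12 : \sum_sigma \sum_(X in Adm) \sum_(zeta | net X zeta && NZ zeta)
      (test1 sigma zeta + test2 sigma zeta) <= P / 4.
  rewrite exchange_big /=.
  apply: le_trans (_ : \sum_(X in Adm) 2 ^+ (81 * K1) * 3 ^+ K1 *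
      (2 * P * expR (- (m%:R / 64))) <= _).
    apply: ler_sum => X XA; rewrite exchange_big /=.
    apply: le_trans (_ : \sum_(zeta | net X zeta && NZ zeta)
       (2 * P * expR (- (m%:R / 64))) <= _).
      apply: ler_sum => zeta /andP[_ nz]; rewrite big_split /=.
      by have := sum_test1 nz; have := sum_test2 nz; rewrite -/P; lra.
    have c0 : 0 <= 2 * P * expR (- (m%:R / 64)).
      by rewrite mulr_ge0 ?expR_ge0 //; lra.
    rewrite sumr_const -[leLHS]mulr_natl ler_wpM2r //.
    apply: le_trans (_ : (#|net X : pred points|%:R : R) <= _).
      by rewrite ler_nat; apply: subset_leq_card; apply/subsetP => z /andP[].
    apply: le_trans (card_net _ _ _) _.
    by rewrite ler_pM2l ?exprn_gt0 // ler_eXn2l ?AdmK // ltr1n.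
  rewrite sumr_const -[leLHS]mulr_natl.
  have -> (x y : R) : x * (2 ^+ (81 * K1) * 3 ^+ K1 * (2 * P * y)) =
     P * (2 * (x * (2 ^+ (81 * K1) * 3 ^+ K1) * y)) by ring.
  rewrite ler_pM2l //.
  have e4 : 3 <= expR 2 :> R by have := expR_ge1Dx (2 : R); lra.
  (* Both 2 and 3 are at most [exp 2], and [2 * 81 + 2 = 164]. As [m / 64 = (L + 300) * K1], the
     factor [exp (- m / 64)] leaves [exp (- 136 * K1)], more than is needed. *)
  have h : #|Adm|%:R * (2 ^+ (81 * K1) * 3 ^+ K1) <= expR ((L + 164) * K1)%:R :> R.
    have -> : ((L + 164) * K1 = L * K1 + (2 * (81 * K1) + 2 * K1))%N by ring.
    rewrite natrD expRD; apply: ler_pM => //; first by rewrite mulr_ge0 ?exprn_ge0.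
    rewrite natrD expRD; apply: ler_pM; rewrite ?exprn_ge0 //.
      rewrite natrM expRM_natr; apply: lerXn2r; rewrite ?nnegrE ?expR_ge0 //.
      by lra.
    by rewrite natrM expRM_natr; apply: lerXn2r; rewrite ?nnegrE ?expR_ge0.
  have mR : m%:R / 64 = ((L + 300) * K1)%:R :> R by rewrite mE natrM; field.
  have le1 : 2 * (#|Adm|%:R * (2 ^+ (81 * K1) * 3 ^+ K1) * expR (- (m%:R / 64)))
     <= 2 * expR (- 7) :> R.
    rewrite ler_pM2l //; apply: le_trans (ler_wpM2r (expR_ge0 _) h) _.
    rewrite -expRD ler_expR mR -opprB lerN2 -natrB ?leq_mul2r ?leq_add2l ?orbT //.
    by rewrite -mulnBl subnDl -[7%R]/(7%:R) ler_nat; lia.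
  apply: le_trans le1 _; have : expR (- 7) <= (1 + 7)^-1 :> R by exact: expRN_le.
  have -> : (1 + 7)^-1 = 1 / 8 :> R by field.
  by lra.
by apply: le_lt_trans (lerD h12 h3) _; lra.
Qed.

(** The first bound makes least squares on an admissible set stable; the second controls the image
    of the flat remainder outside it. *)
Lemma signs_exist : exists sigma : signmx,
  (forall X, X \in Adm -> forall u : V -> R, (forall v, v \notin X -> u v = 0) ->
     m%:R * nsq u <= 768 * bsq sigma u) /\
  (forall S : {set V}, (#|S| <= 2 * K)%N -> bsq sigma (indic S) <= flat_bound).
Proof.
have [sigma hs] := exists_lt1 sum_tests; exists sigma.
have t0 zeta : 0 <= test1 sigma zeta + test2 sigma zeta.
  by rewrite addr_ge0 // mulr_ge0 ?expR_ge0.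
have t30 S : 0 <= test3 sigma S by rewrite mulr_ge0 ?expR_ge0.
have K0 : 0 < K%:R :> R by rewrite ltr0n.
split; last first.
  move=> S SK; have : test3 sigma S < 1.
    apply: le_lt_trans hs; apply: ler_wpDl; first by do 2 (apply: sumr_ge0 => ? _).
    by rewrite (bigD1 S) //= lerDl; apply: sumr_ge0.
  have p0 : 0 < (32 * K%:R)^-1 :> R by rewrite invr_gt0 mulr_gt0.
  by rewrite /test3 -expRD expR_lt1 mulrC subr_lt0 ltr_pM2r // => /ltW.
move=> X XA.
have m0 : 0 < m%:R :> R by rewrite ltr0n mE; lia.
have netP zeta : net X zeta -> m%:R / 4 * nsq (zv zeta) <= bsq sigma (zv zeta)
   <= 4 * m%:R * nsq (zv zeta).
  move=> zX; have [N0|N0] := boolP (NZ zeta); last first.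
    have z v : zv zeta v = 0 :> R.
      have : nsq (zv zeta) == 0 by rewrite eq_le nsq_ge0 andbT leNgt.
      rewrite psumr_eq0 => [|w _]; last exact: sqr_ge0.
      by move=> /allP /(_ v (mem_index_enum _)); rewrite sqrf_eq0 => /eqP.
    have -> : nsq (zv zeta) = 0.
      by apply: big1 => v _; rewrite z expr0n.
    have -> : bsq sigma (zv zeta) = 0 :> R.
      apply: big1 => i _; rewrite /bsum big1 ?expr0n // => v _.
      by rewrite z mulr0.
    by rewrite !mulr0 lexx.
  have : test1 sigma zeta + test2 sigma zeta < 1.
    apply: le_lt_trans hs; apply: ler_wpDr; first by apply: sumr_ge0.
    rewrite (bigD1 X) //= (bigD1 zeta) ?zX //= -addrA lerDl addr_ge0 //.
      by apply: sumr_ge0.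
    by do 2 (apply: sumr_ge0 => ? _).
  have q1 : 0 <= test1 sigma zeta by rewrite mulr_ge0 ?expR_ge0.
  have q2 : 0 <= test2 sigma zeta by rewrite mulr_ge0 ?expR_ge0.
  move=> lt1.
  have {q2}: test1 sigma zeta < 1 by lra.
  have {q1 lt1}: test2 sigma zeta < 1 by lra.
  rewrite /test1 /test2 -!expRD !expR_lt1; move: N0; rewrite /NZ.
  set N := nsq _; set b := bsq _ _ => N0 l1 l2.
  have e1 : (16 * N)^-1 * (16 * N) = 1 by rewrite mulVf // gt_eqF // mulr_gt0.
  have p1 : 0 < (16 * N)^-1 by rewrite invr_gt0 mulr_gt0.
  by apply/andP; split; rewrite -(ler_pM2l p1); nra.
(* The net gives the upper bound at its own points only. A general [u] is [h * zeta] plus a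
   remainder with at most 1/64 of its squared norm; inserting the bound already known for the
   remainder divides the excess over 7 by 8 each time, starting from [bsq_crude]. After [#|V|]
   rounds the excess is at most 1. *)
have upper j (u : V -> R) : (forall v, v \notin X -> u v = 0) ->
    bsq sigma u <= (7 + (1 / 8) ^+ j * #|V|%:R) * m%:R * nsq u.
  elim: j u => [|j IH] u supp.
    apply: le_trans (bsq_crude _ _) _; rewrite expr0 mul1r [m%:R * _]mulrC.
    by rewrite ler_wpM2r ?nsq_ge0 // ler_wpM2r // lerDr.
  have [N0|] := ltP 0 (nsq u); last first.
    move=> N0; have Nz : nsq u = 0 by apply/eqP; rewrite eq_le N0 nsq_ge0.
    by apply: le_trans (bsq_crude _ _) _; rewrite Nz !mulr0.
  have [h [zeta [h0 zX hh nw]]] := rounding (erefl M) (AdmK XA) K1_0 supp N0.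
  have K10 : 0 < K1%:R :> R by rewrite ltr0n.
  pose w v := u v - h * zv zeta v.
  have e v : u v = h * zv zeta v + w v by rewrite /w addrC subrK.
  have suppw v : v \notin X -> w v = 0.
    move=> vX; rewrite /w supp // sub0r; case/andP: zX => /forallP/(_ v).
    by rewrite (negPf vX) /= /zval => /eqP ->; rewrite subrr mulr0 oppr0.
  have := bsqD_le sigma (t := 1 / 4) ltac:(lra) e.
  have -> : bsq sigma (fun v => h * zv zeta v) = h ^+ 2 * bsq sigma (zv zeta).
    exact: bsqZ.
  have b1 := IH w suppw; have /andP[_ b2] := netP _ zX.
  have b3 : nsq (zv zeta) <= 81 * K1%:R :> R by case/andP: zX; rewrite natrM.
  have b2' : h ^+ 2 * bsq sigma (zv zeta) <= m%:R * nsq u * (81 / 16).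
    apply: le_trans (ler_wpM2l (sqr_ge0 h) b2) _; rewrite -hh.
    apply: le_trans (_ : h ^+ 2 * (4 * m%:R * (81 * K1%:R)) <= _); last by lra.
    by rewrite ler_wpM2l ?sqr_ge0 // ler_wpM2l // mulr_ge0 // ltW.
  set c : R := (1 / 8) ^+ j * #|V|%:R in b1 *.
  have c0 : 0 <= c by rewrite mulr_ge0 // exprn_ge0 //; lra.
  have b1' : bsq sigma w <= (7 + c) * m%:R * (nsq u / 64).
    apply: le_trans b1 _; rewrite ler_wpM2l // ?mulr_ge0 ?(ltW m0) //; first by lra.
    by apply: le_trans nw _; rewrite -hh; lra.
  have -> : (1 / 8) ^+ j.+1 * #|V|%:R = 1 / 8 * c :> R by rewrite exprS -mulrA.
  move=> b4; apply: le_trans b4 _.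
  have mn0 : 0 <= m%:R * nsq u by rewrite mulr_ge0 ?nsq_ge0 // ltW.
  have cm0 : 0 <= c * (m%:R * nsq u) by rewrite mulr_ge0.
  have -> : (1 / 4)^-1 = 4 :> R by rewrite div1r invrK.
  by lra.
have upper8 (u : V -> R) : (forall v, v \notin X -> u v = 0) ->
    bsq sigma u <= 8 * m%:R * nsq u.
  move=> supp; apply: le_trans (upper #|V| u supp) _.
  rewrite ler_wpM2r ?nsq_ge0 // ler_wpM2r //.
  have : (1 / 8) ^+ #|V| * #|V|%:R <= 1 :> R; last by lra.
  rewrite expr_div_n expr1n mul1r mulrC ler_pdivrMr ?exprn_gt0 // mul1r -natrX ler_nat.
  by apply: ltnW; exact: ltn_expl.
move=> u supp; have [N0|N0] := ltP 0 (nsq u); last first.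
  have Nz : nsq u = 0 by apply/eqP; rewrite eq_le N0 nsq_ge0.
  by rewrite Nz mulr0 mulr_ge0 // bsq_ge0.
have [h [zeta [h0 zX hh nw]]] := rounding (erefl M) (AdmK XA) K1_0 supp N0.
pose w v := u v - h * zv zeta v.
have suppw v : v \notin X -> w v = 0.
  move=> vX; rewrite /w supp // sub0r; case/andP: zX => /forallP/(_ v).
  by rewrite (negPf vX) /= /zval => /eqP ->; rewrite subrr mulr0 oppr0.
have bw := upper8 w suppw.
have nw' : nsq w <= nsq u / 64 by apply: le_trans nw _; rewrite -hh; lra.
have /andP[b2 _] := netP _ zX.
have e1 v : u v = h * zv zeta v + w v by rewrite /w addrC subrK.
have e2 v : h * zv zeta v = u v + - w v by rewrite /w; ring.
have n1 := nsqD_le (t := 1 / 7) ltac:(lra) e1.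
have n2 : nsq (fun v => h * zv zeta v) = h ^+ 2 * nsq (zv zeta).
  by rewrite /nsq mulr_sumr; apply: eq_bigr => v _; rewrite exprMn.
rewrite n2 in n1.
have n3 : 49 / 64 * nsq u <= h ^+ 2 * nsq (zv zeta).
  have e7 : (1 / 7)^-1 = 7 :> R by rewrite div1r invrK.
  by rewrite e7 in n1; lra.
(* With [t = 2] the point [h * zeta = u - w] costs three times [u] and 3/2 times [w]. Since
   [49 / 256 - 3 / 2 * 1 / 8 = 1 / 256], this yields the constant [768 = 3 * 256]. *)
have q1 := bsqD_le sigma (t := 2) ltac:(lra) e2.
rewrite (bsqZ sigma (x := fun v => h * zv zeta v) (u := zv zeta) (c := h)) // in q1.
have q2 : bsq sigma (fun v => - w v) = bsq sigma w.
  rewrite (bsqZ sigma (u := w) (c := -1)) ?sqrrN ?expr1n ?mul1r // => v.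
  by rewrite mulN1r.
rewrite q2 in q1.
have q3 : 49 / 256 * (m%:R * nsq u) <= h ^+ 2 * bsq sigma (zv zeta).
  apply: le_trans (ler_wpM2l (sqr_ge0 h) b2).
  have := ler_wpM2l (ltW m0) n3; lra.
have q4 : bsq sigma w <= m%:R * nsq u / 8.
  apply: le_trans bw _; have := ler_wpM2l (ltW m0) nw'; lra.
by lra.
Qed.

End Existence.

(** * Recovery in one class *)

Section TopSum.
Context {R : realType}.
Variables (V : finType) (q : nat) (g : V -> R).

(** On the box with sides [[0, t]], cut by a bound [q * t] on the sum, a linear functional is
    largest at [t] times the indicator of a set of at most [q] elements, namely one that maximizes
    the sum of [g]. *)
Lemma top_sum (z : V -> R) (t : R) : 0 <= t ->
  (forall v, 0 <= z v <= t) -> \sum_v z v <= q%:R * t ->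
  exists S : {set V}, (#|S| <= q)%N /\
    \sum_v z v * g v <= t * \sum_(v in S) g v.
Proof.
move=> t0 z0 zq; pose G (S : {set V}) := \sum_(v in S) g v.
have [S Sq Smax] : exists2 S : {set V}, (#|S| <= q)%N &
    forall S' : {set V}, (#|S'| <= q)%N -> G S' <= G S.
  have P0 : (#|@set0 V| <= q)%N by rewrite cards0.
  have [S Sq Smax] := arg_maxP (P := fun S : {set V} => (#|S| <= q)%N) G P0.
  by exists S.
exists S; split=> //.
have gS u : u \in S -> 0 <= g u.
  move=> uS; have := Smax (S :\ u); rewrite /G (big_setD1 u uS) /= lerDr; apply.
  by rewrite (leq_trans _ Sq) // subset_leq_card // subsetDl.
have gsw u v : u \in S -> v \notin S -> g v <= g u.
  move=> uS vS; have vSu : v \notin S :\ u by rewrite !inE (negPf vS) andbF.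
  have := Smax (v |: (S :\ u)).
  rewrite /G (big_setD1 u uS) /= big_setU1 //= lerD2r; apply.
  by rewrite cardsU1 vSu; move: Sq; rewrite (cardsD1 u) uS.
have gout v : (#|S| < q)%N -> v \notin S -> g v <= 0.
  move=> Sq' vS; have := Smax (v |: S); rewrite /G big_setU1 //= gerDr; apply.
  by rewrite cardsU1 vS.
(* The multiplier of the constraint on the sum: [g] is at least [th] on [S] and at most [th]
   elsewhere. *)
pose th := \big[Num.max/0]_(v | v \notin S) g v.
have th0 : 0 <= th by rewrite /th bigmax_idl le_max lexx.
have thout v : v \notin S -> g v <= th by move=> vS; exact: le_bigmax_cond.
have thS u : u \in S -> th <= g u.
  by move=> uS; apply: bigmax_le => [|v vS]; [exact: gS | exact: gsw].
have key : th * \sum_(v | v \notin S) z v <= th * \sum_(v in S) (t - z v).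
  have [Sq'|Sq'] := ltnP #|S| q.
    have -> : th = 0.
      apply/eqP; rewrite eq_le th0 andbT.
      by apply: bigmax_le => // v vS; exact: gout.
    by rewrite !mul0r.
  rewrite ler_wpM2l // sumrB sumr_const.
  have -> : #|S| = q by apply/eqP; rewrite eqn_leq Sq Sq'.
  rewrite lerBrDr -mulr_natl addrC; apply: le_trans zq.
  by rewrite [leRHS](bigID (mem S)) /=.
have split : \sum_v z v * g v =
   \sum_(v in S) z v * g v + \sum_(v | v \notin S) z v * g v.
  by rewrite (bigID (mem S)).
have out : \sum_(v | v \notin S) z v * g v <= th * \sum_(v | v \notin S) z v.
  rewrite mulr_sumr; apply: ler_sum => v vS; rewrite mulrC ler_wpM2r ?thout //.
  by case/andP: (z0 v).
have inn : th * \sum_(v in S) (t - z v) <=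
    t * \sum_(v in S) g v - \sum_(v in S) z v * g v.
  rewrite !mulr_sumr -sumrB; apply: ler_sum => v vS.
  rewrite -mulrBl mulrC ler_wpM2l ?thS // subr_ge0; by case/andP: (z0 v).
by rewrite split; lra.
Qed.

End TopSum.

Lemma leq_card_bigcup (I V : finType) (P : pred I) (F : I -> {set V}) :
  (#|\bigcup_(i | P i) F i| <= \sum_(i | P i) #|F i|)%N.
Proof.
apply: (big_ind2 (fun (X : {set V}) k => (#|X| <= k)%N)) => //; first by rewrite cards0.
move=> X1 k1 X2 k2 l1 l2; apply: leq_trans (leq_add l1 l2).
by rewrite cardsU leq_subr.
Qed.

(** * Error of the two-stage decoder *)

Section Decode.
Context {R : realType}.
Variables (V : finType) (q m d K B L : nat) (Adm : {set {set V}}).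
Variables (h : V -> {set 'I_q}) (sigma : {ffun 'I_m -> {ffun V -> bool}}).
Hypotheses (d0 : (0 < d)%N) (K0 : (0 < K)%N) (L0 : (0 < L)%N).
Hypothesis mE : m = (64 * ((L + 300) * (4 * K)))%N.
Hypothesis AdmK : forall X, X \in Adm -> (#|X| <= 4 * K)%N.
Hypothesis hd : forall v, (#|h v| <= 2 * d)%N.
Hypothesis expand : forall X, X \in Adm ->
  X = setT \/ (d * (4 * K) < #|\bigcup_(v in X) h v|)%N.
Hypothesis low : forall X, X \in Adm -> forall u : V -> R,
  (forall v, v \notin X -> u v = 0) -> m%:R * nsq u <= 768 * bsq sigma u.
Hypothesis flat : forall S : {set V}, (#|S| <= 2 * K)%N ->
  bsq sigma (indic S) <= flat_bound m K B :> R.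

Variables (w E what : V -> R) (T A : {set V}).
Hypothesis w0 : forall v, 0 <= w v.
Hypothesis TA : T \in Adm.
Hypothesis AK : (#|A| <= K)%N.
Let Y1 (r : 'I_q) : R := \sum_(v | r \in h v) w v.
Hypothesis Ew : forall v, w v <= E v.
Hypothesis EY : forall v, v \in T -> forall r, r \in h v -> E v <= Y1 r.
Hypothesis Emax : forall u v, u \in T -> v \notin T -> E v <= E u.
Hypothesis what0 : forall v, v \notin T -> what v = 0.
Hypothesis normal : forall v, v \in T ->
  \sum_(i < m) bsum (fun u => w u - what u) (sigma i) * sg (sigma i v) = 0.

Definition tau : R := \sum_(v | v \notin A) w v.

(* Otherwise the [4 * K] picked nodes would all have estimates above
   [tau / K]; by expansion at least half of the rows they meet avoid [A], and
   those rows together carry at most [2 * d * tau]. *)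
Lemma unpicked v : v \notin T -> K%:R * w v <= tau.
Proof.
move=> vT; apply: le_trans (_ : K%:R * E v <= _); first by rewrite ler_pM2l ?ltr0n.
have [T1|ex] := expand TA; first by rewrite T1 inE in vT.
pose NT := \bigcup_(u in T) h u; pose NA := \bigcup_(u in A) h u.
have NAc : (#|NA| <= 2 * d * K)%N.
  apply: leq_trans (leq_card_bigcup _ _) _.
  apply: leq_trans (_ : \sum_(u in A) 2 * d <= _)%N.
    by apply: leq_sum => u _; exact: hd.
  by rewrite sum_nat_const mulnC leq_mul2l AK orbT.
have Y0 r : 0 <= Y1 r by apply: sumr_ge0.
have h1 : E v * (#|NT| - #|NA|)%N%:R <= \sum_(r in NT :\: NA) Y1 r.
  apply: le_trans (_ : \sum_(r in NT :\: NA) E v <= _).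
    rewrite sumr_const -[leRHS]mulr_natr ler_wpM2l ?(le_trans (w0 v)) // ler_nat.
    by rewrite cardsD leq_sub2l // subset_leq_card // subsetIr.
  apply: ler_sum => r; rewrite inE => /andP[_ /bigcupP[u uT ru]].
  exact: le_trans (Emax uT vT) (EY uT ru).
have h2 : \sum_(r in NT :\: NA) Y1 r <= (2 * d)%:R * tau.
  rewrite /Y1 (exchange_big_dep (fun v => v \notin A)) /=; last first.
    move=> r u; rewrite inE => /andP[rA _] ru; apply: contra rA => uA.
    by apply/bigcupP; exists u.
  rewrite mulr_sumr; apply: ler_sum => u uA; rewrite sumr_const -[leLHS]mulr_natl.
  rewrite ler_wpM2r // ler_nat (leq_trans _ (hd u)) // subset_leq_card //.
  by apply/subsetP => r /andP[].
have h3 : (2 * d * K <= #|NT| - #|NA|)%N by rewrite -/NT in ex; lia.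
have h4 : E v * (2 * d * K)%:R <= (2 * d)%:R * tau.
  apply: le_trans h2; apply: le_trans h1.
  by rewrite ler_wpM2l ?(le_trans (w0 v)) // ler_nat.
have dd : 0 < (2 * d)%:R :> R by rewrite ltr0n muln_gt0.
by rewrite -(ler_pM2l dd); apply: le_trans h4; rewrite natrM; lra.
Qed.

Lemma normal_ext (u : V -> R) : (forall v, v \notin T -> u v = 0) ->
  \sum_(i < m) bsum (fun v => w v - what v) (sigma i) * bsum u (sigma i) = 0.
Proof.
move=> u0; under eq_bigr do rewrite {2}/bsum mulr_sumr.
rewrite exchange_big /= big1 // => v _.
have [vT|vT] := boolP (v \in T); last by rewrite big1 // => i _; rewrite u0 // !mulr0.
under eq_bigr do rewrite mulrA.
by rewrite -mulr_suml normal // mul0r.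
Qed.

Let z v : R := if v \in T then 0 else w v.
Let e v : R := if v \in T then w v - what v else 0.
Let t : R := tau / K%:R.

Lemma tau_ge0 : 0 <= tau. Proof. by apply: sumr_ge0. Qed.

Lemma z_bound v : 0 <= z v <= t.
Proof.
have KR : 0 < K%:R :> R by rewrite ltr0n.
rewrite /z /t; case: ifP => vT; first by rewrite lexx divr_ge0 ?tau_ge0 // ltW.
by rewrite w0 /= ler_pdivlMr // mulrC unpicked // vT.
Qed.

(** Outside [A] the sum is at most [tau] by definition of [tau]; inside, there are at most [K]
    entries of at most [tau / K] each. *)
Lemma z_sum : \sum_v z v <= 2 * tau.
Proof.
have KR : 0 < K%:R :> R by rewrite ltr0n.
rewrite (bigID (mem A)) /= mulr_natl mulr2n; apply: lerD; last first.
  apply: ler_sum => v _; rewrite /z; case: ifP => // _; exact: w0.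
apply: le_trans (_ : \sum_(v in A) t <= _).
  by apply: ler_sum => v _; case/andP: (z_bound v).
rewrite sumr_const -[leLHS]mulr_natl /t mulrA ler_pdivrMr // mulrC.
by rewrite ler_wpM2l ?tau_ge0 // ler_nat.
Qed.

Lemma bsq_cauchy (u v : V -> R) :
  (\sum_(i < m) bsum u (sigma i) * bsum v (sigma i)) ^+ 2 <=
  bsq sigma u * bsq sigma v.
Proof.
set S := \sum_(i < m) _; set a := bsq sigma u; set b := bsq sigma v.
have a0 : 0 <= a by exact: bsq_ge0.
have b0 : 0 <= b by exact: bsq_ge0.
have quad (x y : R) : 0 <= x ^+ 2 * a - 2 * x * y * S + y ^+ 2 * b.
  have -> : x ^+ 2 * a - 2 * x * y * S + y ^+ 2 * b =
      \sum_(i < m) (x * bsum u (sigma i) - y * bsum v (sigma i)) ^+ 2.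
    rewrite /a /b /S /bsq !mulr_sumr -sumrB -big_split; apply: eq_bigr => i _ /=.
    by ring.
  by apply: sumr_ge0 => i _; exact: sqr_ge0.
have [az|an] := eqVneq a 0.
  have := quad (b + 1) S; rewrite az; have := sqr_ge0 S; nra.
have := quad S a; have ap : 0 < a by rewrite lt_def an.
have -> : S ^+ 2 * a - 2 * S * a * S + a ^+ 2 * b = a * (a * b - S ^+ 2) by ring.
by rewrite pmulr_rge0 // subr_ge0.
Qed.

(* The part of [w] outside [T] is flat: its entries are at most [tau / K]. *)
Lemma error_nsq : m%:R * nsq e <= 768 * (t ^+ 2 * flat_bound m K B).
Proof.
have e0 v : v \notin T -> e v = 0 by move=> vT; rewrite /e (negPf vT).
apply: le_trans (low TA e0) _; rewrite ler_pM2l //.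
have wz v : w v - what v = z v + e v.
  rewrite /z /e; case: (boolP (v \in T)) => vT; first by rewrite add0r.
  by rewrite what0 // subr0 addr0.
pose g v := - \sum_(i < m) sg (sigma i v) * bsum e (sigma i).
(* The residual is orthogonal to the image of [e], so the squared length of that image is a linear
   functional of the unpicked part [z]. *)
have bsE : bsq sigma e = \sum_v z v * g v.
  have := normal_ext e0; under eq_bigr do rewrite (bsumD _ wz) mulrDl.
  rewrite big_split /= => /eqP; rewrite addr_eq0 => /eqP h1.
  have -> : \sum_v z v * g v = - \sum_(i < m) bsum z (sigma i) * bsum e (sigma i).
    rewrite -sumrN; under [LHS]eq_bigr do rewrite /g mulrN -mulNr mulr_sumr.
    rewrite exchange_big /=; apply: eq_bigr => i _.
    rewrite -mulNr {1}/bsum -sumrN mulr_suml; apply: eq_bigr => v _.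
    by rewrite mulrA mulNr [z v * _]mulrC.
  by rewrite h1 opprK; apply: eq_bigr => i _; rewrite expr2.
have KR : 0 < K%:R :> R by rewrite ltr0n.
have t0 : 0 <= t by rewrite divr_ge0 ?tau_ge0 // ltW.
have zs : \sum_v z v <= (2 * K)%:R * t.
  apply: le_trans z_sum _; rewrite /t natrM.
  by have -> : 2 * K%:R * (tau / K%:R) = 2 * tau by field; rewrite gt_eqF.
(* Since [z] is flat, the functional is at most [t] times its value on the indicator of [2 * K]
   nodes. There [flat] and Cauchy-Schwarz apply, and one factor [bsq sigma e] cancels. *)
have [S [SK le1]] := top_sum g t0 z_bound zs.
have gS : \sum_(v in S) g v = - \sum_(i < m) bsum (indic S) (sigma i) * bsum e (sigma i).
  rewrite /g sumrN; congr (- _); rewrite exchange_big /=; apply: eq_bigr => i _.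
  rewrite -mulr_suml; congr (_ * _); rewrite /bsum big_mkcond /=.
  by apply: eq_bigr => v _; rewrite /indic; case: (v \in S); rewrite ?mulr1 ?mulr0.
have b0 := bsq_ge0 sigma e.
have c1 := bsq_cauchy (indic S) e.
set s := \sum_(i < m) _ in gS c1.
rewrite -bsE gS in le1.
have c2 : s ^+ 2 <= flat_bound m K B * bsq sigma e.
  by apply: le_trans c1 _; rewrite ler_wpM2r // flat.
have c3 : bsq sigma e ^+ 2 <= t ^+ 2 * flat_bound m K B * bsq sigma e.
  apply: le_trans (_ : (t * - s) ^+ 2 <= _).
    by rewrite lerXn2r ?nnegrE // (le_trans b0).
  by rewrite exprMn sqrrN -mulrA ler_wpM2l ?sqr_ge0.
have [->|bn] := eqVneq (bsq sigma e) 0.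
  rewrite mulr_ge0 ?sqr_ge0 // /flat_bound !mulr_ge0 // ?ler0n //.
  by rewrite !addr_ge0 // divr_ge0.
by rewrite -(ler_pM2r (_ : 0 < bsq sigma e)) -?expr2 // lt_def bn.
Qed.

Lemma decode_error (rho : R) : 0 <= rho -> 1 + B%:R / L%:R <= rho ^+ 2 ->
  \sum_v `|w v - what v| <= 400 * rho * tau.
Proof.
move=> rho0 hrho.
have KR : 0 < K%:R :> R by rewrite ltr0n.
have LR : 0 < L%:R :> R by rewrite ltr0n.
have K1R : 1 <= K%:R :> R by rewrite ler1n.
have BR : 0 <= B%:R :> R by [].
have mR : m%:R = 256 * (L%:R + 300) * K%:R :> R.
  by rewrite mE !natrM natrD; ring.
have mp : 0 < m%:R :> R by rewrite mR !mulr_gt0 //; lra.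
have T0 := tau_ge0.
pose S := \sum_(v in T) `|w v - what v|.
have S0 : 0 <= S by apply: sumr_ge0.
have h1 : S ^+ 2 <= (4 * K)%:R * nsq e.
  apply: le_trans (sqr_sum_le _ _) _; apply: ler_pM => //.
  - by apply: sumr_ge0 => v _; exact: sqr_ge0.
  - by rewrite ler_nat; exact: AdmK.
  rewrite /nsq big_mkcond; apply: ler_sum => v _; rewrite /e.
  by case: ifP => _; rewrite ?sqr_normr ?real_normK ?num_real ?sqr_ge0.
have h2 := error_nsq.
(* The ratio [B / L] arises here: [m] exceeds [256 * L * K], so the term [2 * K * B] is at most
   [B / L] times [m]. *)
have h3 : 4 * K%:R * (768 * (t ^+ 2 * flat_bound m K B)) <=
    (4 * 768 * 32) * (1 + B%:R / L%:R) * m%:R * tau ^+ 2.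
  have -> : 4 * K%:R * (768 * (t ^+ 2 * flat_bound m K B)) =
     (4 * 768 * 32) * tau ^+ 2 * (m%:R / 8 + (K + 2 * K * B)%:R + 3).
    by rewrite /t /flat_bound; field; rewrite gt_eqF.
  have -> : 4 * 768 * 32 * (1 + B%:R / L%:R) * m%:R * tau ^+ 2 =
     4 * 768 * 32 * tau ^+ 2 * ((1 + B%:R / L%:R) * m%:R) by ring.
  apply: ler_wpM2l; first by rewrite !mulr_ge0 ?sqr_ge0.
  rewrite mulrDl mul1r mR natrD !natrM.
  have -> : B%:R / L%:R * (256 * (L%:R + 300) * K%:R) =
     256 * B%:R * K%:R + 256 * 300 * K%:R * (B%:R / L%:R) :> R.
    by field; rewrite gt_eqF.
  have q0 : 0 <= K%:R * (B%:R / L%:R) :> R by rewrite mulr_ge0 ?divr_ge0 // ltW.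
  have q1 : 0 <= L%:R * K%:R :> R by rewrite mulr_ge0 // ltW.
  have q2 : 0 <= B%:R * K%:R :> R by rewrite mulr_ge0 // ltW.
  by lra.
have h4 : S ^+ 2 <= (4 * 768 * 32) * rho ^+ 2 * tau ^+ 2.
  rewrite -(ler_pM2l mp); apply: le_trans (_ : (4 * K)%:R * (m%:R * nsq e) <= _).
    by rewrite [leRHS]mulrCA ler_pM2l.
  rewrite natrM; apply: le_trans (ler_wpM2l _ h2) _; first by rewrite mulr_ge0.
  apply: le_trans h3 _.
  have -> : m%:R * ((4 * 768 * 32) * rho ^+ 2 * tau ^+ 2) =
      (4 * 768 * 32) * rho ^+ 2 * m%:R * tau ^+ 2 by ring.
  by rewrite ler_wpM2r ?sqr_ge0 // ler_wpM2r ?(ltW mp) //; lra.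
(* [314 ^ 2 = 98596] is just above [4 * 768 * 32 = 98304]. *)
have h5 : S <= 314 * rho * tau.
  rewrite -ler_sqr ?nnegrE ?mulr_ge0 //.
  apply: le_trans h4 _; rewrite !exprMn ler_wpM2r ?sqr_ge0 // ler_wpM2r ?sqr_ge0 //.
  by rewrite expr2; lra.
have rho1 : 1 <= rho.
  rewrite -ler_sqr ?nnegrE // expr1n; apply: le_trans hrho.
  by rewrite lerDl divr_ge0 // ltW.
rewrite (bigID (mem T)) /= -/S.
have h6 : \sum_(v | v \notin T) `|w v - what v| <= 2 * tau.
  apply: le_trans z_sum; rewrite [leLHS]big_mkcond; apply: ler_sum => v _ /=.
  rewrite /z; case: (boolP (v \in T)) => // vT.
  by rewrite what0 // subr0 ger0_norm.
by nra.
Qed.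

End Decode.

(** * Expanders and up-closed sets *)

Section Expander.
Context {R : realType}.
Variables (V : finType) (K1 L : nat) (Adm : {set {set V}}).
Hypotheses (K1_0 : (0 < K1)%N) (L0 : (0 < L)%N).
Hypothesis AdmK : forall X, X \in Adm -> #|X| = K1.
Hypothesis AdmL : #|Adm|%:R <= expR (L * K1)%:R :> R.

Let d := (10 * L)%N.
Let q := (d * K1)%N.
Notation hashes := {ffun V * 'I_(2 * d) -> 'I_(3 * q)}.

Let fits (X : {set V}) (Z : {set 'I_(3 * q)}) (p : V * 'I_(2 * d)) :
  pred 'I_(3 * q) := fun j => (p.1 \in X) ==> (j \in Z).

Let q0 : (0 < q)%N.
Proof. by rewrite /q /d !muln_gt0 L0 K1_0. Qed.

Let card_fits (X : {set V}) (Z : {set 'I_(3 * q)}) : #|X| = K1 -> (#|Z| <= q)%N ->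
  #|family (fits X Z)|%:R <= #|{: hashes}|%:R * (1 / 9) ^+ q :> R.
Proof.
move=> XK Zq.
have q3 : 0 < (3 * q)%:R :> R by rewrite ltr0n muln_gt0.
rewrite -sum1_card natr_sum.
have -> : \sum_(f in family (fits X Z)) 1 =
    \prod_(p : V * 'I_(2 * d)) \sum_(j | fits X Z p j) 1 :> R.
  rewrite (bigA_distr_big_dep (fits X Z) (fun _ _ => 1 : R)).
  by apply: eq_bigr => f _; rewrite big1.
apply: le_trans (_ : \prod_(p : V * 'I_(2 * d))
    ((3 * q)%:R * (if p.1 \in X then 1 / 3 else 1)) <= _).
  apply: ler_prod => p _; rewrite sumr_ge0 //= /fits; case: (p.1 \in X) => /=.
    rewrite sumr_const natrM; apply: le_trans (_ : q%:R <= _); last by lra.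
    by rewrite ler_nat.
  by rewrite sumr_const cardT size_enum_ord mulr1.
rewrite big_split /= prodr_const card_ffun card_ord natrX ler_pM2l ?exprn_gt0 //.
rewrite -(pair_bigA _ (fun v (a : 'I_(2 * d)) => if v \in X then 1 / 3 else 1 : R)) /=.
under eq_bigr do rewrite prodr_const card_ord.
rewrite (bigID (mem X)) /= [X in _ * X]big1 ?mulr1; last first.
  by move=> v vX; rewrite (negPf vX) expr1n.
rewrite (eq_bigr (fun _ => (1 / 3) ^+ (2 * d))); last by move=> v ->.
rewrite prodr_const XK -exprM -mulnA -/q exprM.
by rewrite (_ : (1 / 3) ^+ 2 = 1 / 9 :> R) // expr2; lra.
Qed.

(** An admissible [X] makes [2 * d * K1 = 2 * q] random choices among [3 * q] rows; all fall into a
    given set [Z] of at most [q] rows with probability at most [(1 / 9) ^ q]. There are at most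
    [8 ^ q] sets [Z], and [(8 / 9) ^ q <= exp (- q / 9)] with [q = 10 * L * K1] beats the
    [exp (L * K1)] admissible sets. *)
Lemma expander_exist : exists h : V -> {set 'I_(3 * q)},
  (forall v, (#|h v| <= 2 * d)%N) /\
  forall X, X \in Adm -> (q < #|\bigcup_(v in X) h v|)%N.
Proof.
have [f hf] : exists f : hashes,
    \sum_(X in Adm) \sum_(Z : {set 'I_(3 * q)} | (#|Z| <= q)%N)
      (f \in family (fits X Z))%:R < 1 :> R.
  apply: exists_lt1; rewrite exchange_big /=.
  have P0 : 0 < #|{: hashes}|%:R :> R.
    have q3 : (0 < 3 * q)%N by rewrite muln_gt0.
    by rewrite ltr0n; apply/card_gt0P; exists [ffun => Ordinal q3].
  apply: le_lt_trans (_ : \sum_(X in Adm) 2 ^+ (3 * q) *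
     (#|{: hashes}|%:R * (1 / 9) ^+ q) < _).
    apply: ler_sum => X XA; rewrite exchange_big /=.
    apply: le_trans (_ : \sum_(Z : {set 'I_(3 * q)})
      (#|{: hashes}|%:R * (1 / 9) ^+ q) <= _); last first.
      by rewrite sumr_const -[leLHS]mulr_natl -cardsT -powersetT
        card_powerset cardsT card_ord natrX.
    rewrite [leLHS]big_mkcond; apply: ler_sum => Z _; case: ifP => Zq; last first.
      by rewrite mulr_ge0 ?exprn_ge0 ?divr_ge0.
    apply: le_trans (card_fits (AdmK XA) Zq).
    rewrite -sum1_card natr_sum [leRHS]big_mkcond /=; apply: ler_sum => f _.
    by case: (f \in _).
  rewrite sumr_const -[ltLHS]mulr_natl.
  have -> (a b c P : R) : a * (b * (P * c)) = P * (a * (b * c)) by ring.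
  rewrite gtr_pMr // exprM -exprMn.
  have le1 : 2 ^+ 3 * (1 / 9) <= expR (- (1 / 9)) :> R.
    by have := expR_ge1Dx (- (1 / 9) : R); rewrite !exprS expr0; lra.
  have le2 : (2 ^+ 3 * (1 / 9)) ^+ q <= expR (- (1 / 9) * q%:R) :> R.
    rewrite expRM_natr; apply: lerXn2r => //; rewrite nnegrE ?expR_ge0 //.
    by rewrite mulr_ge0 ?exprn_ge0 ?divr_ge0.
  apply: le_lt_trans (_ : expR (L * K1)%:R * expR (- (1 / 9) * q%:R) < _).
    by apply: ler_pM => //; rewrite exprn_ge0 // mulr_ge0 ?exprn_ge0 ?divr_ge0.
  rewrite -expRD expR_lt1 /q /d !natrM.
  have : 0 < L%:R * K1%:R :> R by rewrite mulr_gt0 ?ltr0n.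
  by lra.
exists (fun v => [set f (v, a) | a : 'I_(2 * d)]); split.
  by move=> v; apply: leq_trans (leq_imset_card _ _) _; rewrite card_ord.
move=> X XA; rewrite ltnNge; apply/negP => le; move: hf; apply/negP.
set Z := \bigcup_(v in X) _ in le.
rewrite -leNgt (bigD1 X) //= (bigD1 Z) //=.
have -> : f \in family (fits X Z).
  apply/familyP => -[v a]; rewrite /fits unfold_in /=; apply/implyP => vX.
  by apply/bigcupP; exists v => //; exact: imset_f.
by rewrite -addrA lerDl addr_ge0 // sumr_ge0 // => ? _; rewrite sumr_ge0.
Qed.

End Expander.

(** * Counting sets closed under parents *)

Section CountClosed.
Variables (V : finType) (par : V -> option V) (rank : V -> nat) (K1 r0 : nat).
Hypothesis par_rank : forall v u, par v = Some u -> (rank u < rank v)%N.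
Hypothesis roots : (#|[set v | par v == None]| <= r0)%N.
Hypothesis children : forall u, (#|[set v | par v == Some u]| <= 4)%N.

Definition upclosed (X : {set V}) : bool :=
  [forall v in X, if par v is Some u then u \in X else true].

(** For an up-closed [X], the nodes whose addition keeps it up-closed, roots included. *)
Let bd (X : {set V}) : {set V} :=
  [set v | (v \notin X) && (if par v is Some u then u \in X else true)].

Let bd_card (X : {set V}) : upclosed X -> (#|X :|: bd X| <= r0 + 4 * #|X|)%N.
Proof.
move=> /forall_inP cl.
have sub : X :|: bd X \subset [set v | par v == None] :|:
    \bigcup_(u in X) [set v | par v == Some u].
  apply/subsetP => v; rewrite !inE => vX.
  have pv : is_true (if par v is Some u then u \in X else true).
    by case/orP: vX => [/cl|/andP[]].
  case E: (par v) pv => [u|] uX; last by rewrite eqxx.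
  by apply/orP; right; apply/bigcupP; exists u; rewrite // inE E.
apply: leq_trans (subset_leq_card sub) _; rewrite cardsU.
apply: leq_trans (leq_subr _ _) _; apply: leq_add => //.
apply: leq_trans (leq_card_bigcup _ _) _.
by rewrite mulnC -sum_nat_const; apply: leq_sum => u _; exact: children.
Qed.

Let sep (X Z : {set V}) : bool := (X \subset Z) && [disjoint Z & bd X].

(** Climb from a node of [X] outside [X']: its topmost ancestor outside [X'] belongs to [bd X'], and
    also to [X], hence to [Z], which avoids [bd X']. *)
Let sep_le (X X' Z : {set V}) : upclosed X -> upclosed X' -> sep X Z -> sep X' Z ->
  X \subset X'.
Proof.
move=> clX clX' /andP[XZ _] /andP[_ ZX']; apply/subsetP => v.
elim: (rank v).+1 {-2}v (ltnSn (rank v)) => // k IH {}v rk vX.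
rewrite ltnS in rk; apply/negPn/negP => vX'.
have : v \in bd X'.
  rewrite inE vX' /=; case E: (par v) => [u|] //.
  apply: IH; first exact: leq_trans (par_rank E) rk.
  by move/forall_inP: clX => /(_ v vX); rewrite E.
by move=> vb; have := disjointFr ZX' (subsetP XZ v vX); rewrite vb.
Qed.

Let sep_count (X : {set V}) : upclosed X ->
  (2 ^ (#|V| - (r0 + 4 * #|X|)) <= #|[set Z | sep X Z]|)%N.
Proof.
move=> cl; pose C := ~: (X :|: bd X).
apply: leq_trans (_ : #|powerset C| <= _)%N.
  rewrite card_powerset leq_exp2l // [leqRHS]cardsCs /C setCK leq_sub2l //.
  exact: bd_card.
rewrite -(card_in_imset (f := fun W => X :|: W) (D := mem (powerset C))).
  apply: subset_leq_card; apply/subsetP => Z /imsetP[W WP ->]; rewrite inE.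
  have WC : W \subset C by rewrite -powersetE.
  rewrite /sep subsetUl /= -setI_eq0; apply/eqP/setP => v.
  rewrite in_setI in_setU in_set0; apply/negP => /andP[/orP[vX|vW] vb].
    by move: vb; rewrite inE vX.
  by move: (subsetP WC v vW); rewrite in_setC in_setU vb orbT.
move=> W W' WP WP' e; apply/setP => v.
have WC : W \subset C by rewrite -powersetE.
have W'C : W' \subset C by rewrite -powersetE.
have nX (U : {set V}) : U \subset C -> v \in U -> v \notin X.
  by move=> UC /(subsetP UC); rewrite !inE negb_or => /andP[].
move/setP/(_ v): e; rewrite !inE; have [vX|//] := boolP (v \in X).
by move=> _; apply/idP/idP => h; [have := nX W WC h | have := nX W' W'C h]; rewrite vX.
Qed.

(* The sets [Z] that contain [X] and miss the nodes just below [X] determine the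
   up-closed set [X]; each [X] has many of them, so there are few sets [X]. *)
Lemma card_upclosed :
  (#|[set X : {set V} | upclosed X & #|X| == K1]| <= 2 ^ (r0 + 4 * K1))%N.
Proof.
set AD := [set X | _ & _].
have le1 : (#|AD| * 2 ^ (#|V| - (r0 + 4 * K1)) <= 2 ^ #|V|)%N.
  apply: leq_trans (_ : \sum_(X in AD) #|[set Z | sep X Z]| <= _)%N.
    rewrite -sum_nat_const; apply: leq_sum => X; rewrite inE => /andP[cl /eqP <-].
    exact: sep_count.
  under eq_bigr do rewrite -sum1dep_card.
  rewrite (exchange_big_dep predT) //= -[X in (_ <= 2 ^ X)%N]cardsT -card_powerset.
  rewrite powersetT cardsT -sum1_card; apply: leq_sum => Z _.
  have [X0 /andP[X0A X0Z]|none] := pickP (fun X => (X \in AD) && sep X Z).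
    rewrite (bigD1 X0) ?X0A //= big1 // => X /andP[/andP[XA XZ] ne].
    move: XA X0A; rewrite !inE => /andP[c1 _] /andP[c2 _].
    by case/eqP: ne; apply/eqP; rewrite eqEsubset !(sep_le (Z := Z)).
  by rewrite big_pred0.
have p : (0 < 2 ^ (#|V| - (r0 + 4 * K1)))%N by rewrite expn_gt0.
rewrite -(leq_pmul2r p); apply: leq_trans le1 _.
by rewrite -expnD leq_exp2l //; lia.
Qed.

End CountClosed.

(** * One class of cells *)

(** One row more than the expander for sets of [4 * K] nodes: row 0 sums up the whole class, so an
    estimate exists even if no other row applies. *)
Definition hash_rows (K Lam : nat) : nat := (3 * (10 * Lam * (4 * K))).+1.
Definition sign_rows (K Lam : nat) : nat := (64 * ((Lam + 300) * (4 * K)))%N.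

Section Class.
Context {R : realType}.

(* [hash v r] tells whether the node [v] enters the measurement [r] of the
   class; [phi v r] whether measurement [r] is used to estimate it. *)
Definition decodes (N K K1 R1 R2 : nat) (par : 'I_N -> option 'I_N) (rho : R)
    (hash phi : nat -> nat -> bool) (sgn : nat -> nat -> R) : Prop :=
  forall (mu sc E c y1 y2 : nat -> R) (A : {set 'I_N}) (sq : seq nat),
  (forall v : 'I_N, 0 <= mu v) -> (forall v : 'I_N, 0 < sc v) ->
  (forall u v, par u = Some v -> sc u * mu u <= sc v * mu v) ->
  (#|A| <= K)%N ->
  (forall r, (r < R1)%N -> y1 r = \sum_(v < N) (hash v r)%:R * (sc v * mu v)) ->
  (forall r, (r < R2)%N -> y2 r = \sum_(v < N) sgn v r * (sc v * mu v)) ->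
  (forall v, (v < N)%N -> is_est y1 R1 (phi v) (E v)) ->
  top_selection E N K1 sq ->
  (forall i, (i < K1)%N ->
     row_dot R2 (fun r => y2 r - \sum_(l < K1) c l * (sc (nth 0%N sq l) * sgn (nth 0%N sq l) r))
       (fun r => sc (nth 0%N sq i) * sgn (nth 0%N sq i) r) = 0) ->
  \sum_(v < N) sc v * `|mu v - \sum_(l < K1) c l * (v == nth 0%N sq l :> nat)%:R|
    <= 400 * rho * \sum_(v | v \notin A) sc v * mu v.

(** A node is estimated from its own rows and those of its ancestors. Weights grow towards the root,
    so all these rows overestimate it; and a child uses all rows of its parent, so its estimate is
    no larger. With ties going to smaller indices, the picked set is closed under parents, hence
    admissible. *)
Lemma class_scheme N K Lam B (par : 'I_N -> option 'I_N) (rho : R) :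
  (0 < K)%N -> (0 < Lam)%N -> (N <= K * 2 ^ B)%N ->
  (forall u v, par u = Some v -> (v < u)%N) ->
  ((4 * K <= N)%N ->
   #|[set X : {set 'I_N} | upclosed par X & #|X| == 4 * K]|%:R
     <= expR (Lam * (4 * K))%:R :> R) ->
  0 <= rho -> 1 + B%:R / Lam%:R <= rho ^+ 2 ->
  exists (hash phi : nat -> nat -> bool) (sgn : nat -> nat -> R),
    decodes K (minn (4 * K) N) (hash_rows K Lam) (sign_rows K Lam) par rho hash phi sgn.
Proof.
move=> K0 L0 NK par_lt cnt rho0 hrho.
set q := (10 * Lam * (4 * K))%N.
have K40 : (0 < 4 * K)%N by rewrite muln_gt0.
(* In a class of fewer than [4 * K] nodes all of them are picked, and the whole class is the only
   admissible set. *)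
pose Adm : {set {set 'I_N}} := if (4 * K <= N)%N
  then [set X : {set 'I_N} | upclosed par X & #|X| == 4 * K]%N else [set setT].
have AdmK X : X \in Adm -> (#|X| <= 4 * K)%N.
  rewrite /Adm; case: leqP => h; rewrite inE; first by case/andP => _ /eqP ->.
  by move/eqP ->; rewrite cardsT card_ord ltnW.
have AdmL : #|Adm|%:R <= expR (Lam * (4 * K))%:R :> R.
  rewrite /Adm; case: leqP => h; first exact: cnt.
  by rewrite cards1; apply: le_trans (expR_ge1Dx _); rewrite lerDl ler0n.
have VK : (#|'I_N| <= K * 2 ^ B)%N by rewrite card_ord.
have [sigma [low flat]] := signs_exist K40 K0 VK AdmK AdmL (erefl (sign_rows K Lam)).
have [h [hd expand]] : exists h : 'I_N -> {set 'I_(3 * q)},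
    (forall v, (#|h v| <= 2 * (10 * Lam))%N) /\
    forall X, X \in Adm -> X = setT \/ (q < #|\bigcup_(v in X) h v|)%N.
  have [le|lt] := leqP (4 * K) N; last first.
    exists (fun _ => set0); split=> [v|X]; first by rewrite cards0.
    by rewrite /Adm leqNgt lt /= inE => /eqP; left.
  have AK X : X \in Adm -> #|X| = (4 * K)%N by rewrite /Adm le inE => /andP[_ /eqP].
  have [h [h1 h2]] := expander_exist K40 L0 AK AdmL.
  by exists h; split=> // X XA; right; exact: h2.
(* [u] is reached by climbing from [v], possibly in zero steps. *)
pose anc u v := connect [rel a b | par a == Some b] v u.
pose hash v r := if r is r'.+1 then
  [exists u : 'I_N, [exists x : 'I_(3 * q), [&& val u == v, val x == r' & x \in h u]]] else true.
pose phi v r := if r is r'.+1 then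
  [exists u : 'I_N, [exists w : 'I_N, [&& val u == v, anc w u & hash w r]]] else true.
pose sgn v i : R := if insub v is Some u then
  if insub i is Some j then sg (sigma j u) else 0 else 0.
exists hash, phi, sgn => mu sc E c y1 y2 A sq mu0 sc0 mono AK Hy1 Hy2 est.
move=> [sqs squ sqN sel] normal.
pose w (v : 'I_N) := sc v * mu v.
have w0 v : 0 <= w v by rewrite mulr_ge0 // ltW.
have hashE (v : 'I_N) (r : 'I_(3 * q)) : hash v r.+1 = (r \in h v).
  apply/existsP/idP => [[u /existsP[x /and3P[/eqP/val_inj -> /eqP/val_inj ->]]] //|rv].
  by exists v; apply/existsP; exists r; rewrite !eqxx.
have phiP (v : 'I_N) (r : 'I_(3 * q)) : reflect (exists2 u, anc u v & r \in h u) (phi v r.+1).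
  apply: (iffP existsP) => [[u /existsP[x /and3P[/eqP/val_inj ->]]]|[u uv ru]].
    by rewrite hashE => xv rx; exists x.
  by exists v; apply/existsP; exists u; rewrite eqxx uv hashE.
have sgnE (v : 'I_N) (i : 'I_(sign_rows K Lam)) : sgn v i = sg (sigma i v).
  by rewrite /sgn !valK.
have anc_w u v : anc u v -> w v <= w u.
  case/connectP => s; elim: s v => [|a s IH] v /=; first by move=> _ ->.
  by case/andP => /eqP/mono le /IH{}IH /IH; exact: le_trans.
have y1S (r : 'I_(3 * q)) : y1 r.+1 = \sum_(v | r \in h v) w v.
  rewrite Hy1; last by rewrite /hash_rows ltnS.
  rewrite [RHS]big_mkcond; apply: eq_bigr => v _; rewrite hashE.
  by case: (r \in h v); rewrite ?mul1r ?mul0r.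
have Ew (v : 'I_N) : w v <= E v.
  have [_ _ [->|[[|r] [rR ph ->]]]] := est v (ltn_ord v).
  - rewrite Hy1 // (bigD1 v) //= mul1r lerDl sumr_ge0 // => u _.
    by rewrite mul1r (w0 u).
  - rewrite Hy1 // (bigD1 v) //= mul1r lerDl sumr_ge0 // => u _.
    by rewrite mul1r (w0 u).
  rewrite ltnS in rR; move: ph; rewrite -[r]/(val (Ordinal rR)) => /phiP[u uv ru].
  rewrite y1S (bigD1 u) //= ler_wpDr ?sumr_ge0 //; exact: anc_w.
have Epar u v : par u = Some v -> E u <= E v.
  move=> uv; have [e0 er _] := est u (ltn_ord u).
  have [_ _ [->|[[|r] [rR ph ->]]]] := est v (ltn_ord v) => //.
  apply: er => //; move: ph; rewrite ltnS in rR.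
  rewrite -[r]/(val (Ordinal rR)) => /phiP[x xv rx]; apply/phiP; exists x => //.
  by apply: connect_trans xv; apply: connect1; rewrite /= uv.
pose T := [set v : 'I_N | val v \in sq].
have cT : #|T| = minn (4 * K) N.
  rewrite -sqs cardE -(size_map val); apply/perm_size/uniq_perm => //.
    by rewrite map_inj_uniq ?enum_uniq //; exact: val_inj.
  move=> v; apply/mapP/idP => [[u]|vsq]; first by rewrite mem_enum inE => usq ->.
  by exists (Ordinal (sqN _ vsq)); rewrite // mem_enum inE.
have TA : T \in Adm.
  rewrite /Adm; move: cT; case: leqP => le.
    rewrite inE => ->; rewrite eqxx andbT.
    apply/forall_inP => u; rewrite inE => usq; case E': (par u) => [v|//].
    rewrite inE; apply/negPn/negP => vsq.
    have [_ /(_ (par_lt _ _ E'))] := sel _ _ usq (ltn_ord v) vsq.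
    by rewrite ltNge Epar.
  move=> cT; rewrite inE eqEcard subsetT /=.
  by rewrite cardsT card_ord cT.
pose muh (v : 'I_N) := \sum_(l < minn (4 * K) N) c l * (v == nth 0%N sq l :> nat)%:R.
pose what (v : 'I_N) := sc v * muh v.
have muh0 (v : 'I_N) : v \notin T -> muh v = 0.
  move=> vT; apply: big1 => l _; case: eqP => [e|]; last by rewrite mulr0.
  by move: vT; rewrite inE /= e mem_nth // sqs.
have whatE (v : 'I_N) : v \in T -> \sum_(i < sign_rows K Lam)
    bsum (fun u => w u - what u) (sigma i) * sg (sigma i v) = 0.
  rewrite inE => vsq; have vi : (index (val v) sq < minn (4 * K) N)%N.
    by rewrite -sqs index_mem.
  have := normal _ vi; rewrite /row_dot nth_index // => H.
  apply: (mulfI (lt0r_neq0 (sc0 v))); rewrite mulr0 -[RHS]H mulr_sumr.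
  apply: eq_bigr => i _; rewrite sgnE mulrCA; congr (_ * _).
  rewrite Hy2 // (_ : bsum _ _ = \sum_u sg (sigma i u) * w u - \sum_u sg (sigma i u) * what u);
    last by rewrite -sumrB; apply: eq_bigr => u _; rewrite mulrBr.
  congr (_ - _); first by apply: eq_bigr => u _; rewrite sgnE.
  rewrite (eq_bigr (fun u : 'I_N => \sum_(l < minn (4 * K) N)
    c l * (sc u * sgn u i) * (u == nth 0%N sq l :> nat)%:R)); last first.
    move=> u _; rewrite /what /muh !mulr_sumr; apply: eq_bigr => l _.
    by rewrite sgnE; ring.
  rewrite exchange_big; apply: eq_bigr => l _ /=.
  have lN : (nth 0%N sq l < N)%N by apply: sqN; rewrite mem_nth // sqs.
  rewrite (bigD1 (Ordinal lN)) //= eqxx mulr1 big1 ?addr0 // => u ul.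
  rewrite (_ : (_ == _) = false) ?mulr0 //.
  by apply: contraNF ul => /eqP e; apply/eqP/val_inj.
have EY v : v \in T -> forall r, r \in h v -> E v <= \sum_(u | r \in h u) w u.
  move=> _ r rv; have [_ er _] := est v (ltn_ord v).
  rewrite -y1S; apply: er; first by rewrite /hash_rows ltnS.
  by apply/phiP; exists v => //; exact: connect0.
have Emax u v : u \in T -> v \notin T -> E v <= E u.
  by rewrite !inE => uT vT; have [] := sel _ _ uT (ltn_ord v) vT.
have what0 (v : 'I_N) : v \notin T -> what v = 0 by move=> vT; rewrite /what muh0 ?mulr0.
have dd : (0 < 10 * Lam)%N by rewrite muln_gt0.
have := decode_error dd K0 L0 (erefl (sign_rows K Lam)) AdmK hd expand low flat w0 TA AK
  Ew EY Emax what0 whatE rho0 hrho.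
rewrite /tau; apply: le_trans; apply: ler_sum => v _.
by rewrite /w /what -mulrBr normrM (gtr0_norm (sc0 v)).
Qed.

End Class.

(** * The earth mover norm *)

Section PixelDist.
Variable D : nat.
Implicit Types i j k : 'I_(D ^ 2).

Lemma pixel_distC i j : pixel_dist i j = pixel_dist j i.
Proof. by rewrite /pixel_dist; congr (_ + _)%N; lia. Qed.

Lemma pixel_dist_triangle i j k :
  (pixel_dist i k <= pixel_dist i j + pixel_dist j k)%N.
Proof.
rewrite /pixel_dist; move: (i %/ D)%N (i %% D)%N (j %/ D)%N (j %% D)%N.
by move: (k %/ D)%N (k %% D)%N => a b c d e f; lia.
Qed.

Lemma pixel_dist_le i j : (pixel_dist i j <= 2 * D)%N.
Proof.
have D0 : (0 < D)%N by case: D i => // -[].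
have h (a : 'I_(D ^ 2)) : (a %/ D < D)%N /\ (a %% D < D)%N.
  by rewrite ltn_divLR // ltn_mod D0 mulnn ltn_ord.
rewrite /pixel_dist; have [] := h i; have [] := h j.
by move: (i %/ D)%N (i %% D)%N (j %/ D)%N (j %% D)%N => a b c d; lia.
Qed.

End PixelDist.

(** * Upper and lower bounds on the norm *)

Section EmdBounds.
Import classical_sets.
Context {R : realType}.
Variable D : nat.
Notation n := (D ^ 2)%N.
Implicit Types (x y z w : 'cV[R]_n).

Lemma transport_cost_ge0 (g : 'M[R]_n) : (forall i j, 0 <= g i j) ->
  0 <= transport_cost g.
Proof.
move=> g0; apply: sumr_ge0 => i _; apply: sumr_ge0 => j _.
by rewrite mulr_ge0.
Qed.

Lemma emd_star_le x y g : coupling x y g -> emd_star x y <= transport_cost g.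
Proof.
move=> cg; apply: ge_inf; last by exists g.
by exists 0 => r [g' [g0 _ _] <-]; exact: transport_cost_ge0.
Qed.

Lemma emd_star_ge0 x y : 0 <= emd_star x y.
Proof.
rewrite /emd_star; set A := (X in inf X).
have [->|ne] := eqVneq A set0; first by rewrite inf0.
apply: lb_le_inf; first exact/set0P.
by move=> r [g' [g0 _ _] <-]; exact: transport_cost_ge0.
Qed.

Lemma l1norm_ge0 m (z : 'cV[R]_m) : 0 <= l1norm z.
Proof. by apply: sumr_ge0. Qed.

Lemma l1norm_nonneg m (z : 'cV[R]_m) : nonneg z -> l1norm z = \sum_i z i 0.
Proof. by move=> z0; apply: eq_bigr => i _; rewrite ger0_norm. Qed.

Lemma emd_norm_le w x y z : x - y + z = w -> nonneg x -> nonneg y ->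
  l1norm x = l1norm y -> emd_norm w <= emd_star x y + 2 * D%:R * l1norm z.
Proof.
move=> e x0 y0 xy; apply: ge_inf; last by exists x, y, z.
exists 0 => r [x' [y' [z' [_ _ _ _ ->]]]].
by rewrite addr_ge0 ?emd_star_ge0 // !mulr_ge0 // l1norm_ge0.
Qed.

(** The product coupling. It shows that the infimum in [emd_star] ranges over a nonempty set; over
    the empty set it would be 0 by convention, and lower bounds would fail. *)
Lemma coupling_exists x y : nonneg x -> nonneg y -> l1norm x = l1norm y ->
  exists g, coupling x y g.
Proof.
move=> x0 y0; rewrite !l1norm_nonneg // => xy; set S := \sum_i x i 0 in xy.
have [Sz|Sn] := eqVneq S 0.
  have z0 u : nonneg u -> \sum_i u i 0 = 0 -> forall i, u i 0 = 0 :> R.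
    move=> u0 /eqP; rewrite psumr_eq0 // => /allP h i.
    by apply/eqP; exact: h (mem_index_enum _).
  exists 0; split=> [i j|i|j]; first by rewrite mxE.
    by rewrite big1 ?z0 // => l _; rewrite mxE.
  by rewrite big1 ?z0 -?xy // => l _; rewrite mxE.
have S0 : 0 <= S by apply: sumr_ge0.
exists (\matrix_(i, j) (x i 0 * y j 0 / S)); split=> [i j|i|j].
- by rewrite mxE divr_ge0 // mulr_ge0.
- under eq_bigr do rewrite mxE.
  by rewrite -mulr_suml -mulr_sumr -xy mulfK.
- under eq_bigr do rewrite mxE.
  by rewrite -mulr_suml -mulr_suml -/S mulrAC mulfV // mul1r.
Qed.

(** Feasible dual potentials: the Lipschitz bound matches the transport cost, the bound [2 * D] the
    price of unmatched mass. *)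
Definition lipschitz (f : 'I_n -> R) : Prop :=
  (forall i, 0 <= f i <= 2 * D%:R) /\
  forall i j, f i - f j <= (pixel_dist i j)%:R.

(* The easy half of Kantorovich duality. *)
Lemma emd_norm_ge f w : lipschitz f -> \sum_i f i * w i 0 <= emd_norm w.
Proof.
move=> [f0 fl]; apply: lb_le_inf.
  exists (@emd_star R D 0 0 + 2 * D%:R * l1norm w), 0, 0, w.
  split=> //; first by rewrite subrr add0r.
  - by move=> i; rewrite mxE.
  - by move=> i; rewrite mxE.
move=> r [x [y [z [<- x0 y0 xy ->]]]].
have -> : \sum_i f i * (x - y + z) i 0 =
   \sum_i f i * x i 0 - \sum_i f i * y i 0 + \sum_i f i * z i 0.
  rewrite -sumrB -big_split; apply: eq_bigr => i _; rewrite !mxE /=; ring.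
apply: lerD; last first.
  rewrite /l1norm mulr_sumr; apply: ler_sum => i _.
  have /andP[h1 h2] := f0 i.
  apply: le_trans (ler_norm _) _; rewrite normrM (ger0_norm h1).
  by rewrite ler_wpM2r.
apply: lb_le_inf.
  by have [g cg] := coupling_exists x0 y0 xy; exists (transport_cost g), g.
move=> r' [g [g0 gx gy] <-].
have -> : \sum_i f i * x i 0 = \sum_i \sum_j g i j * f i.
  by apply: eq_bigr => i _; rewrite -gx mulr_sumr; apply: eq_bigr => j _; rewrite mulrC.
have -> : \sum_j f j * y j 0 = \sum_i \sum_j g i j * f j.
  rewrite exchange_big; apply: eq_bigr => j _; rewrite -gy mulr_sumr.
  by apply: eq_bigr => i _; rewrite mulrC.
rewrite -sumrB; apply: ler_sum => i _; rewrite -sumrB; apply: ler_sum => j _.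
by rewrite -mulrBr ler_wpM2l.
Qed.

(** Mass [|c i|] moves between the two poles, in the direction given by the sign of [c i]; no
    unmatched mass remains. *)
Lemma emd_norm_dipoles (I : finType) (c : I -> R) (p q : I -> 'I_n) w :
  (forall j, w j 0 = \sum_i c i * ((j == p i)%:R - (j == q i)%:R)) ->
  emd_norm w <= \sum_i `|c i| * (pixel_dist (p i) (q i))%:R.
Proof.
move=> ew.
pose src i := if 0 <= c i then p i else q i.
pose dst i := if 0 <= c i then q i else p i.
pose x : 'cV[R]_n := \col_j \sum_i `|c i| * (j == src i)%:R.
pose y : 'cV[R]_n := \col_j \sum_i `|c i| * (j == dst i)%:R.
have x0 : nonneg x by move=> j; rewrite mxE sumr_ge0 // => i _; rewrite mulr_ge0.
have y0 : nonneg y by move=> j; rewrite mxE sumr_ge0 // => i _; rewrite mulr_ge0.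
have mass (r : I -> 'I_n) : \sum_j \sum_i `|c i| * (j == r i)%:R = \sum_i `|c i|.
  rewrite exchange_big; apply: eq_bigr => i _ /=.
  rewrite -mulr_sumr (bigD1 (r i)) //= eqxx big1 ?addr0 ?mulr1 //.
  by move=> j /negPf ->.
have xy : l1norm x = l1norm y.
  rewrite !l1norm_nonneg //; under eq_bigr do rewrite mxE.
  by under [RHS]eq_bigr do rewrite mxE; rewrite !mass.
have e : x - y + 0 = w.
  apply/colP => j; rewrite addr0 ew !mxE -sumrB; apply: eq_bigr => i _.
  rewrite -mulrBr /src /dst; case: (leP 0 (c i)) => c0.
    by rewrite ger0_norm.
  by rewrite ltr0_norm // mulNr -mulrN opprB.
apply: le_trans (emd_norm_le e x0 y0 xy) _.
have -> : l1norm (0 : 'cV[R]_n) = 0.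
  by apply: big1 => j _; rewrite mxE normr0.
rewrite mulr0 addr0.
pose g : 'M[R]_n := \matrix_(j, l) \sum_i `|c i| * ((j == src i) && (l == dst i))%:R.
have cg : coupling x y g.
  split=> [j l|j|l].
  - by rewrite mxE sumr_ge0 // => i _; rewrite mulr_ge0.
  - under eq_bigr do rewrite mxE.
    rewrite mxE exchange_big; apply: eq_bigr => i _ /=.
    rewrite -mulr_sumr (bigD1 (dst i)) //= eqxx andbT big1 ?addr0 //.
    by move=> l /negPf ->; rewrite andbF.
  - under eq_bigr do rewrite mxE.
    rewrite mxE exchange_big; apply: eq_bigr => i _ /=.
    rewrite -mulr_sumr (bigD1 (src i)) //= eqxx big1 ?addr0 //.
    by move=> j /negPf ->.
apply: le_trans (emd_star_le cg) _; rewrite /transport_cost.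
under eq_bigr => j _.
  under eq_bigr => l _ do rewrite mxE mulr_suml.
  rewrite exchange_big; over.
rewrite exchange_big /=; apply: ler_sum => i _.
rewrite (bigD1 (src i)) //= [X in _ + X]big1 ?addr0; last first.
  move=> j /negPf js; rewrite big1 // => l _; by rewrite js mulr0 mul0r.
rewrite (bigD1 (dst i)) //= [X in _ + X]big1 ?addr0; last first.
  by move=> l /negPf ld; rewrite ld andbF mulr0 mul0r.
rewrite !eqxx mulr1 /src /dst; case: ifP => _ //.
by rewrite pixel_distC.
Qed.

End EmdBounds.

(** * The quadtree *)

Section Grid.
Variable p : nat.
Notation D := (2 ^ p)%N.
Notation n := (D ^ 2)%N.
Implicit Types (i j c : 'I_n) (l : nat).

Lemma D_gt0 : (0 < D)%N. Proof. by rewrite expn_gt0. Qed.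

Definition cx l j : nat := (j %/ D) %/ 2 ^ l.
Definition cy l j : nat := (j %% D) %/ 2 ^ l.

Lemma col_lt j : (j %/ D < D)%N.
Proof. by rewrite ltn_divLR ?D_gt0 // mulnn. Qed.

Lemma row_lt j : (j %% D < D)%N. Proof. by rewrite ltn_mod D_gt0. Qed.

Lemma rep_proof l j : (cx l j * 2 ^ l * D + cy l j * 2 ^ l < n)%N.
Proof.
have h1 := leq_divM (j %/ D) (2 ^ l); have h2 := leq_divM (j %% D) (2 ^ l).
apply: leq_ltn_trans (ltn_ord j); rewrite [leqRHS](divn_eq j D).
by apply: leq_add => //; rewrite leq_mul2r h1 orbT.
Qed.

(* The top left pixel of the cell of side [2 ^ l] that contains [j]. *)
Definition rep l j : 'I_n := Ordinal (rep_proof l j).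

Lemma rep_col l j : (rep l j %/ D = cx l j * 2 ^ l)%N.
Proof.
rewrite /= divnMDl ?D_gt0 // divn_small ?addn0 //.
exact: leq_ltn_trans (leq_divM _ _) (row_lt j).
Qed.

Lemma rep_row l j : (rep l j %% D = cy l j * 2 ^ l)%N.
Proof.
rewrite /= modnMDl modn_small //.
exact: leq_ltn_trans (leq_divM _ _) (row_lt j).
Qed.

Let div_level l l' a : (l' <= l)%N ->
  ((a %/ 2 ^ l' * 2 ^ l') %/ 2 ^ l = a %/ 2 ^ l)%N.
Proof.
move=> le; rewrite -(subnK le) expnD [in RHS]mulnC [RHS]divnMA.
by rewrite divnMr // expn_gt0.
Qed.

Lemma cx_rep l l' j : (l' <= l)%N -> cx l (rep l' j) = cx l j.
Proof. by move=> le; rewrite /cx rep_col div_level. Qed.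

Lemma cy_rep l l' j : (l' <= l)%N -> cy l (rep l' j) = cy l j.
Proof. by move=> le; rewrite /cy rep_row div_level. Qed.

Lemma rep_eq l i j : cx l i = cx l j -> cy l i = cy l j -> rep l i = rep l j.
Proof. by move=> e1 e2; apply: val_inj; rewrite /= e1 e2. Qed.

Lemma rep_rep l l' j : (l' <= l)%N -> rep l (rep l' j) = rep l j.
Proof. by move=> le; apply: rep_eq; rewrite ?cx_rep ?cy_rep. Qed.

Lemma rep0 j : rep 0 j = j.
Proof. by apply: val_inj; rewrite /= /cx /cy expn0 !divn1 !muln1 -divn_eq. Qed.

Lemma rep_step_dist l j : (pixel_dist j (rep l.+1 j) <= 4 * 2 ^ l)%N.
Proof.
rewrite /pixel_dist rep_col rep_row /cx /cy.
have e a : (`|a%:Z - (a %/ 2 ^ l.+1 * 2 ^ l.+1)%:Z| <= 2 * 2 ^ l)%N.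
  rewrite -expnS.
  have h : (0 < 2 ^ l.+1)%N by rewrite expn_gt0.
  have := divn_eq a (2 ^ l.+1); have := ltn_pmod a h.
  by set u := (a %/ _ * _)%N; set v := (a %% _)%N; lia.
by have := e (j %/ D)%N; have := e (j %% D)%N; lia.
Qed.

Definition cell_class (s l : nat) j : nat := ((cx l j %% s) * s + cy l j %% s)%N.

Lemma cell_class_lt s l j : (0 < s)%N -> (cell_class s l j < s ^ 2)%N.
Proof.
move=> s0; rewrite /cell_class -mulnn.
have := ltn_pmod (cx l j) s0; have := ltn_pmod (cy l j) s0.
by move: (_ %% s)%N (_ %% s)%N => a b; nia.
Qed.

Lemma cell_class_mod s l i j : (0 < s)%N -> cell_class s l i = cell_class s l j ->
  cx l i = cx l j %[mod s] /\ cy l i = cy l j %[mod s].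
Proof.
move=> s0 e; have h a b : (b %% s < s)%N -> ((a %% s * s + b %% s) %/ s = a %% s)%N.
  by move=> bs; rewrite divnMDl // divn_small // addn0.
have e1 : cx l i = cx l j %[mod s].
  by have := congr1 (divn^~ s) e; rewrite /cell_class /= !h ?ltn_mod.
by split=> //; move: e; rewrite /cell_class e1 => /addnI.
Qed.

Definition rep_in_class (s l o : nat) j : bool :=
  (rep l j == j) && (cell_class s l j == o).

Lemma cell_lt l j : (l <= p)%N -> (cx l j < 2 ^ (p - l))%N /\ (cy l j < 2 ^ (p - l))%N.
Proof.
move=> lp; have h a : (a < D)%N -> (a %/ 2 ^ l < 2 ^ (p - l))%N.
  by move=> aD; rewrite ltn_divLR ?expn_gt0 // -expnD subnK.
by split; apply: h; rewrite ?col_lt ?row_lt.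
Qed.

Lemma card_rep_in_class q l o : (l + q <= p)%N ->
  (#|[set j | rep_in_class (2 ^ q) l o j]| <= 4 ^ (p - l - q))%N.
Proof.
move=> lq; set s := (2 ^ q)%N; have s0 : (0 < s)%N by rewrite expn_gt0.
have lp : (l <= p)%N by lia.
have b a : (a < 2 ^ (p - l))%N -> (a %/ s < 2 ^ (p - l - q))%N.
  by rewrite ltn_divLR // -expnD subnK //; lia.
pose f j : 'I_(2 ^ (p - l - q)) * 'I_(2 ^ (p - l - q)) :=
  (Ordinal (b _ (cell_lt j lp).1), Ordinal (b _ (cell_lt j lp).2)).
apply: leq_trans (_ : #|f @: [set j | rep_in_class s l o j]| <= _)%N.
  rewrite card_in_imset // => i j; rewrite !inE => /andP[/eqP ri /eqP ci].
  move=> /andP[/eqP rj /eqP cj] [e1 e2].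
  have [m1 m2] := cell_class_mod s0 (etrans ci (esym cj)).
  rewrite -ri -rj; apply: rep_eq.
    by rewrite (divn_eq (cx l i) s) (divn_eq (cx l j) s) e1 m1.
  by rewrite (divn_eq (cy l i) s) (divn_eq (cy l j) s) e2 m2.
apply: leq_trans (max_card _) _; rewrite card_prod card_ord.
by rewrite -expnD -[4%N]/(2 ^ 2)%N -expnM leq_exp2l //; lia.
Qed.

Definition near (s a b : nat) : bool := (a <= b + s)%N && (b <= a + s)%N.

Definition is_head (s l : nat) (C : {set 'I_n}) j : bool :=
  [exists c in C, near s (cx l j) (cx l c) && near s (cy l j) (cy l c)].

Lemma is_head_rep s l (C : {set 'I_n}) j : is_head s l C (rep l j) = is_head s l C j.
Proof. by apply: eq_existsb => c; rewrite cx_rep // cy_rep. Qed.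

(** Cells whose indices differ by more than [s] have [s] full cells between them. *)
Lemma not_head_dist s l (C : {set 'I_n}) j c : c \in C -> ~~ is_head s l C j ->
  (2 ^ l * s <= pixel_dist j c)%N.
Proof.
move=> cC /existsPn /(_ c); rewrite cC /= /cx /cy /pixel_dist.
have key a b : ~~ near s (a %/ 2 ^ l) (b %/ 2 ^ l) -> (2 ^ l * s <= `|a%:Z - b%:Z|)%N.
  rewrite /near negb_and -!ltnNge => h.
  have ha := divn_eq a (2 ^ l); have hb := divn_eq b (2 ^ l).
  have L0 : (0 < 2 ^ l)%N by rewrite expn_gt0.
  have := ltn_pmod a L0; have := ltn_pmod b L0.
  move: ha hb h L0; set A := (a %/ _)%N; set B := (b %/ _)%N.
  set a' := (a %% _)%N; set b' := (b %% _)%N; move: (2 ^ l)%N A B a' b'.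
  by move=> L A B a' b' -> -> /orP[h|h] ? ? ?;
    have := leq_mul h (leqnn L); rewrite mulSn mulnDl [(L * s)%N]mulnC; lia.
by rewrite negb_and => /orP[] /key; lia.
Qed.

(** A geometric sum: the terms below the largest one add up to at most that one, which is at most
    [d]. *)
Lemma sum_levels (H s d : nat) :
  (\sum_(l < H | 2 ^ l * s <= d) 2 ^ l * s <= 2 * d)%N.
Proof.
have full m : (\sum_(l < m) 2 ^ l * s <= 2 ^ m * s)%N.
  elim: m => [|m IH]; first by rewrite big_ord0.
  by rewrite big_ord_recr /= expnS -mulnA mul2n -addnn leq_add2r.
elim: H => [|H IH]; first by rewrite big_ord0.
rewrite big_mkcond big_ord_recr /= -big_mkcond /=.
case: ifP => [le|_]; last by rewrite addn0.
apply: leq_trans (_ : \sum_(l < H) 2 ^ l * s + 2 ^ H * s <= _)%N.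
  by rewrite leq_add2r big_mkcond leq_sum // => l _; case: ifP.
by have := full H; lia.
Qed.

End Grid.

Section Nodes.
Variables p q H : nat.
Notation D := (2 ^ p)%N.
Notation n := (D ^ 2)%N.
Notation s := (2 ^ q)%N.
Implicit Types (i j c : 'I_n) (l o : nat).

(* Coarse cells come first, so that parents precede their children. *)
Definition nodes o : seq (nat * 'I_n) :=
  sort (fun x y => y.1 <= x.1)%N
    [seq (l, j) | l <- iota 0 H, j <- enum [pred j | rep_in_class s l o j]].

Lemma mem_nodes o x :
  (x \in nodes o) = (x.1 < H)%N && rep_in_class s x.1 o x.2.
Proof.
case: x => l j; rewrite mem_sort; apply/allpairsPdep/andP => /=.
  move=> [l' [j' [lH]]]; rewrite mem_iota /= add0n in lH.
  by rewrite mem_enum inE => rc [-> ->].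
by move=> [lH rc]; exists l, j; rewrite mem_iota mem_enum inE.
Qed.

Lemma nodes_uniq o : uniq (nodes o).
Proof.
rewrite sort_uniq allpairs_uniq_dep ?iota_uniq // => [l _|].
  exact: enum_uniq.
by move=> [l j] [l' j'] _ _ /= [-> ->].
Qed.

Lemma nodes_level o x0 u v : (u <= v)%N -> (v < size (nodes o))%N ->
  ((nth x0 (nodes o) v).1 <= (nth x0 (nodes o) u).1)%N.
Proof.
move=> uv vN; have tr : transitive (fun x y : nat * 'I_n => y.1 <= x.1)%N.
  by move=> y x z h1 h2; apply: leq_trans h2 h1.
have tot : total (fun x y : nat * 'I_n => y.1 <= x.1)%N.
  by move=> x y; apply: leq_total.
have srt : sorted (fun x y : nat * 'I_n => y.1 <= x.1)%N (nodes o) by exact: sort_sorted.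
have refl : reflexive (fun x y : nat * 'I_n => y.1 <= x.1)%N by move=> x; exact: leqnn.
have uN := leq_ltn_trans uv vN.
exact: (sorted_leq_nth tr refl x0 srt u v uN vN uv).
Qed.

Lemma sum_nodes (V : nmodType) (o : nat) (F : nat * 'I_n -> V) :
  \sum_(x <- nodes o) F x = \sum_(l < H) \sum_(j | rep_in_class s l o j) F (val l, j).
Proof.
have P : perm_eq (nodes o) [seq (l, j) | l <- iota 0 H, j <- enum [pred j | rep_in_class s l o j]].
  by rewrite /nodes perm_sort.
rewrite (perm_big _ P) big_allpairs_dep /=.
rewrite -(big_mkord xpredT (fun l => \sum_(j | rep_in_class s l o j) F (l, j))).
rewrite /index_iota subn0; apply: eq_bigr => l _.
by rewrite big_enum_cond; apply: eq_bigl => j; rewrite inE andbT.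
Qed.

Lemma sum_nodes_nth (V : nmodType) (o : nat) x0 (F : nat * 'I_n -> V) :
  \sum_(v < size (nodes o)) F (nth x0 (nodes o) v) = \sum_(x <- nodes o) F x.
Proof. by rewrite (big_nth x0) big_mkord. Qed.

Lemma sum_all_nodes (V : nmodType) (F : nat * 'I_n -> V) :
  \sum_(o < s ^ 2) \sum_(x <- nodes o) F x =
  \sum_(l < H) \sum_(j | rep l j == j) F (val l, j).
Proof.
under eq_bigr do rewrite sum_nodes.
rewrite exchange_big; apply: eq_bigr => l _ /=.
have s0 : (0 < s)%N by rewrite expn_gt0.
rewrite (partition_big (fun j => Ordinal (cell_class_lt l j s0)) predT) //=.
Qed.

Lemma size_nodes o : (q + H <= p)%N -> (size (nodes o) <= 2 * 4 ^ (p - q))%N.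
Proof.
move=> qH; rewrite -sum1_size sum_nodes.
apply: leq_trans (_ : \sum_(l < H) 4 ^ (p - q - l) <= _)%N.
  apply: leq_sum => l _; rewrite sum1dep_card.
  apply: leq_trans (card_rep_in_class _ _) _; first by have := ltn_ord l; lia.
  by rewrite leq_exp2l //; lia.
have : (H <= p - q)%N by lia.
move: (p - q)%N => a; elim: H a => [|h IH] a ha; first by rewrite big_ord0.
rewrite big_ord_recl subn0 /=; case: a ha => // a ha.
have -> : (\sum_(i < h) 4 ^ (a.+1 - bump 0 i) = \sum_(i < h) 4 ^ (a - i))%N.
  by apply: eq_bigr => i _; rewrite /bump /= add1n subSS.
by have := IH a ha; rewrite expnS; lia.
Qed.

(** * Telescoping, and the weight of the cells far from the support *)

Section Mass.
Context {R : realType}.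
Variable x : 'cV[R]_n.
Hypothesis x0 : nonneg x.

Definition mass l j : R := \sum_(i | rep l i == j) x i 0.

Lemma mass_ge0 l j : 0 <= mass l j. Proof. by apply: sumr_ge0. Qed.

Lemma mass_parent l j : mass l j <= mass l.+1 (rep l.+1 j).
Proof.
rewrite /mass [leLHS]big_mkcond [leRHS]big_mkcond; apply: ler_sum => i _.
case: eqP => [<-|_]; first by rewrite rep_rep // eqxx.
by case: ifP.
Qed.

Lemma sum_mass l (G : 'I_n -> R) :
  \sum_(j | rep l j == j) mass l j * G j = \sum_i x i 0 * G (rep l i).
Proof.
rewrite [RHS](partition_big (rep l) (fun j => rep l j == j)) /=; last first.
  by move=> i _; rewrite rep_rep.
apply: eq_bigr => j _; rewrite mulr_suml; apply: eq_bigr => i /eqP <- //.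
Qed.

Lemma telescope_mass (g : 'I_n) :
  x g 0 = (if rep H g == g then mass H g else 0) +
  \sum_(l < H) \sum_(j | rep l j == j)
     mass l j * ((g == j)%:R - (g == rep l.+1 j)%:R).
Proof.
(* The value at [g] once all mass has moved to the cell corners of level [l]; at level 0 it is [x]
   itself. *)
pose Z l := \sum_i x i 0 * (g == rep l i)%:R.
have -> : (if rep H g == g then mass H g else 0) = Z H.
  rewrite /Z; case: eqP => [e|ne].
    rewrite /mass big_mkcond; apply: eq_bigr => i _.
    by rewrite eq_sym; case: ifP; rewrite ?mulr1 ?mulr0.
  rewrite big1 // => i _; case: eqP => [e|]; last by rewrite mulr0.
  by case: ne; rewrite e rep_rep.
have e l : \sum_(j | rep l j == j) mass l j * ((g == j)%:R - (g == rep l.+1 j)%:R) = Z l - Z l.+1.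
  rewrite sum_mass /Z -sumrB; apply: eq_bigr => i _.
  by rewrite rep_rep // mulrBr.
under eq_bigr do rewrite e.
have -> : \sum_(l < H) (Z l - Z l.+1) = Z 0%N - Z H.
  elim: H => [|h IH]; first by rewrite big_ord0 subrr.
  by rewrite big_ord_recr IH /=; ring.
rewrite addrC subrK /Z (bigD1 g) //= rep0 eqxx mulr1 big1 ?addr0 // => i ig.
by rewrite rep0 eq_sym (negPf ig) mulr0.
Qed.

Variable C : {set 'I_n}.
Hypothesis C0 : (0 < #|C|)%N.

Definition centre i : 'I_n :=
  if [pick c in C] is Some c0 then [arg min_(c < c0 in C) pixel_dist i c]%N else i.

Lemma centreP i : centre i \in C /\
  forall c, c \in C -> (pixel_dist i (centre i) <= pixel_dist i c)%N.
Proof.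
rewrite /centre; case: pickP => [c0 c0C|none]; first by case: arg_minnP.
by case/card_gt0P: C0 => c cC; have := none c; rewrite /= cC.
Qed.

Let delta i : R := (pixel_dist i (centre i))%:R.

(** Pixel by pixel: level [l] contributes only if the pixel is at least [2 ^ l * s] away from [C],
    so [sum_levels] bounds the contributions by twice its distance to [C]. *)
Lemma tail_mass :
  s%:R * (\sum_(l < H) \sum_(j | rep l j == j)
    (if is_head s l C j then 0 else (2 ^ l)%:R * mass l j)) <=
  2 * \sum_i x i 0 * delta i.
Proof.
have e l : \sum_(j | rep l j == j) (if is_head s l C j then 0 else (2 ^ l)%:R * mass l j) =
    \sum_i x i 0 * (if is_head s l C i then 0 else (2 ^ l)%:R).
  rewrite (eq_bigr (fun j => mass l j * (if is_head s l C j then 0 else (2 ^ l)%:R))); last first.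
    by move=> j _; case: ifP => _; rewrite ?mulr0 // mulrC.
  by rewrite sum_mass; apply: eq_bigr => i _; rewrite is_head_rep.
under eq_bigr do rewrite e.
rewrite exchange_big !mulr_sumr; apply: ler_sum => i _ /=.
rewrite -mulr_sumr mulrCA [leRHS]mulrCA ler_wpM2l //.
apply: le_trans (_ : (\sum_(l < H | 2 ^ l * s <= pixel_dist i (centre i)) 2 ^ l * s)%N%:R <= _).
  rewrite natr_sum mulr_sumr big_mkcond [leRHS]big_mkcond; apply: ler_sum => l _ /=.
  case: (boolP (is_head s l C i)) => hd; first by rewrite mulr0; case: ifP.
  by rewrite (not_head_dist (centreP i).1 hd) mulrC natrM.
by rewrite /delta -natrM ler_nat sum_levels.
Qed.

(** The distance to [C] is a dual potential that vanishes on [C], so it does not see [x']. *)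
Lemma dist_le_emd (x' : 'cV[R]_n) : (forall i, i \notin C -> x' i 0 = 0) ->
  \sum_i x i 0 * delta i <= emd_norm (x - x').
Proof.
move=> x'C; apply: le_trans (emd_norm_ge _ (_ : lipschitz delta)); last first.
  split=> [i|i j].
    by rewrite ler0n /= /delta -natrM ler_nat pixel_dist_le.
  rewrite /delta lerBlDr -natrD ler_nat.
  have [_ /(_ _ (centreP j).1) h] := centreP i.
  exact: leq_trans h (pixel_dist_triangle _ _ _).
apply: ler_sum => i _; rewrite !mxE.
have [iC|iC] := boolP (i \in C); last by rewrite x'C // subr0 mulrC.
have -> : delta i = 0; last by rewrite mulr0 mul0r.
have [_ /(_ i iC)] := centreP i; rewrite /delta.
have -> : pixel_dist i i = 0%N by rewrite /pixel_dist !distnn.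
by rewrite leqn0 => /eqP ->.
Qed.

End Mass.

Lemma near_div a b : near s a b -> (a %/ s <= (b %/ s).+1)%N /\ (b %/ s <= (a %/ s).+1)%N.
Proof.
have s0 : (0 < s)%N by rewrite expn_gt0.
have h u v : (u <= v + s)%N -> (u %/ s <= (v %/ s).+1)%N.
  move=> uv; apply: leq_trans (leq_div2r s uv) _.
  by rewrite divnDr ?dvdnn // divnn s0 addn1.
by case/andP => /h h1 /h h2.
Qed.

(** Fix a pixel of [C] and a level. Cells of one class agree modulo [s], and nearness leaves three
    quotients by [s] in each direction: at most 9 cells. *)
Lemma card_head o (C : {set 'I_n}) x0 :
  (#|[set v : 'I_(size (nodes o)) | is_head s (nth x0 (nodes o) v).1 C (nth x0 (nodes o) v).2]|
    <= 9 * #|C| * H)%N.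
Proof.
set S := [set v | _]; have s0 : (0 < s)%N by rewrite expn_gt0.
pose nd (v : 'I_(size (nodes o))) := nth x0 (nodes o) v.
have ndP v : nd v \in nodes o by exact: mem_nth.
pose cen (v : 'I_(size (nodes o))) := odflt (nd v).2
  [pick c in C | near s (cx (nd v).1 (nd v).2) (cx (nd v).1 c) &&
                 near s (cy (nd v).1 (nd v).2) (cy (nd v).1 c)].
have cenP v : v \in S -> [/\ cen v \in C,
    near s (cx (nd v).1 (nd v).2) (cx (nd v).1 (cen v)) &
    near s (cy (nd v).1 (nd v).2) (cy (nd v).1 (cen v))].
  rewrite inE /is_head => hd; rewrite /cen; case: pickP => [c /and3P[]|none] //=.
  by case/exists_inP: hd => c cC hh; have := none c; rewrite cC /= hh.
have lev v : ((nd v).1 < H)%N by have := ndP v; rewrite mem_nodes => /andP[].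
(* The difference of the quotients, shifted by 1 into the range 0 to 2. *)
pose dif (a b : nat) : 'I_3 := inord ((a %/ s).+1 - b %/ s).
pose f v : 'I_n * 'I_H * ('I_3 * 'I_3) :=
  ((cen v, Ordinal (lev v)),
   (dif (cx (nd v).1 (nd v).2) (cx (nd v).1 (cen v)),
    dif (cy (nd v).1 (nd v).2) (cy (nd v).1 (cen v)))).
have difP a b a' : near s a b -> near s a' b -> a = a' %[mod s] ->
    dif a b = dif a' b -> a = a'.
  move=> /near_div[h1 h2] /near_div[h3 h4] ea /(congr1 val).
  rewrite /= !inordK; try lia.
  by move=> ed; rewrite (divn_eq a s) (divn_eq a' s) ea; congr (_ * _ + _)%N; lia.
have finj : {in S &, injective f}.
  move=> u v /cenP[_ u1 u2] /cenP[_ v1 v2] [ec el e1 e2].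
  have : nd u = nd v.
    move: (ndP u) (ndP v) ec el e1 e2 u1 u2 v1 v2.
    rewrite !mem_nodes => /andP[_ /andP[/eqP ru /eqP cu]] /andP[_ /andP[/eqP rv /eqP cv]] -> el.
    rewrite el in ru cu *; move=> e1 e2 u1 u2 v1 v2.
    have [m1 m2] := cell_class_mod s0 (etrans cu (esym cv)).
    rewrite [LHS]surjective_pairing [RHS]surjective_pairing el -ru -rv; congr (_, _).
    by apply: rep_eq; [exact: difP u1 v1 m1 e1 | exact: difP u2 v2 m2 e2].
  by move/eqP; rewrite nth_uniq ?nodes_uniq // => /eqP/val_inj.
rewrite -(card_in_imset finj).
apply: leq_trans (subset_leq_card
  (_ : _ \subset setX (setX C [set: 'I_H]) [set: 'I_3 * 'I_3])) _.
  apply/subsetP => _ /imsetP[v vS ->]; have [cC _ _] := cenP v vS.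
  by rewrite !inE /= cC.
rewrite !cardsX !cardsT !card_prod !card_ord; lia.
Qed.

Lemma pix0_proof : (0 < n)%N. Proof. by rewrite !expn_gt0. Qed.

Definition node o (u : nat) : nat * 'I_n := nth (0%N, Ordinal pix0_proof) (nodes o) u.

(** If the parent cell lies in another class or at level [H], then [index] returns the size of the
    list, [insub] fails, and the node counts as a root. *)
Definition par o (u : 'I_(size (nodes o))) : option 'I_(size (nodes o)) :=
  insub (index ((node o u).1.+1, rep (node o u).1.+1 (node o u).2) (nodes o)).

Lemma par_some o (u v : 'I_(size (nodes o))) : par u = Some v ->
  node o v = ((node o u).1.+1, rep (node o u).1.+1 (node o u).2).
Proof.
rewrite /par; case: insubP => // v' lt e [<-].
by rewrite /node -/(node o u) e nth_index // -index_mem.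
Qed.

Lemma par_lt o (u v : 'I_(size (nodes o))) : par u = Some v -> (v < u)%N.
Proof.
move=> /par_some e; rewrite ltnNge; apply/negP => uv.
have := nodes_level (0%N, Ordinal pix0_proof) uv (ltn_ord v).
by rewrite -!/(node _ _) e /= ltnn.
Qed.

Lemma nodeP o (u : 'I_(size (nodes o))) :
  ((node o u).1 < H)%N /\ rep_in_class s (node o u).1 o (node o u).2.
Proof. by apply/andP; rewrite -mem_nodes mem_nth. Qed.

Lemma node_inj o (u v : 'I_(size (nodes o))) : node o u = node o v -> u = v.
Proof. by move/eqP; rewrite nth_uniq ?nodes_uniq // => /eqP/val_inj. Qed.

(** A child is determined by the parities of its two cell coordinates. *)
Lemma card_children o (u : 'I_(size (nodes o))) :
  (#|[set v | par v == Some u]| <= 4)%N.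
Proof.
pose par2 (a : nat) : 'I_2 := inord (a %% 2).
pose f (v : 'I_(size (nodes o))) :=
  (par2 (cx (node o v).1 (node o v).2), par2 (cy (node o v).1 (node o v).2)).
have par2E a b : par2 a = par2 b -> a = b %[mod 2].
  by move/(congr1 val); rewrite /= !inordK ?ltn_mod.
have half l j : (cx l.+1 j = cx l j %/ 2 /\ cy l.+1 j = cy l j %/ 2)%N.
  by rewrite /cx /cy (expnSr 2 l) !divnMA.
rewrite -(card_in_imset (_ : {in [set v | par v == Some u] &, injective f})).
  by apply: leq_trans (max_card _) _; rewrite card_prod !card_ord.
move=> v w; rewrite !inE => /eqP/par_some ev /eqP/par_some ew [/par2E e1 /par2E e2].
have e := etrans (esym ev) ew; apply: node_inj.
move: (congr1 fst e) (congr1 snd e) => {e ev ew}; move: e1 e2 (nodeP v).2 (nodeP w).2.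
case: (node o v) => l i; case: (node o w) => l' j /= e1 e2.
move=> /andP[/eqP ri _] /andP[/eqP rj _] [ll]; subst l' => er.
have [hi hi'] := half l i; have [hj hj'] := half l j.
congr (_, _); rewrite -ri -rj; apply: rep_eq.
  rewrite (divn_eq (cx l i) 2) (divn_eq (cx l j) 2) e1 -hi -hj.
  by rewrite -(cx_rep i (leqnn l.+1)) er cx_rep.
rewrite (divn_eq (cy l i) 2) (divn_eq (cy l j) 2) e2 -hi' -hj'.
by rewrite -(cy_rep i (leqnn l.+1)) er cy_rep.
Qed.

(** With a single class only the coarsest level [H - 1] lacks parents. *)
Lemma card_roots o : q = 0%N -> (0 < H <= p)%N ->
  (#|[set v : 'I_(size (nodes o)) | par v == None]| <= 4 ^ (p - H).+1)%N.
Proof.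
move=> q0 /andP[H0 Hp]; pose f (v : 'I_(size (nodes o))) := (node o v).2.
have lev (v : 'I_(size (nodes o))) : par v == None -> (node o v).1 = H.-1.
  have [lt /andP[/eqP rv /eqP cv]] := nodeP v.
  rewrite /par; case: insubP => // + _; rewrite index_mem mem_nodes /= negb_and.
  rewrite -leqNgt => /orP[|/negP[]]; first by lia.
  rewrite /rep_in_class rep_rep // eqxx /=; move: cv.
  by rewrite /cell_class q0 expn0 !modn1 => ->.
rewrite -(card_in_imset (_ : {in [set v | par v == None] &, injective f})); last first.
  move=> v w; rewrite !inE => /lev ev /lev ew e; apply: node_inj.
  by rewrite [LHS]surjective_pairing [RHS]surjective_pairing ev ew; congr (_, _).
apply: leq_trans (_ : #|[set j | rep_in_class s H.-1 o j]| <= _)%N.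
  apply/subset_leq_card/subsetP => _ /imsetP[v + ->]; rewrite !inE => /lev <-.
  by case: (nodeP v).
apply: leq_trans (card_rep_in_class _ _) _; first by lia.
by rewrite leq_exp2l //; lia.
Qed.

End Nodes.

(** * The sketch *)

Section Table.
Context {R : realType}.

Lemma size_flatten_iota (f : nat -> seq R) S :
  size (flatten [seq f o | o <- iota 0 S]) = (\sum_(o < S) size (f o))%N.
Proof.
elim: S => [|S IH]; first by rewrite big_ord0.
by rewrite -addn1 iotaD map_cat flatten_cat size_cat IH /= cats0 addn1 big_ord_recr.
Qed.

Lemma nth_flatten_iota (f : nat -> seq R) S o r : (o < S)%N -> (r < size (f o))%N ->
  nth 0 (flatten [seq f o | o <- iota 0 S]) (\sum_(o' < o) size (f o') + r) = nth 0 (f o) r.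
Proof.
move=> oS rf; rewrite -(subnKC oS) iotaD map_cat flatten_cat -addn1 iotaD map_cat.
rewrite flatten_cat /= cats0 add0n -catA nth_cat size_flatten_iota.
by rewrite ltnNge leq_addr /= addKn nth_cat rf.
Qed.

Variable ly : @layout R.

Definition record_cells o v : seq R :=
  mkseq (fun r => (ly_phi ly o v r)%:R) (ly_R1 ly) ++ mkseq (ly_B ly o v) (ly_R2 ly)
    ++ [:: (ly_pos ly o v)%:R; (ly_neg ly o v)%:R].

Definition class_cells o : seq R :=
  [:: (ly_NN ly o)%:R; (ly_K ly o)%:R] ++
    flatten [seq record_cells o v | v <- iota 0 (ly_NN ly o)].

Definition table : seq R :=
  [:: (ly_a ly)%:R; (ly_S ly)%:R; (ly_R1 ly)%:R; (ly_R2 ly)%:R; (ly_NT ly)%:R] ++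
  mkseq (fun t => (ly_top ly t)%:R) (ly_NT ly) ++
  flatten [seq class_cells o | o <- iota 0 (ly_S ly)].

Lemma size_record o v : size (record_cells o v) = rec_size ly.
Proof. by rewrite !size_cat !size_mkseq /rec_size /= addnA. Qed.

Lemma size_class o : size (class_cells o) = (2 + ly_NN ly o * rec_size ly)%N.
Proof.
rewrite size_cat size_flatten_iota; under eq_bigr do rewrite size_record.
by rewrite sum_nat_const card_ord.
Qed.

Lemma size_table : size table = class_addr ly (ly_S ly).
Proof.
rewrite !size_cat size_mkseq size_flatten_iota /class_addr addnA.
by congr (_ + _)%N; apply: eq_bigr => o _; rewrite size_class.
Qed.

Lemma class_addr_lt o r : (o < ly_S ly)%N -> (r < 2 + ly_NN ly o * rec_size ly)%N ->
  (class_addr ly o + r < class_addr ly (ly_S ly))%N.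
Proof.
move=> oS rc; rewrite /class_addr -addnA ltn_add2l.
rewrite -(big_mkord xpredT (fun o' => 2 + ly_NN ly o' * rec_size ly)%N).
rewrite -(big_mkord xpredT (fun o' => 2 + ly_NN ly o' * rec_size ly)%N).
rewrite [ltnRHS](big_cat_nat (n := o)) //=; last exact: ltnW.
rewrite ltn_add2l big_ltn //; exact: ltn_addr.
Qed.

Variable M : nat -> R.
Hypothesis MT : forall g, (g < size table)%N -> M g = nth 0 table g.

Lemma table_header : header_stored ly M.
Proof. by split; rewrite MT. Qed.

Lemma table_top : top_stored ly M.
Proof.
move=> t tN; rewrite MT; last by rewrite !size_cat size_mkseq /=; lia.
by rewrite /table /= add0n nth_cat size_mkseq tN nth_mkseq.
Qed.

Lemma table_at o r : (o < ly_S ly)%N -> (r < 2 + ly_NN ly o * rec_size ly)%N ->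
  M (class_addr ly o + r)%N = nth 0 (class_cells o) r.
Proof.
move=> oS rc; rewrite MT; last by rewrite size_table class_addr_lt.
rewrite -(nth_flatten_iota oS) ?size_class //.
rewrite /table catA nth_cat size_cat size_mkseq.
rewrite (_ : (_ < _)%N = false); last by rewrite /class_addr /=; lia.
congr nth; under [in RHS]eq_bigr do rewrite size_class.
by rewrite /class_addr /=; set X := (\sum_(_ < o) _)%N; lia.
Qed.

Lemma table_class o : (o < ly_S ly)%N -> class_stored ly M o.
Proof.
move=> oS; split.
- by rewrite -[class_addr _ _]addn0 table_at.
- by rewrite table_at.
move=> v vN.
have h r : (r < rec_size ly)%N -> M (rec_addr ly o v + r)%N = nth 0 (record_cells o v) r.
  move=> rr; have -> : (rec_addr ly o v + r = class_addr ly o + (2 + (v * rec_size ly + r)))%N.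
    by rewrite /rec_addr; lia.
  rewrite table_at //; last first.
    have := leq_mul2r (rec_size ly) v.+1 (ly_NN ly o); rewrite vN orbT mulSn; lia.
  rewrite /class_cells /=; rewrite -(nth_flatten_iota (f := record_cells o) vN) ?size_record //.
  congr nth; congr (_ + _)%N.
  by under eq_bigr do rewrite size_record; rewrite sum_nat_const card_ord.
split=> [r rR|r rR||].
- rewrite h; last by rewrite /rec_size; lia.
  by rewrite nth_cat size_mkseq rR nth_mkseq.
- rewrite -addnA h; last by rewrite /rec_size; lia.
  by rewrite nth_cat size_mkseq ltnNge leq_addr /= addKn nth_cat size_mkseq rR nth_mkseq.
- rewrite -addnA h; last by rewrite /rec_size; lia.
  rewrite nth_cat size_mkseq ltnNge leq_addr /= addKn nth_cat size_mkseq ltnn subnn //.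
- rewrite -addnA -(addnA (rec_addr ly o v)) h; last by rewrite /rec_size; lia.
  rewrite nth_cat size_mkseq ltnNge leq_addr /= addKn nth_cat size_mkseq ltnNge leq_addr /=.
  by rewrite addKn.
Qed.

End Table.

Lemma cells_mulmx {R : realType} m n (A : 'M[R]_(m, n)) (x : 'cV[R]_n) (g : 'I_m) :
  cells (A *m x) g = \sum_j A g j * x j 0.
Proof. by rewrite /cells (nth_map g) ?size_enum_ord // nth_ord_enum mxE. Qed.

Lemma card_code m b (P : pred nat) (f : nat -> nat) :
  (forall i, P i -> (f i < b)%N) -> {in P &, injective f} ->
  (#|[set i : 'I_m | P i]| <= b)%N.
Proof.
move=> fb fi; case: b fb => [|b] fb.
  by rewrite leqn0 cards_eq0; apply/eqP/setP => i; rewrite !inE; apply/negP => /fb.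
have inj : {in [set i : 'I_m | P i] &, injective (fun i : 'I_m => inord (f i) : 'I_b.+1)}.
  move=> i j; rewrite !inE => Pi Pj /(congr1 val); rewrite /= !inordK ?fb //.
  by move/(fi _ _ Pi Pj)/val_inj.
by rewrite -(card_in_imset inj); apply: leq_trans (max_card _) _; rewrite card_ord.
Qed.

(** Two terms survive: the first covers reading the matrix and selecting in all classes, the second
    the least squares problems. Products are generalized to variables throughout, so that only
    linear goals remain. *)
Lemma time_arith n H K R1 R2 s2 r a nt nz f nb :
  let W := (R1 + R2 + 2)%N in
  (0 < n)%N -> (0 < K)%N -> (0 < nb)%N -> (4 * K < W)%N -> (r <= 15 * (n * W))%N ->
  (nz <= n * (a + 1 + H * (R1 + R2)))%N -> (a <= 2 * W + 9)%N -> (nt <= n)%N ->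
  (s2 <= n)%N -> (s2 * f = n)%N ->
  (n + r + nz + nt.+1 * nb + s2 * (nb * (4 * K).+1 + (2 * f).+1 * (4 * K + R1).+1 +
     (4 * K).+1 * (4 * K).+1 * (R2 + 4 * K).+1) + 1
   <= 50 * (nb * (n * H.+1 * W + s2 * K ^ 2 * W)))%N.
Proof.
move=> W n0 K0 nb0 KW hr hnz ha hnt s2n s2f.
pose X := (n * H.+1 * W)%N; pose Y := (s2 * K ^ 2 * W)%N.
have W0 : (0 < W)%N by exact: leq_ltn_trans KW.
have RW : (R1 + R2 <= W)%N by exact: leq_addr.
have R1W : (R1 <= W)%N by rewrite /W -addnA leq_addr.
have R2W : (R2.+1 <= W)%N by rewrite /W; lia.
have nW : (n * W <= X)%N by rewrite /X -mulnA leq_mul2l mulSn leq_addr orbT.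
have nnW : (n <= n * W)%N by rewrite leq_pmulr.
have nHW : (n * (H * W) + n * W = X)%N by rewrite /X -mulnA mulSnr mulnDr.
have t1 : (nz <= 12 * X)%N.
  apply: leq_trans hnz _; apply: leq_trans (_ : n * (12 * W + H * W) <= _)%N.
    rewrite leq_mul2l leq_add ?orbT //; last by rewrite leq_mul2l RW orbT.
    by move: ha W0; move: (W) => w; lia.
  by rewrite mulnDr mulnCA; move: nHW nnW nW; clear; move: X (n * _)%N (n * _)%N => x u v; lia.
have t2 : (nt.+1 * nb <= nb * (2 * X))%N.
  rewrite mulnC leq_mul2l; apply/orP; right.
  by move: hnt n0 nnW nW; clear; move: X (n * W)%N => x u; lia.
have q_n : (s2 * W <= X)%N by apply: leq_trans nW; rewrite leq_mul2r s2n orbT.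
have t3 : (s2 * (nb * (4 * K).+1) <= nb * X)%N.
  rewrite mulnCA leq_mul2l; apply/orP; right; apply: leq_trans q_n.
  by rewrite leq_mul2l KW orbT.
have t4 : (s2 * ((2 * f).+1 * (4 * K + R1).+1) <= 6 * X)%N.
  apply: leq_trans (_ : (3 * n) * (2 * W) <= _)%N.
    rewrite mulnA leq_mul //.
      by rewrite mulnS mulnCA s2f; move: s2n; clear; lia.
    by move: KW R1W; clear; move: (W) => w; lia.
  by rewrite mulnACA; move: nW; clear; move: X (n * W)%N => x u; lia.
have t5 : (s2 * ((4 * K).+1 * (4 * K).+1 * (R2 + 4 * K).+1) <= 50 * Y)%N.
  have -> : (50 * Y = s2 * (5 * K * (5 * K) * (2 * W)))%N by rewrite /Y -mulnn; ring.
  rewrite leq_mul2l; apply/orP; right; apply: leq_mul; last first.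
    by move: KW R2W; clear; move: (W) => w; lia.
  by apply: leq_mul; lia.
have lX : (X <= nb * X)%N by rewrite leq_pmull.
have lY : (Y <= nb * Y)%N by rewrite leq_pmull.
rewrite -/X -/Y !(mulnDr s2) (mulnDr nb); rewrite mulnCA in t2.
move: t1 t2 t3 t4 t5 lX lY nnW nW hr n0; clear.
move: (nt.+1 * nb)%N (s2 * (nb * (4 * K).+1))%N => u3 u4.
move: (s2 * ((2 * f).+1 * (4 * K + R1).+1))%N => u5.
move: (s2 * ((4 * K).+1 * (4 * K).+1 * (R2 + 4 * K).+1))%N => u6.
move: (nb * X)%N (nb * Y)%N (n * W)%N => nX nY w.
by move: X Y => x y; lia.
Qed.

(** * The sketching matrix and its guarantees *)

Section Scheme.
Context {R : realType}.
Variables (p q H K Lam : nat) (tree : bool) (rho : R).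
Notation D := (2 ^ p)%N.
Notation n := (D ^ 2)%N.
Notation s := (2 ^ q)%N.
Notation N o := (size (nodes p q H o)).
Notation lev o v := (node p q H o v).1.
Notation pix o v := (node p q H o v).2.
Notation R1 := (hash_rows K Lam).
Notation R2 := (sign_rows K Lam).

(** [tree] switches between the two regimes; without parents every set is up-closed, so all sets of
    [4 * K] nodes have to be counted. *)
Definition parents o (u : 'I_(N o)) : option 'I_(N o) := if tree then par u else None.
Definition scale o v : R := (2 ^ lev o v)%:R.

Variables (hash phi : nat -> nat -> nat -> bool) (sgn : nat -> nat -> nat -> R).
Hypothesis dec : forall o, decodes K (minn (4 * K) (N o)) R1 R2 (@parents o) rho
  (hash o) (phi o) (sgn o).
Hypotheses (qH : (q + H <= p)%N) (K0 : (0 < K)%N) (L0 : (0 < Lam)%N) (rho0 : 0 <= rho).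

Definition tops : seq 'I_n := enum [pred j | rep H j == j].
Definition top t : 'I_n := nth (Ordinal (pix0_proof p)) tops t.
Definition width := (R1 + R2 + 2)%N.
Definition table_length := (5 + size tops + \sum_(o < s ^ 2) (2 + N o * width))%N.
Definition advice := (table_length %/ n).+1.

(** The stored sign columns carry the scale, so the least squares coefficients are masses rather
    than weights and can be written to the output directly. *)
Definition lay : @layout R := Layout advice (s ^ 2) R1 R2 (size tops)
  (fun o => N o) (fun o => minn (4 * K) (N o)) (fun t => top t) phi
  (fun o v r => scale o v * sgn o v r)
  (fun o v => pix o v) (fun o v => rep (lev o v).+1 (pix o v)).

Definition coef o v r : R :=
  (if (r < R1)%N then (hash o v r)%:R else sgn o v (r - R1)%N) * scale o v.

(* The first rows of the matrix carry no measurement: they store the table from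
   which the program learns the scheme. *)
Definition entry (i : nat) (j : 'I_n) : R :=
  if (i < advice)%N then nth 0 (table lay) (i * n + j)
  else if (i < advice + size tops)%N then (rep H j == top (i - advice))%:R
  else let t := (i - (advice + size tops))%N in
    \sum_(v < N (t %/ (R1 + R2))) coef (t %/ (R1 + R2)) v (t %% (R1 + R2)) *
      (rep (lev (t %/ (R1 + R2)) v) j == pix (t %/ (R1 + R2)) v)%:R.

Definition rows := (advice + size tops + s ^ 2 * (R1 + R2))%N.
Definition sketch : 'M[R]_(rows, n) := \matrix_(i < rows, j < n) entry i j.

Lemma n_gt0 : (0 < n)%N. Proof. by rewrite !expn_gt0. Qed.

Lemma sketch_table g : (g < size (table lay))%N -> dense sketch g = nth 0 (table lay) g.
Proof.
have -> : size (table lay) = table_length by rewrite size_table.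
move=> gT; have ga : (g %/ n < advice)%N.
  by rewrite /advice ltnS leq_div2r // ltnW.
have gm : (g %/ n < rows)%N by rewrite /rows -addnA ltn_addr.
have gn : (g %% n < n)%N by rewrite ltn_mod n_gt0.
have := denseE sketch (Ordinal gm) (Ordinal gn); rewrite /= -divn_eq => ->.
by rewrite mxE /entry /= ga -divn_eq.
Qed.

Lemma size_tops : (size tops <= 4 ^ (p - H))%N.
Proof.
rewrite /tops -cardE; have := @card_rep_in_class p 0 H 0.
rewrite addn0 subn0 => /(_ (leq_trans (leq_addl _ _) qH)); apply: leq_trans.
rewrite cardE [X in (_ <= X)%N]cardE; apply: eq_leq; congr size; apply: eq_enum => j.
by rewrite !inE /rep_in_class /cell_class expn0 !modn1 mul0n addn0 eqxx andbT.
Qed.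

Lemma nE : n = (4 ^ p)%N. Proof. by rewrite -expnM mulnC expnM. Qed.

Lemma s2E : (s ^ 2 = 4 ^ q)%N. Proof. by rewrite -expnM mulnC expnM. Qed.

Lemma sum_N : (\sum_(o < s ^ 2) N o <= 2 * n)%N.
Proof.
apply: leq_trans (_ : \sum_(o < s ^ 2) 2 * 4 ^ (p - q) <= _)%N.
  by apply: leq_sum => o _; exact: size_nodes.
by rewrite sum_nat_const card_ord mulnCA leq_mul2l /= nE s2E -expnD subnKC //; lia.
Qed.

Lemma s2_le : (s ^ 2 <= n)%N.
Proof. by rewrite leq_exp2r // leq_exp2l //; lia. Qed.

(** All classes together have at most [2 * n] nodes with [width] numbers each, and a row holds [n]
    numbers. *)
Lemma advice_le : (advice <= 2 * width + 9)%N.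
Proof.
have h1 := size_tops; have h2 := sum_N; have h3 := s2_le.
have h4 : (4 ^ (p - H) <= n)%N by rewrite nE leq_exp2l //; lia.
have le : (table_length <= (2 * width + 8) * n)%N.
  rewrite /table_length big_split /= sum_nat_const card_ord -big_distrl /=.
  have := leq_mul h2 (leqnn width); have := n_gt0.
  set X := (\sum_(_ < _) _)%N; move: (X * width)%N => Y n0 hY.
  have -> : ((2 * width + 8) * n = 2 * n * width + 8 * n)%N by ring.
  by move: hY n0 h1 h3 h4; set a := (2 * n * width)%N; lia.
by rewrite /advice addnS ltnS; have := leq_div2r n le; rewrite mulnK ?n_gt0.
Qed.

Lemma rows_le : (rows <= 4 ^ (p - H) + 12 * (4 ^ q * width))%N.
Proof.
have h1 := size_tops; have h2 := advice_le; have w2 : (2 <= width)%N by rewrite leq_addl.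
have q1 : (width <= 4 ^ q * width)%N by rewrite leq_pmull // expn_gt0.
have q2 : (s ^ 2 * (R1 + R2) <= 4 ^ q * width)%N by rewrite s2E leq_mul // /width leq_addr.
by rewrite /rows; move: h1 h2 q1 q2 w2; move: (4 ^ q * width)%N (s ^ 2 * _)%N => X Y; lia.
Qed.

Lemma lay_bounded : layout_bounded lay (rows + n + n).
Proof.
have ro : (R1 + R2 <= s ^ 2 * (R1 + R2))%N by rewrite leq_pmull // !expn_gt0.
have io (j : 'I_n) : (j <= rows + n + n)%N by have := ltn_ord j; lia.
split.
- split=> /=; rewrite ?/rows; try lia.
  have := s2_le; lia.
- by move=> t _; exact: (io (top t)).
move=> o oS; split=> /=; last by move=> v _; split; [exact: (io (pix o v)) | exact: (io (rep _ _))].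
  have := sum_N; rewrite (bigD1 (Ordinal oS)) //=; lia.
exact: geq_minr.
Qed.

(** A pixel lies in one cell per level, so it enters the rows of one class per level, besides the
    advice rows and one top row. *)
Lemma column_nz (j : 'I_n) :
  (#|[set i : 'I_rows | sketch i j != 0%R]| <= advice + 1 + H * (R1 + R2))%N.
Proof.
pose off := (advice + size tops)%N.
pose B l := [set i : 'I_rows | (off <= i)%N && ((i - off) %/ (R1 + R2) == cell_class s l j)%N].
have sub : [set i : 'I_rows | sketch i j != 0] \subset
    ([set i : 'I_rows | (i < advice)%N] :|:
     [set i : 'I_rows | [&& (advice <= i)%N, (i < off)%N & rep H j == top (i - advice)]]) :|:
    \bigcup_(l < H) B l.
  apply/subsetP => i; rewrite !inE mxE /entry -/off.
  case: ltnP => //= ai; case: ltnP => /= io.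
    by case: (rep H j == _); rewrite //= ?eqxx.
  set o := (_ %/ _)%N.
  case: (pickP (fun v : 'I_(N o) => rep (lev o v) j == pix o v)) => [v|none]; last first.
    by rewrite big1 ?eqxx // => v _; rewrite none mulr0.
  move=> /eqP rv _; apply/bigcupP; have [lH /andP[_ /eqP cv]] := nodeP v.
  exists (Ordinal lH) => //; rewrite inE io /= -/o -[X in X == _]cv -rv.
  by rewrite /cell_class cx_rep // cy_rep.
apply: leq_trans (subset_leq_card sub) _; rewrite cardsU; apply: leq_trans (leq_subr _ _) _.
apply: leq_add.
  rewrite cardsU; apply: leq_trans (leq_subr _ _) _; apply: leq_add.
    by apply: (@card_code _ _ (fun i => i < advice)%N id).
  apply: (@card_code _ _
    (fun i => [&& (advice <= i)%N, (i < off)%N & rep H j == top (i - advice)])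
    (fun=> 0%N)) => // i i'.
  rewrite !unfold_in => /and3P[ai io /eqP e] /and3P[ai' io' /eqP e'] _.
  have := etrans (esym e) e'; move/eqP; rewrite nth_uniq ?enum_uniq //; first lia.
    by rewrite ltn_subLR.
  by rewrite ltn_subLR.
apply: leq_trans (leq_card_bigcup _ _) _.
rewrite -[H in leqRHS]card_ord -sum_nat_const; apply: leq_sum => l _.
apply: (@card_code _ _
  (fun i => (off <= i)%N && ((i - off) %/ (R1 + R2) == cell_class s l j)%N)
  (fun i => ((i - off) %% (R1 + R2))%N)) => [i _|i i'].
  by rewrite ltn_mod addn_gt0 /hash_rows.
rewrite !unfold_in => /andP[io /eqP e] /andP[io' /eqP e'] em.
have : (i - off = i' - off)%N.
  by rewrite (divn_eq (i - off) (R1 + R2)) (divn_eq (i' - off) (R1 + R2)) e e' em.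
lia.
Qed.

Lemma size_nz : (size (nz_entries sketch) <= n * (advice + 1 + H * (R1 + R2)))%N.
Proof.
rewrite /nz_entries -sum1_size big_filter big_mkcond big_allpairs_dep /=.
rewrite big_enum /= -[n in leqRHS]card_ord -sum_nat_const; apply: leq_sum => j _.
rewrite big_enum /= -big_mkcond sum1dep_card; exact: column_nz.
Qed.

Variable x : 'cV[R]_n.
Hypothesis x0 : nonneg x.
Notation y := (cells (sketch *m x)).
Notation mu o v := (mass x (lev o v) (pix o v)).

Lemma y_top t : (t < size tops)%N -> y (advice + t)%N = mass x H (top t).
Proof.
move=> tN; have tr : (advice + t < rows)%N.
  by rewrite /rows -addnA ltn_add2l ltn_addr.
rewrite -[(advice + t)%N]/(val (Ordinal tr)) cells_mulmx /mass [RHS]big_mkcond.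
apply: eq_bigr => j _; rewrite mxE /entry /= ltnNge leq_addr /= ltn_add2l tN addKn.
by case: ifP; rewrite ?mul1r ?mul0r.
Qed.

Lemma y_class o r : (o < s ^ 2)%N -> (r < R1 + R2)%N ->
  y (y_addr lay o + r)%N = \sum_(v < N o) coef o v r * mu o v.
Proof.
move=> oS rR; have tr : (y_addr lay o + r < rows)%N.
  rewrite /y_addr /rows -addnA ltn_add2l /=.
  by have := leq_mul2r (R1 + R2) o.+1 (s ^ 2); rewrite oS orbT mulSn; lia.
rewrite -[(y_addr lay o + r)%N]/(val (Ordinal tr)) cells_mulmx.
have e j : sketch (Ordinal tr) j = \sum_(v < N o) coef o v r * (rep (lev o v) j == pix o v)%:R.
  rewrite mxE /entry /= /y_addr /= -!addnA ltnNge leq_addr /= ltnNge leq_add2l leq_addr /=.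
  rewrite addnA addKn divnMDl; last by lia.
  by rewrite divn_small // addn0 modnMDl modn_small.
under eq_bigr do rewrite e mulr_suml.
rewrite exchange_big; apply: eq_bigr => v _ /=.
rewrite /mass mulr_sumr [RHS]big_mkcond; apply: eq_bigr => j _.
by rewrite mulrAC; case: ifP => _; rewrite ?mulr1 ?mulr0 // ?mul0r.
Qed.

Lemma scale_gt0 o v : 0 < scale o v. Proof. by rewrite ltr0n expn_gt0. Qed.

Lemma y_ge0 : y_nonneg lay y.
Proof.
move=> o r /= oS rR; rewrite y_class //; last by rewrite ltn_addr.
apply: sumr_ge0 => v _; by rewrite mulr_ge0 ?mass_ge0 // /coef rR mulr_ge0 ?ler0n.
Qed.

Lemma top_out (g : 'I_n) : top_output lay y g = if rep H g == g then mass x H g else 0.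
Proof.
rewrite /top_output /=.
rewrite (eq_bigr (fun t : 'I_(size tops) => (g == top t :> nat)%:R * mass x H (top t))); last first.
  by move=> t _; rewrite y_top.
rewrite -(big_mkord xpredT (fun t => (g == top t :> nat)%:R * mass x H (top t))).
rewrite -(big_nth _ xpredT (fun j : 'I_n => (g == j :> nat)%:R * mass x H j)) /tops.
rewrite big_enum_cond /= [LHS]big_mkcond (bigD1 g) //= big1 ?addr0.
  by rewrite inE eqxx mul1r andbT.
move=> j jg; case: ifP => // _; rewrite (_ : (_ == _) = false) ?mul0r //.
by rewrite eq_sym; exact: negPf.
Qed.

Definition tail_sum (C : {set 'I_n}) : R := \sum_(l < H) \sum_(j | rep l j == j)
  (if is_head s l C j then 0 else (2 ^ l)%:R * mass x l j).

(** Image and output are sums of dipoles on the same pairs of pixels plus the same top cells, so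
    their difference is a sum of dipoles whose coefficients are the mass errors. In [1600 = 4 * 400]
    the 4 is the length of a dipole in cell sides. *)
Lemma output_error (sqs : nat -> seq nat) (cs : nat -> nat -> R) (out : 'cV[R]_n)
    (C : {set 'I_n}) :
  (9 * #|C| * H <= K)%N ->
  (forall o, (o < s ^ 2)%N -> class_solution lay y o (sqs o) (cs o)) ->
  (forall g : 'I_n, out g 0 = top_output lay y g +
     \sum_(o < s ^ 2) class_output lay o (sqs o) (cs o) g) ->
  emd_norm (x - out) <= 1600 * rho * tail_sum C.
Proof.
move=> CK sol eout.
pose muh o v := \sum_(l < minn (4 * K) (N o)) cs o l * (v == nth 0%N (sqs o) l :> nat)%:R.
have err o : (o < s ^ 2)%N ->
  \sum_(v < N o) scale o v * `|mu o v - muh o v| <=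
  400 * rho * \sum_(v < N o) (if is_head s (lev o v) C (pix o v) then 0 else scale o v * mu o v).
  move=> oS; have [E [est sel nrm]] := sol o oS.
  pose A := [set v : 'I_(N o) | is_head s (lev o v) C (pix o v)].
  have AK : (#|A| <= K)%N by apply: leq_trans CK; exact: card_head.
  have := @dec o (fun v => mu o v) (scale o) E (cs o)
    (fun r => y (y_addr lay o + r)%N) (fun r => y (y_addr lay o + R1 + r)%N) A (sqs o).
  rewrite (_ : \sum_(v | v \notin A) _ =
      \sum_(v < N o) (if is_head s (lev o v) C (pix o v) then 0 else scale o v * mu o v)).
    apply=> //.
    - by move=> v; exact: mass_ge0.
    - by move=> v; exact: scale_gt0.
    - move=> u v; rewrite /parents; case: (tree) => // uv; have e := par_some uv.
      rewrite /scale e /=; apply: ler_pM; rewrite ?ler0n ?mass_ge0 //.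
        by rewrite ler_nat leq_exp2l.
      exact: mass_parent.
    - move=> r rR; rewrite y_class //; last by rewrite ltn_addr.
      by apply: eq_bigr => v _; rewrite /coef rR mulrA.
    - move=> r rR; rewrite -addnA y_class ?ltn_add2l //.
      by apply: eq_bigr => v _; rewrite /coef ltnNge leq_addr /= addKn mulrA.
    rewrite big_mkcond; apply: eq_bigr => v _; rewrite inE.
    by case: is_head.
pose I := {o : 'I_(s ^ 2) & 'I_(N o)}.
pose cI (i : I) : R := mu (tag i) (tagged i) - muh (tag i) (tagged i).
apply: le_trans (emd_norm_dipoles (c := cI)
  (p := fun i : I => pix (tag i) (tagged i))
  (q := fun i : I => rep (lev (tag i) (tagged i)).+1 (pix (tag i) (tagged i))) _) _.
  move=> g.
  rewrite -(sig_big_dep xpredT (fun o => xpredT) (fun (o : 'I_(s ^ 2)) (v : 'I_(N o)) =>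
    (mu o v - muh o v) * ((g == pix o v)%:R - (g == rep (lev o v).+1 (pix o v))%:R))) /=.
  rewrite !mxE eout top_out (telescope_mass H x g) opprD addrACA subrr add0r.
  pose F z := mass x z.1 z.2 * ((g == z.2)%:R - (g == rep z.1.+1 z.2)%:R).
  rewrite (_ : \sum_(l < H) _ = \sum_(o < s ^ 2) \sum_(z <- nodes p q H o) F z); last first.
    by rewrite sum_all_nodes.
  rewrite -sumrB; apply: eq_bigr => o _.
  rewrite -(@sum_nodes_nth p q H _ o (0%N, Ordinal (pix0_proof p))) /class_output /=.
  have [_ [_ [sqs_size _ sqN _] _]] := sol o (ltn_ord o).
  rewrite (_ : \sum_(i < minn _ _) _ = \sum_(v < N o) muh o v *
      ((g == pix o v)%:R - (g == rep (lev o v).+1 (pix o v))%:R)).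
    by rewrite -sumrB; apply: eq_bigr => v _; rewrite mulrBl.
  under [RHS]eq_bigr do rewrite /muh mulr_suml.
  rewrite exchange_big; apply: eq_bigr => l _ /=.
  have lN : (nth 0%N (sqs o) l < N o)%N by apply: sqN; rewrite mem_nth // sqs_size.
  rewrite (bigD1 (Ordinal lN)) //= eqxx mulr1 big1 ?addr0 // => v vl.
  rewrite (_ : (_ == _) = false) ?mulr0 ?mul0r //.
  by apply: contraNF vl => /eqP e; apply/eqP/val_inj.
rewrite -(sig_big_dep xpredT (fun o => xpredT) (fun (o : 'I_(s ^ 2)) (v : 'I_(N o)) =>
    `|mu o v - muh o v| * (pixel_dist (pix o v) (rep (lev o v).+1 (pix o v)))%:R)) /=.
pose F z := if is_head s z.1 C z.2 then 0 else (2 ^ z.1)%:R * mass x z.1 z.2.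
rewrite /tail_sum (_ : \sum_(l < H) _ = \sum_(o < s ^ 2) \sum_(z <- nodes p q H o) F z); last first.
  by rewrite sum_all_nodes.
rewrite mulr_sumr; apply: ler_sum => o _.
have -> : 1600 * rho = 4 * (400 * rho) by ring.
rewrite -mulrA -(@sum_nodes_nth p q H _ o (0%N, Ordinal (pix0_proof p))).
apply: le_trans (ler_wpM2l _ (err o (ltn_ord o))) => //.
rewrite mulr_sumr; apply: ler_sum => v _.
rewrite [leRHS]mulrA [leRHS]mulrC ler_wpM2l // /scale -natrM ler_nat.
exact: rep_step_dist.
Qed.

Lemma width_ge : (4 * K < width)%N.
Proof.
rewrite /width /sign_rows; have : (4 * K <= 64 * ((Lam + 300) * (4 * K)))%N.
  by rewrite mulnA leq_pmull // muln_gt0 addn_gt0 L0.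
by lia.
Qed.

Lemma rows_le_width : (rows + n + n <= 15 * (n * width))%N.
Proof.
have h1 := rows_le; have w1 : (0 < width)%N by rewrite addn_gt0 orbT.
have h2 : (4 ^ (p - H) <= n)%N by rewrite nE leq_exp2l //; lia.
have h3 : (4 ^ q * width <= n * width)%N by rewrite leq_mul2r -s2E s2_le orbT.
have h4 : (n <= n * width)%N by rewrite leq_pmulr.
by move: h1 h2 h3 h4; set a := (4 ^ q * width)%N; set b := (n * width)%N; lia.
Qed.

Lemma time_le nb : (0 < nb)%N ->
  (n + rows + size (nz_entries sketch) + (size tops).+1 * nb +
     s ^ 2 * (nb * (4 * K).+1 + (2 * 4 ^ (p - q)).+1 * (4 * K + R1).+1 +
       (4 * K).+1 * (4 * K).+1 * (R2 + 4 * K).+1) + 1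
   <= 50 * (nb * (n * H.+1 * width + 4 ^ q * K ^ 2 * width)))%N.
Proof.
move=> nb0; rewrite -s2E; apply: (time_arith (a := advice) (f := (4 ^ (p - q))%N)) => //.
- exact: n_gt0.
- exact: width_ge.
- by apply: leq_trans rows_le_width; rewrite -addnA leq_addr.
- exact: size_nz.
- exact: advice_le.
- by apply: leq_trans size_tops _; rewrite nE leq_exp2l //; lia.
- exact: s2_le.
- by rewrite s2E -expnD subnKC ?nE //; lia.
Qed.

Lemma scheme_exec k eps : exists t st,
  [/\ exec recovery (ram_input k eps sketch (sketch *m x)) t st,
     (t <= 100 * 100 * (50 * ((trunc_log 2 (15 * (n * width))).+2 *
        (n * H.+1 * width + 4 ^ q * K ^ 2 * width))))%N &
     forall C : {set 'I_n}, (9 * #|C| * H <= K)%N ->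
       emd_norm (x - ram_output n st) <= 1600 * rho * tail_sum C].
Proof.
have D0 : (0 < D)%N by rewrite expn_gt0.
have tab : forall g, (g < size (table lay))%N -> dense sketch g = nth 0 (table lay) g.
  exact: sketch_table.
have bnd o : (o < s ^ 2)%N -> (N o <= 2 * 4 ^ (p - q))%N /\ (minn (4 * K) (N o) <= 4 * K)%N.
  by move=> _; rewrite size_nodes // geq_minl.
have [t [st [ex tle [sqs [cs [sol out]]]]]] := run_recovery k eps D0 lay_bounded y_ge0
  (isT : (0 < ly_R1 lay)%N) bnd (table_header tab) (table_top tab)
  (fun o => table_class tab (o := o)).
exists t, st; split; first exact: ex.
  apply: leq_trans tle _; rewrite leq_mul2l; apply/orP; right.
  apply: leq_trans (time_le (isT : 0 < _.+1)%N) _.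
  rewrite leq_mul2l leq_mul2r !ltnS; apply/orP; right; apply/orP; right.
  by apply: leq_trunc_log; exact: rows_le_width.
move=> C CK; apply: (output_error CK sol) => g.
by rewrite mxE out.
Qed.

End Scheme.

Lemma scheme_exists {R : realType} p q H K Lam B (tree : bool) (rho : R) :
  (q + H <= p)%N -> (0 < K)%N -> (0 < Lam)%N -> (2 * 4 ^ (p - q) <= K * 2 ^ B)%N ->
  (forall o, (4 * K <= size (nodes p q H o))%N ->
     #|[set X : {set 'I_(size (nodes p q H o))} |
         upclosed (@parents p q H tree o) X & #|X| == 4 * K]|%:R <= expR (Lam * (4 * K))%:R :> R) ->
  0 <= rho -> 1 + B%:R / Lam%:R <= rho ^+ 2 ->
  let n := ((2 ^ p) ^ 2)%N in let W := width K Lam in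
  exists m (A : 'M[R]_(m, n)), (m <= 4 ^ (p - H) + 12 * (4 ^ q * W))%N /\
  forall k eps x, nonneg x -> exists t st,
  [/\ exec recovery (ram_input k eps A (A *m x)) t st,
     (t <= 100 * 100 * (50 * ((trunc_log 2 (15 * (n * W))).+2 *
        (n * H.+1 * W + 4 ^ q * K ^ 2 * W))))%N &
     forall C : {set 'I_n}, (9 * #|C| * H <= K)%N ->
       emd_norm (x - ram_output n st) <= 1600 * rho * tail_sum q H x C].
Proof.
move=> qH K0 L0 NK cnt rho0 hrho n W.
pose P o (f : (nat -> nat -> bool) * (nat -> nat -> bool) * (nat -> nat -> R)) :=
  decodes K (minn (4 * K) (size (nodes p q H o)))
    (hash_rows K Lam) (sign_rows K Lam) (@parents p q H tree o) rho f.1.1 f.1.2 f.2.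
have [f hf] : {f & forall o, P o (f o)}.
  apply: choice => o.
  have NKo := leq_trans (size_nodes o qH) NK.
  have par_ltn (u v : 'I_(size (nodes p q H o))) : parents tree u = Some v -> (v < u)%N.
    by rewrite /parents; case: (tree) => //; exact: par_lt.
  have [hash [phi [sgn h]]] := class_scheme K0 L0 NKo par_ltn (cnt o) rho0 hrho.
  by exists (hash, phi, sgn).
exists _, (@sketch R p q H K Lam (fun o => (f o).1.1) (fun o => (f o).1.2) (fun o => (f o).2)).
split; first exact: (@rows_le R).
move=> k eps x x0; exact: (scheme_exec hf qH K0 L0 rho0 x0 k eps).
Qed.

(** * Choice of the parameters *)

Section Calibration.
Context {R : realType}.
Implicit Types (p q k H b e Lam : nat) (eps : R).

Lemma half_le_ln2 : 2^-1 <= ln 2 :> R.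
Proof.
have h : ln (2^-1) <= 2^-1 - 1 :> R.
  by rewrite -{1}[2^-1 : R](subrKC 1) addrC -{1}[2^-1 - 1 + 1 : R]addrC le_ln1Dx //; lra.
by move: h; rewrite lnV ?posrE // => h; lra.
Qed.

(** [b] and [p] are integer stand-ins for log (n / k) and log n. By [2 * k < n] the truncated
    logarithm is at least 1, so rounding up costs a factor 2; the other 2 comes from
    [ln 2 >= 1 / 2]. *)
Lemma log_params p k : let n := ((2 ^ p) ^ 2)%N in (0 < k)%N -> (2 * k < n)%N ->
  exists b, [/\ (0 < b)%N, (n < k * 2 ^ b)%N, (b <= 3 * p)%N,
    b%:R <= 4 * ln (n%:R / k%:R) :> R & p%:R <= ln n%:R :> R].
Proof.
move=> n k0 kn; have n0 : (0 < n)%N by lia.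
have p0 : (0 < p)%N by rewrite /n in kn *; case: (p) kn => //=; lia.
have d2 : (2 <= n %/ k)%N by rewrite leq_divRL //; lia.
pose c := trunc_log 2 (n %/ k).
have c1 : (0 < c)%N by rewrite trunc_log_gt0.
have cle : (2 ^ c <= n %/ k)%N by apply: trunc_logP => //; lia.
have kc : (2 ^ c * k <= n)%N by rewrite -leq_divRL.
have nE : n = (2 ^ (2 * p))%N by rewrite /n -expnM mulnC.
have cp : (c <= 2 * p)%N.
  rewrite -(leq_exp2l (m := 2)) // -nE; apply: leq_trans kc; exact: leq_pmulr.
have l2 := half_le_ln2.
have lnX m : ln ((2 ^ m)%N%:R) = m%:R * ln 2 :> R.
  by rewrite natrX lnXn // mulr_natl.
exists c.+1; split=> //.
- by rewrite mulnC -ltn_divLR //; exact: trunc_log_ltn.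
- lia.
- have kR : 0 < k%:R :> R by rewrite ltr0n.
  have h : c%:R * ln 2 <= ln (n%:R / k%:R) :> R.
    rewrite -lnX ler_ln ?posrE ?ltr0n ?expn_gt0 ?divr_gt0 ?ltr0n //.
    by rewrite ler_pdivlMr // -natrM ler_nat.
  have c1R : 1 <= c%:R :> R by rewrite ler1n.
  by rewrite -natr1; nra.
by rewrite nE lnX natrM; have := ler0n R p; nra.
Qed.

Lemma precision_params eps : 0 < eps -> eps <= 1 ->
  exists e, [/\ (0 < e)%N, eps ^- 2 <= e%:R & e%:R <= 2 * eps ^- 2].
Proof.
move=> e0 e1; have h1 : 1 <= eps ^- 2.
  by rewrite invf_ge1 ?exprn_gt0 // expr_le1 // ltW.
have h0 : 0 <= eps ^- 2 by lra.
have /andP[t1 t2] := truncn_itv h0.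
by exists (Num.truncn (eps ^- 2)).+1; split=> //; [exact: ltW|rewrite -natr1; lra].
Qed.

(** [H] is the least level with at most [4 ^ q * k] cells, few enough to be measured exactly. Level
    [b] qualifies, whence [H <= b]; the last clause holds because level [H - 1] has too many
    cells. *)
Lemma level_params p k q b : (0 < k)%N -> ((2 ^ p) ^ 2 < k * 2 ^ b)%N ->
  exists H, [/\ (H <= b)%N, (H <= p)%N, (4 ^ (p - H) <= 4 ^ q * k)%N &
    (0 < H)%N -> (q + H <= p)%N /\ (4 ^ q * k <= 4 ^ p)%N].
Proof.
move=> k0 nb; pose P h := (4 ^ (p - h) <= 4 ^ q * k)%N.
have q1 : (1 <= 4 ^ q)%N by rewrite expn_gt0.
have Pp : P p by rewrite /P subnn muln_gt0 k0 q1.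
have Pb : P b.
  have [pb|bp] := leqP p b; first by rewrite /P (eqP pb) muln_gt0 k0 q1.
  apply: leq_trans (leq_pmull k q1); rewrite -(leq_pmul2r (_ : 0 < 4 ^ b)%N) ?expn_gt0 //.
  rewrite -expnD subnK; last exact: ltnW.
  have -> : (4 ^ p = (2 ^ p) ^ 2)%N by rewrite -expnM mulnC expnM.
  apply: leq_trans (ltnW nb) _; rewrite leq_mul2l; apply/orP; right.
  by rewrite -[4%N]/(2 * 2)%N expnMn leq_pmull ?expn_gt0.
case: (ex_minnP (ex_intro P p Pp)) => H PH min.
exists H; split=> //; [exact: min|exact: min|].
move=> H0; have Hp := min p Pp.
have : ~~ P H.-1 by apply/negP => /min; lia.
rewrite /P -ltnNge (_ : (p - H.-1 = (p - H).+1)%N) => [lt|]; last by lia.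
have lt2 : (4 ^ q < 4 ^ (p - H).+1)%N by apply: leq_ltn_trans lt; exact: leq_pmulr.
split; first by move: lt2; rewrite ltn_exp2l //; lia.
by apply: leq_trans (ltnW lt) _; rewrite leq_exp2l //; lia.
Qed.

Lemma count_all N K b : (0 < K)%N -> (N <= K * 2 ^ b)%N ->
  #|[set X : {set 'I_N} | upclosed (fun _ : 'I_N => None) X & #|X| == 4 * K]|%:R
     <= expR (b.+1 * (4 * K))%:R :> R.
Proof.
move=> K0 NK; have V : (#|'I_N| <= 2 * K * 2 ^ b)%N.
  by rewrite card_ord (leq_trans NK) // leq_mul2r leq_pmull ?orbT.
have h := @card_small_sets R _ (2 * K) b V.
apply: le_trans (le_trans _ h) _; last by rewrite ler_expR ler_nat; nia.
rewrite ler_nat; apply: subset_leq_card; apply/subsetP => X; rewrite !inE.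
by case/andP => _ /eqP ->; rewrite mulnA.
Qed.

(** At most [4 * K] roots, and [4 * K] picked nodes with four children each, give at most
    [2 ^ (20 * K)] closed sets; [20 = 5 * 4] explains [5 <= Lam]. *)
Lemma count_forest p H k K Lam o : (0 < k)%N -> (k <= K)%N -> (5 <= Lam)%N -> (0 < H <= p)%N ->
  (4 ^ (p - H) <= k)%N ->
  #|[set X : {set 'I_(size (nodes p 0 H o))} | upclosed (@par p 0 H o) X & #|X| == 4 * K]|%:R
     <= expR (Lam * (4 * K))%:R :> R.
Proof.
move=> k0 kK L5 Hp hk.
have roots := card_roots o (erefl 0%N) Hp.
have cnt := card_upclosed (4 * K) (@par_lt p 0 H o) roots (@card_children p 0 H o).
apply: (@le_trans _ _ ((2 ^ (20 * K))%N%:R)).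
  rewrite ler_nat; apply: leq_trans cnt _; rewrite leq_exp2l // expnS; lia.
apply: (@le_trans _ _ (expR (20 * K)%:R)); last first.
  by rewrite ler_expR ler_nat mulnA leq_mul2r; apply/orP; right; lia.
rewrite natrX -[X in expR X]mulr1 expRM_natl.
by apply: lerXn2r; rewrite ?nnegrE ?expR_ge0 //; apply: le_trans (expR_ge1Dx _); lra.
Qed.

Lemma width_le K Lam : (0 < K)%N -> (0 < Lam)%N ->
  (width K Lam <= 100 * (1000 * (Lam * K)))%N.
Proof.
move=> K0 L0; rewrite /width /hash_rows /sign_rows.
have : (K <= Lam * K)%N by rewrite leq_pmull.
have -> : (3 * (10 * Lam * (4 * K)) = 120 * (Lam * K))%N by ring.
have -> : (64 * ((Lam + 300) * (4 * K)) = 256 * (Lam * K) + 256 * (300 * K))%N by ring.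
by move: (Lam * K)%N => X; lia.
Qed.

Lemma rows_bound m p q k H b e Lam : let K := (9 * k * H.+1)%N in
  (0 < k)%N -> (0 < Lam)%N -> (H <= b)%N -> (0 < b)%N ->
  (4 ^ (p - H) <= e * k)%N -> (4 ^ q * Lam <= 10 * e)%N ->
  (m <= 4 ^ (p - H) + 12 * (4 ^ q * width K Lam))%N ->
  (m <= 1000 * (1000 * (300 * (e * k * b))))%N.
Proof.
move=> K k0 L0 Hb b0 h1 h2 hm; have K0 : (0 < K)%N by rewrite !muln_gt0 k0.
have w1 := width_le K0 L0.
have h3 : (4 ^ q * (Lam * K) <= 180 * (e * k * b))%N.
  rewrite mulnA; apply: leq_trans (leq_mul h2 (leqnn K)) _.
  have -> : (180 * (e * k * b) = 10 * e * (9 * k * (2 * b)))%N by ring.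
  by rewrite leq_mul2l /K leq_mul2l; apply/orP; right; apply/orP; right; lia.
have h4 : (4 ^ q * width K Lam <= 100 * (1000 * (4 ^ q * (Lam * K))))%N.
  have -> : (100 * (1000 * (4 ^ q * (Lam * K))) = 4 ^ q * (100 * (1000 * (Lam * K))))%N by ring.
  by rewrite leq_mul2l w1 orbT.
have h5 : (e * k <= e * k * b)%N by rewrite leq_pmulr.
move: hm h1 h3 h4 h5; clear; set a := (4 ^ q * _)%N; set c := (4 ^ q * _)%N.
by move: a c (4 ^ _)%N (e * k * b)%N (e * k)%N => a c d f g; lia.
Qed.

(** Five factors [p]: one from the number of binary digits, two from [W = O (k * p ^ 2)], two from
    the work per row, [O (n * k * p ^ 2)]. *)
Lemma time_bound : exists CT : nat, forall p q k H b Lam,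
  let n := ((2 ^ p) ^ 2)%N in let K := (9 * k * H.+1)%N in let W := width K Lam in
  (0 < k)%N -> (0 < p)%N -> (k <= n)%N -> (0 < Lam)%N -> (Lam <= 10 * b)%N ->
  (H <= b)%N -> (b <= 3 * p)%N -> (4 ^ q * k <= n)%N ->
  ((trunc_log 2 (15 * (n * W))).+2 * (n * H.+1 * W + 4 ^ q * K ^ 2 * W) <=
     CT * (k ^ 2 * n * p ^ 5))%N.
Proof.
(* The constant is hidden behind its two properties, since a natural of this size is unary and must
   not be computed. *)
have [c [c32 cE]] : exists c, (15 * c <= 2 ^ 32)%N /\ forall a b,
    (100 * (1000 * (30 * a * (36 * b))) = c * (a * b))%N.
  exists (100 * (1000 * 1080))%N; split; last by move=> a b; ring.
  have e32 : (32 = 4 + (7 + (10 + 11)))%N by [].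
  rewrite e32 !expnD.
  exact: (leq_mul (isT : (15 <= 2 ^ 4)%N) (leq_mul (isT : (100 <= 2 ^ 7)%N)
    (leq_mul (isT : (1000 <= 2 ^ 10)%N) (isT : (1080 <= 2 ^ 11)%N)))).
exists (40 * (1300 * c))%N => p q k H b Lam n K W k0 p0 kn L0 Lb Hb bp qn.
have K0 : (0 < K)%N by rewrite !muln_gt0 k0.
have Kle : (K <= 36 * (k * p))%N.
  have -> : (36 * (k * p) = 9 * k * (4 * p))%N by ring.
  by rewrite leq_mul2l; apply/orP; right; lia.
have Lle : (Lam <= 30 * p)%N by lia.
have Wle : (W <= c * (k * p ^ 2))%N.
  apply: leq_trans (width_le K0 L0) _.
  have -> : (c * (k * p ^ 2) = 100 * (1000 * (30 * p * (36 * (k * p)))))%N.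
    by rewrite cE -mulnn (mulnCA k).
  exact: (leq_mul (leqnn _) (leq_mul (leqnn _) (leq_mul Lle Kle))).
have tl : (trunc_log 2 (15 * (n * W)) <= 38 * p)%N.
  rewrite -[(38 * p)%N](trunc_expnK (p := 2)) //; apply: leq_trunc_log.
  have pn : (p ^ 2 <= n)%N by rewrite leq_exp2r //; apply: ltnW; exact: ltn_expl.
  apply: leq_trans (_ : 15 * c * (n * (n * n)) <= _)%N.
    rewrite -mulnA leq_mul2l; apply/orP; right.
    rewrite mulnCA leq_mul2l; apply/orP; right.
    by apply: leq_trans Wle _; rewrite leq_mul2l leq_mul ?orbT.
  apply: leq_trans (leq_mul c32 (leqnn _)) _.
  have -> : n = (2 ^ (2 * p))%N by rewrite /n -expnM mulnC.
  by rewrite -!expnD leq_exp2l //; lia.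
have sum : (n * H.+1 * W + 4 ^ q * K ^ 2 * W <= 1300 * (n * k * p ^ 2) * W)%N.
  rewrite -mulnDl leq_mul2r; apply/orP; right.
  have h1 : (n * H.+1 <= 4 * (n * k * p ^ 2))%N.
    have -> : (4 * (n * k * p ^ 2) = n * (4 * p * (k * p)))%N by rewrite -mulnn; ring.
    rewrite leq_mul2l; apply/orP; right; apply: leq_trans (_ : 4 * p <= _)%N; first by lia.
    by rewrite leq_pmulr // muln_gt0 k0.
  have h2 : (4 ^ q * K ^ 2 <= 36 * (36 * (n * k * p ^ 2)))%N.
    have -> : (36 * (36 * (n * k * p ^ 2)) = (n * k) * (36 * p * (36 * p)))%N.
      by rewrite -mulnn; ring.
    apply: leq_trans (_ : 4 ^ q * (36 * (k * p) * (36 * (k * p))) <= _)%N.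
      by rewrite leq_mul2l -mulnn leq_mul ?orbT.
    have -> : (4 ^ q * (36 * (k * p) * (36 * (k * p))) =
       (4 ^ q * k) * k * (36 * p * (36 * p)))%N by ring.
    by rewrite leq_mul2r leq_mul2r qn !orbT.
  by move: h1 h2; clear; set a := (n * H.+1)%N; set c := (4 ^ q * _)%N;
    set d := (n * k * _)%N; move: a c d => a c d; lia.
apply: leq_trans (leq_mul (_ : _ <= 40 * p)%N sum) _; first by lia.
apply: leq_trans (leq_mul (leqnn _) (leq_mul (leqnn _) Wle)) _.
apply: eq_leq.
have -> : (p ^ 5 = p * (p ^ 2 * p ^ 2))%N by rewrite -expnD -expnS.
by rewrite -[(k ^ 2)%N]mulnn; move: (p ^ 2)%N => P2; ring.
Qed.

(** The decoding loss [rho] may be as large as [s * eps * sqrt b], because the tail gains back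
    [1 / s]. For [H = 0] all pixels are measured exactly and the tail is empty; [rho] is then just a
    value acceptable to the decoder. *)
Lemma scheme_params p k b e eps : let n := ((2 ^ p) ^ 2)%N in
  0 < eps -> (0 < k)%N -> (k <= n)%N -> (0 < b)%N -> (n < k * 2 ^ b)%N -> (0 < e)%N ->
  eps ^- 2 <= e%:R ->
  exists q H Lam (tree : bool) (rho : R), let K := (9 * k * H.+1)%N in
  [/\ [/\ (q + H <= p)%N, (H <= b)%N, (4 ^ (p - H) <= e * k)%N & (4 ^ q * k <= n)%N],
      [/\ (0 < Lam)%N, (4 ^ q * Lam <= 10 * e)%N & (Lam <= 10 * b)%N],
      [/\ 0 <= rho, 1 + b%:R / Lam%:R <= rho ^+ 2 &
         (0 < H)%N -> rho <= 3 * (2 ^ q)%N%:R * eps * Num.sqrt b%:R] &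
      forall o, (4 * K <= size (nodes p q H o))%N ->
     #|[set X : {set 'I_(size (nodes p q H o))} |
         upclosed (@parents p q H tree o) X & #|X| == 4 * K]|%:R <= expR (Lam * (4 * K))%:R :> R].
Proof.
move=> n eps0 k0 kn b0 nb e0 he.
have nE4 : n = (4 ^ p)%N by rewrite /n -expnM mulnC expnM.
have x0 : 0 < eps ^+ 2 by rewrite exprn_gt0.
have ex1 : 1 <= e%:R * eps ^+ 2.
  by move: he; rewrite -[eps ^- 2]mul1r ler_pdivrMr.
have bR : 0 < b%:R :> R by rewrite ltr0n.
have eR : 0 < e%:R :> R by rewrite ltr0n.
have sqrho q : (3 * (2 ^ q)%N%:R * eps * Num.sqrt b%:R) ^+ 2 =
    9 * (4 ^ q * b)%N%:R * eps ^+ 2 :> R.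
  have e4 : (2 ^ q)%N%:R ^+ 2 = (4 ^ q)%N%:R :> R by rewrite -natrX -expnM mulnC expnM.
  rewrite !exprMn sqr_sqrtr ?ler0n // natrM e4; move: (4 ^ q)%N%:R => t; ring.
have rho_ge0 q : 0 <= 3 * (2 ^ q)%N%:R * eps * Num.sqrt b%:R :> R.
  by rewrite mulr_ge0 ?sqrtr_ge0 // mulr_ge0 ?(ltW eps0) // mulr_ge0 ?ler0n.
have rho1 Lam : (0 < Lam)%N -> 0 <= 1 + b%:R / Lam%:R :> R /\
    1 + b%:R / Lam%:R <= (1 + b%:R / Lam%:R) ^+ 2 :> R.
  move=> L0; have h : 0 <= (b%:R / Lam%:R : R) by rewrite divr_ge0 ?ler0n.
  split; first by lra.
  by nra.
have [be|eb] := leqP b e; last first.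
  (* few measurements: a single class, and supports closed under ancestors *)
  have [H [Hb Hp hk hH]] := level_params 0 k0 nb; rewrite mul1n in hk hH.
  have L0 : (0 < 5 * e)%N by rewrite muln_gt0 e0.
  exists 0%N, H, (5 * e)%N, true,
    (if H == 0%N then 1 + b%:R / (5 * e)%N%:R else 3 * (2 ^ 0)%N%:R * eps * Num.sqrt b%:R).
  split; first by split=> //; [apply: leq_trans hk _; rewrite leq_pmull|rewrite mul1n].
  - by split=> //; lia.
  - case: eqP => [H0|_]; first by have [r1 r2] := rho1 _ L0; split=> //; rewrite H0.
    split=> //; rewrite sqrho mul1n natrM.
    have h : 1 <= b%:R / e%:R :> R by rewrite ler_pdivlMr // mul1r ler_nat ltnW.
    have h2 : b%:R / e%:R <= b%:R * eps ^+ 2 by rewrite ler_pdivrMr //; nra.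
    have -> : b%:R / (5 * e%:R) = (b%:R / e%:R) / 5 :> R by field; rewrite gt_eqF.
    by lra.
  move=> o sz; have H0 : (0 < H)%N.
    case: H sz {Hb Hp hk hH} => // sz.
    have := size_nodes (p := p) (q := 0) (H := 0) o (leq0n p).
    move: sz; rewrite -[size _]sum1_size sum_nodes big_ord0; lia.
  apply: (count_forest (k := k)) => //; try lia.
(* [s ^ 2] is the largest power of 4 with [s ^ 2 * b <= e], so [e < 4 * s ^ 2 * b]. The 9 in the
   square of [rho] absorbs this 4 and the bound [1 + b / (b + 1) <= 2]. *)
pose q0 := trunc_log 4 (e %/ b).
have eb0 : (0 < e %/ b)%N by rewrite divn_gt0.
have q0le : (4 ^ q0 * b <= e)%N by rewrite -leq_divRL //; exact: trunc_logP.
have q0gt : (e < 4 * (4 ^ q0 * b))%N.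
  by rewrite mulnA -expnS -ltn_divLR //; exact: trunc_log_ltn.
have [H [Hb Hp hk hH]] := level_params q0 k0 nb.
have q0e : (4 ^ q0 <= e)%N by apply: leq_trans q0le; exact: leq_pmulr.
(* For [H = 0], [level_params] puts no bound on [q0], and a single class is taken. *)
pose q := if H == 0%N then 0%N else q0.
have qq0 : (4 ^ q <= 4 ^ q0)%N by rewrite /q; case: ifP => // _; rewrite expn_gt0.
exists q, H, b.+1, false,
  (if H == 0%N then 1 + b%:R / b.+1%:R else 3 * (2 ^ q)%N%:R * eps * Num.sqrt b%:R).
have qb : (4 ^ q * b <= e)%N by apply: leq_trans q0le; rewrite leq_mul2r qq0 orbT.
have q4 : (4 ^ q <= e)%N by exact: leq_trans qq0 q0e.
have qHp : (q + H <= p)%N /\ (4 ^ q * k <= n)%N.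
  rewrite /q; case: eqP => [->|/eqP]; first by rewrite mul1n.
  by rewrite -lt0n nE4 => /hH.
split.
- split; [exact: qHp.1|by []| |exact: qHp.2].
  by apply: leq_trans hk _; rewrite leq_mul2r q0e orbT.
- by split=> //; [rewrite mulnS; lia|lia].
- rewrite /q; case: eqP => [H0|_].
    by have [r1 r2] := rho1 b.+1 isT; split=> //; rewrite H0.
  split=> //; rewrite sqrho.
  have h1 : b%:R / b.+1%:R <= 1 :> R by rewrite ler_pdivrMr ?ltr0n // mul1r ler_nat.
  have h2 : e%:R <= 4 * (4 ^ q0 * b)%N%:R :> R by rewrite -natrM ler_nat ltnW.
  have h3 : e%:R * eps ^+ 2 <= 4 * (4 ^ q0 * b)%N%:R * eps ^+ 2 by rewrite ler_pM2r.
  apply: le_trans (_ : 1 + 1 <= _); first by rewrite lerD2l.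
  move: h3 ex1; move: (4 ^ q0 * b)%N%:R (eps ^+ 2) (e%:R : R) => t x u h3 ex1; lra.
move=> o _; apply: count_all; first by rewrite !muln_gt0 k0.
apply: leq_trans (size_nodes o qHp.1) _.
apply: leq_trans (_ : 9 * k * 2 ^ b <= _)%N; last first.
  by rewrite leq_mul2r leq_pmulr ?orbT.
have : (4 ^ (p - q) <= n)%N by rewrite nE4 leq_exp2l // leq_subr.
by move: nb; rewrite -mulnA; move: (k * 2 ^ b)%N => X; lia.
Qed.

End Calibration.

(** A zero image has empty support; an arbitrary pixel replaces it, because every pixel needs a
    nearest point in [C]. *)
Lemma sparse_support {R : realType} p k (x' : 'cV[R]_((2 ^ p) ^ 2)) : (0 < k)%N -> sparse k x' ->
  exists C : {set 'I_((2 ^ p) ^ 2)},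
    [/\ (0 < #|C|)%N, (#|C| <= k)%N & forall i, i \notin C -> x' i 0 = 0].
Proof.
move=> k0 sp; pose C := [set i | x' i 0 != 0]%SET.
have [C0|C0] := posnP #|C|.
  exists [set Ordinal (pix0_proof p)]%SET; rewrite cards1; split=> // i _.
  by apply/eqP; rewrite -[_ == _]negbK; move/eqP: C0; rewrite cards_eq0 => /eqP/setP/(_ i);
    rewrite !inE => ->.
by exists C; split=> // i; rewrite inE negbK => /eqP.
Qed.

Theorem theorem5p2 (R : realType) :
  exists (P : cmd) (cm cC cT : R) (c : nat),
  forall (p k : nat) (eps : R),
    let D := (2 ^ p)%N in
    let n := (D ^ 2)%N in
    0 < eps -> eps <= 1 -> (0 < k)%N -> (2 * k < n)%N ->
    exists (m : nat) (A : 'M[R]_(m, n)),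
      m%:R <= cm * (eps ^- 2 * k%:R * ln (n%:R / k%:R)) /\
      forall x : 'cV[R]_n, nonneg x ->
        exists (t : nat) (s : state),
          [/\ exec P (ram_input k eps A (A *m x)) t s,
              t%:R <= cT * (k%:R ^+ 2 * n%:R * ln n%:R ^+ c)
            & emd_norm (x - ram_output n s) <=
                cC * (eps * Num.sqrt (ln (n%:R / k%:R))) * emd_sparse_err k x].
Proof.
have [CT hCT] := time_bound.
(* [8 = 2 * 4] from [e <= 2 * eps ^- 2] and [b <= 4 * L]. [100 * 192 = 1600 * 3 * 2 * 2]: the
   decoding error, the bound on [rho], [sqrt b <= 2 * sqrt L], and the 2 of the tail bound. *)
exists recovery, (8 * (1000 * (1000 * 300))), (100 * 192), ((100 * 100) * (50 * CT%:R)), 5%N.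
move=> p k eps D n eps0 eps1 k0 kn.
have kn' : (k <= n)%N by lia.
have [b [b0 nb bp bL pL]] := @log_params R p k k0 kn.
have [e [e0 he1 he2]] := precision_params eps0 eps1.
have [q [H [Lam [tree [rho /= [[qH Hb hk qk] [L0 Le Lb] [rho0 hrho rhoH] cnt]]]]]] :=
  scheme_params eps0 k0 kn' b0 nb e0 he1.
set K := (9 * k * H.+1)%N in cnt.
have p0 : (0 < p)%N by move: bp; case: (p) => //; rewrite muln0 leqNgt b0.
have K0 : (0 < K)%N by rewrite !muln_gt0 k0.
have NK : (2 * 4 ^ (p - q) <= K * 2 ^ b)%N.
  apply: leq_trans (_ : 9 * k * 2 ^ b <= _)%N; last first.
    by rewrite leq_mul2r leq_pmulr ?orbT.
  have : (4 ^ (p - q) <= n)%N by rewrite /n /D nE leq_exp2l // leq_subr.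
  by move: nb; rewrite -/n -mulnA; move: (k * 2 ^ b)%N => X; lia.
have [m [A [hm hA]]] := scheme_exists qH K0 L0 NK cnt rho0 hrho.
set L := ln (n%:R / k%:R) in bL *.
have L_ge0 : 0 <= L by have := ler0n R b; lra.
exists m, A; split.
  have := rows_bound k0 L0 Hb b0 hk Le hm; rewrite -(ler_nat R) !natrM => hmR.
  apply: le_trans hmR _.
  have h1 : e%:R * k%:R * b%:R <= 2 * eps ^- 2 * k%:R * (4 * L).
    by rewrite ler_pM ?mulr_ge0 ?ler_pM.
  have -> : 8 * (1000 * (1000 * 300)) * (eps ^- 2 * k%:R * L) =
      1000 * (1000 * (300 * (2 * eps ^- 2 * k%:R * (4 * L)))) :> R.
    by move: (eps ^- 2) => y; ring.
  by rewrite !ler_wpM2l.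
move=> x x0; have [t [st [ex tle err]]] := hA k eps x x0.
exists t, st; split; first exact: ex.
  have tN : (t <= 100 * 100 * (50 * (CT * (k ^ 2 * n * p ^ 5))))%N :=
    leq_trans tle (leq_mul (leqnn _) (leq_mul (leqnn _)
      (hCT p q k H b Lam k0 p0 kn' L0 Lb Hb bp qk))).
  have tR : t%:R <= 100 * 100 * (50 * (CT%:R * (k%:R ^+ 2 * n%:R * p%:R ^+ 5))) :> R.
    by move: tN; rewrite -(ler_nat R) -(natrX R k) -(natrX R p) -!natrM.
  apply: le_trans tR _; rewrite -[leRHS]mulrA -(mulrA 50 CT%:R).
  rewrite !ler_wpM2l // ?mulr_ge0 ?exprn_ge0 //.
  by rewrite lerXn2r // nnegrE ?ler0n // (le_trans _ pL).
have L_gt0 : 0 < L by have : 1 <= b%:R :> R; [rewrite ler1n | lra].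
pose cst := 100 * 192 * (eps * Num.sqrt L).
have cst0 : 0 < cst by rewrite mulr_gt0 // mulr_gt0 ?sqrtr_gt0.
have main x' : sparse k x' -> emd_norm (x - ram_output n st) <= cst * emd_norm (x - x').
  move=> sp; have [C [C0 Ck xC]] := sparse_support k0 sp.
  have CK : (9 * #|C| * H <= K)%N by rewrite /K leq_mul // leq_mul.
  apply: le_trans (err C CK) _.
  have h1 := tail_mass q H x0 C0; have h2 := dist_le_emd x C0 xC.
  have h0 : 0 <= \sum_i x i 0 * (pixel_dist i (centre C i))%:R.
    by apply: sumr_ge0 => i _; rewrite mulr_ge0.
  have emd0 := le_trans h0 h2.
  (* Without levels the tail is an empty sum, and the recovery is exact. *)
  have [H0|H0] := posnP H.
    by rewrite /tail_sum H0 big_ord0 mulr0 mulr_ge0 // ltW.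
  have sb : Num.sqrt b%:R <= 2 * Num.sqrt L.
    have -> : 2 = Num.sqrt 4 :> R by rewrite (_ : 4 = 2 ^+ 2) ?sqrtr_sqr ?ger0_norm //; ring.
    by rewrite -sqrtrM // ler_sqrt // mulr_ge0.
  rewrite -/(tail_sum q H x C) in h1.
  have tl0 : 0 <= tail_sum q H x C.
    apply: sumr_ge0 => l _; apply: sumr_ge0 => j _; case: ifP => // _.
    by rewrite mulr_ge0 // mass_ge0.
  apply: le_trans (_ : 1600 * (3 * (2 ^ q)%N%:R * eps * Num.sqrt b%:R) * tail_sum q H x C <= _).
    by rewrite ler_wpM2r // ler_wpM2l // rhoH.
  have -> : 1600 * (3 * (2 ^ q)%N%:R * eps * Num.sqrt b%:R) * tail_sum q H x C =
      48 * (100 * (eps * Num.sqrt b%:R * ((2 ^ q)%N%:R * tail_sum q H x C))) :> R by ring.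
  have -> : cst * emd_norm (x - x') =
      48 * (100 * (eps * (2 * Num.sqrt L) * (2 * emd_norm (x - x')))) by rewrite /cst; ring.
  rewrite !ler_wpM2l // ler_pM ?mulr_ge0 ?sqrtr_ge0 ?(ltW eps0) //.
    by rewrite ler_wpM2l // ltW.
  by apply: le_trans h1 _; rewrite ler_wpM2l.
(* The bound holds for each sparse [x']; after division by the positive constant it passes to the
   infimum, over a set that is nonempty because the zero image is sparse. *)
rewrite -/cst -ler_pdivrMl //; apply: lb_le_inf.
  exists (emd_norm (x - 0)), 0 => //.
  rewrite /= /sparse (_ : [set i | _]%SET = set0) ?cards0 //.
  by apply/setP => i; rewrite !inE mxE eqxx.
by move=> _ [x' sp <-]; rewrite ler_pdivrMl // main.
Qed.
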